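(* Let $V_1,\dots,V_n\in\mathcal{B}$ be simple adapted biprocesses, $M_i=\int V_i\,\sharp\, dX$ and $M_i(t)=\int_0^tV_i\,\sharp\, dX$ for $1\le i\le n$. Then $$\prod_{i=1}^nM_i=\sum_{k=1}^n\int\phi_{k+1}\Bigl[\sum_{1\le i(1)<\dots<i(k)\le n}\bigl(M_1\cdots M_{i(1)-1}\otimes M_{i(1)+1}\cdots M_{i(2)-1}\otimes\dots\otimes M_{i(k)+1}\cdots M_n\bigr)(t)\ \sharp\,\mathfrak{m}_k\bigl(V_{i(1)}(t),\dots,V_{i(k)}(t)\bigr)\Bigr]\,\sharp\, d\Delta_k(t),$$ where the product on the left is taken in the order $M_1M_2\cdots M_n$, the argument $(t)$ means that every $M_i$ is replaced by $M_i(t)$, and empty products equal $1$.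
   Context: Setting. $\mathcal{A}$ is a finite von Neumann algebra with a faithful normal trace state $\phi$; $\|S\|_p=\phi[|S|^p]^{1/p}$, $\|S\|_\infty=\|S\|$ is the operator norm, $L^p(\mathcal{A},\phi)$ are the completions of $\mathcal{A}$. $(\mathcal{A}_t)_{t\ge0}$ is an increasing family of von Neumann subalgebras of $\mathcal{A}$. $\mu$ is a compactly supported freely infinitely divisible probability measure on $\mathbb{R}$ of variance $1$; $r_k$ are its free cumulants, and $(\mu_t)_{t\ge0}$ is the free convolution semigroup whose free cumulants are $t r_k$. $X$ is a fixed adapted free stochastic measure with distribution $\mu$: a map $I\mapsto X(I)$ from finite half-open intervals $I=[a,b)\subset[0,\infty)$ to self-adjoint elements of $\mathcal{A}$ such that $X(I_1)+X(I_2)=X(I_1\cup I_2)$ when $I_1\cap I_2=\emptyset$ and $I_1\cup I_2$ is an interval; $X(I)$ has distribution $\mu_{|I|}$; $X(I_1),\dots,X(I_n)$ are freely independent for disjoint $I_1,\dots,I_n$; $X(I)\in\mathcal{A}_t$ if $I\subset[0,t)$; and $X(I)$ is freely independent from $\mathcal{A}_t$ if $I\cap[0,t)=\emptyset$. Put $X(t)=X([0,t))$. Diagonal measures. For $I=[a,b)$, $\Delta_k(I)=\lim_{N\to\infty}\sum_{i=1}^N X\bigl([a+\tfrac{i-1}{N}(b-a),a+\tfrac{i}{N}(b-a))\bigr)^k$, the limit being in operator norm (it is known to exist); $\Delta_k(t)=\Delta_k([0,t))$, $\Delta_1=X$. Each $\Delta_k$ is known to be an adapted process with freely independent stationary increments,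 and the free cumulants of $\Delta_k(t)$ are $r_n(\Delta_k(t))=t\,r_{nk}$. Biprocesses and integrals. A biprocess is a map $[0,\infty)\to\mathcal{A}\otimes\mathcal{A}^{op}$. $\mathcal{B}$ is the space of simple adapted biprocesses, spanned by $S\otimes T\,\mathbf{1}_{[a,b)}$ with $S,T\in\mathcal{A}_a$. For such a biprocess $\int (S\otimes T\mathbf{1}_{[a,b)})\,\sharp\, d\Delta_k=S(\Delta_k(b)-\Delta_k(a))T$, extended linearly; $\int_{t_1}^{t_2}U\,\sharp\, d\Delta_k=\int U\mathbf{1}_{[t_1,t_2)}\,\sharp\, d\Delta_k$. For non-simple adapted $W$ the integral is defined by continuous extension: if $W_n\in\mathcal{B}$ with $\int\|W_n-W\|_2^2ds\to0$ and $\|\int m(W_n-W)ds\|_2\to0$, then $\int W\,\sharp\, d\Delta_k$ is the limit of $\int W_n\,\sharp\, d\Delta_k$ in $L^2(\mathcal{A},\phi)$; here $m(S\otimes T)=ST$, and $\|\cdot\|_2$ on $\mathcal{A}\otimes\mathcal{A}^{op}$ comes from $\langle A\otimes B,C\otimes D\rangle=\phi[C^*A]\phi[BD^*]$. Notation. The right action $\sharp\,\mathfrak{m}_k$ is the multilinear extension of $$(a_0\otimes a_1\otimes\dots\otimes a_k)\,\sharp\,\mathfrak{m}_k(A_1\otimes B_1,\dots,A_k\otimes B_k)=a_0A_1\otimes B_1a_1A_2\otimes\dots\otimes B_{k-1}a_{k-1}A_k\otimes B_ka_k .$$ For $k\ge2$, $\phi_k:\mathcal{A}^{\otimes k}\to\mathcal{A}\otimes\mathcal{A}$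 is $\phi_k=\mathrm{id}\otimes\phi^{\otimes(k-2)}\otimes \mathrm{id}$, and its value is regarded as an element of $\mathcal{A}\otimes\mathcal{A}^{op}$. *)

(* Defs.v *)
(* MathComp / MathComp-Analysis development, over an arbitrary R : realType. *)
From HB Require Import structures.
From mathcomp Require Import all_boot all_order all_algebra.
From mathcomp Require Import complex.
From mathcomp Require Import all_classical all_reals all_analysis.
Set Implicit Arguments.
Unset Strict Implicit.
Unset Printing Implicit Defensive.
Import Order.TTheory GRing.Theory Num.Theory.
Import numFieldNormedType.Exports.
Local Open Scope classical_set_scope.
Local Open Scope ring_scope.

(** * Tracial von Neumann algebras *)

(* Inner products are linear in the first argument. *)
Definition inner_product (R : realType) (H : normedModType R[i])
    (ip : H -> H -> R[i]) : Prop :=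
  [/\ forall y (c : R[i]) x x', ip (c *: x + x') y = c * ip x y + ip x' y,
      forall x y, ip y x = (ip x y)^* &
      forall x, ip x x = `|x| ^+ 2].

Definition commutant (R : realType) (H : completeNormedModType R[i])
    (S : set (H -> H)) : set (H -> H) :=
  [set T | [/\ linear T, continuous T & forall s, S s -> T \o s = s \o T]].

(* A finite von Neumann algebra with a faithful normal trace state: a complex
   *-algebra [ws_alg], identified by the faithful representation [ws_rep] with
   an algebra of bounded operators on a Hilbert space that equals its
   bicommutant. *)
Record tracial_vN (R : realType) := TracialVN {
  ws_alg :> algType R[i];
  ws_star : ws_alg -> ws_alg;
  ws_hilbert : completeNormedModType R[i];
  ws_ip : ws_hilbert -> ws_hilbert -> R[i];
  ws_rep : ws_alg -> ws_hilbert -> ws_hilbert;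
  ws_tr : ws_alg -> R[i];
  ws_ipP : inner_product ws_ip;
  ws_repL : forall (c : R[i]) x y v,
    ws_rep (c *: x + y) v = c *: ws_rep x v + ws_rep y v;
  ws_rep1 : ws_rep 1 = id;
  ws_repM : forall x y, ws_rep (x * y) = ws_rep x \o ws_rep y;
  ws_rep_inj : injective ws_rep;
  ws_repS : forall x v w,
    ws_ip (ws_rep (ws_star x) v) w = ws_ip v (ws_rep x w);
  ws_bicommutant : commutant (commutant (range ws_rep)) = range ws_rep;
  ws_trL : forall (c : R[i]) x y, ws_tr (c *: x + y) = c * ws_tr x + ws_tr y;
  ws_tr1 : ws_tr 1 = 1;
  ws_tr_ge0 : forall x, 0 <= ws_tr (ws_star x * x);
  ws_tr_faithful : forall x, ws_tr (ws_star x * x) = 0 -> x = 0;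
  ws_trC : forall x y, ws_tr (x * y) = ws_tr (y * x);
  (* normality: if x is the least upper bound of a nonempty upward directed
     set D of self-adjoint elements, then tr x is the supremum of tr on D *)
  ws_tr_normal :
    let le x y := forall v, 0 <= ws_ip (ws_rep (y - x) v) v in
    forall (D : set ws_alg) (x : ws_alg),
    D !=set0 ->
    (forall y, D y -> ws_star y = y) ->
    (forall y z, D y -> D z -> exists w, [/\ D w, le y w & le z w]) ->
    ws_star x = x ->
    (forall y, D y -> le y x) ->
    (forall z, ws_star z = z -> (forall y, D y -> le y z) -> le x z) ->
    forall c : R[i], (forall y, D y -> ws_tr y <= c) -> ws_tr x <= c
}.

Arguments ws_star {R t}.
Arguments ws_ip {R t}.
Arguments ws_rep {R t}.
Arguments ws_tr {R t}.

Section Algebra.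
Context {R : realType} {A : tracial_vN R}.
Implicit Types (x y : A) (B : set A).

Definition opnorm x : R :=
  sup [set complex.Re `|ws_rep x v| | v in [set v | `|v| <= 1]].

Definition vN_subalgebra B : Prop :=
  (forall x, B x -> B (ws_star x)) /\
  commutant (commutant (ws_rep @` B)) = ws_rep @` B.

Definition star_subalgebra B : Prop :=
  [/\ B 1, (forall (c : R[i]) x y, B x -> B y -> B (c *: x + y)),
      (forall x y, B x -> B y -> B (x * y)) &
      (forall x, B x -> B (ws_star x))].

Definition generated (S : set A) : set A :=
  [set x | forall B, star_subalgebra B -> S `<=` B -> B x].

Definition free (I : eqType) (S : I -> set A) : Prop :=
  forall (m : nat) (i : nat -> I) (x : nat -> A),
    (0 < m)%N ->
    (forall j, (j < m)%N -> generated (S (i j)) (x j) /\ ws_tr (x j) = 0) ->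
    (forall j, (j.+1 < m)%N -> i j != i j.+1) ->
    ws_tr (\prod_(j < m) x j) = 0.

End Algebra.

(* The completion of A for |x|_2 = tr (x^* x)^{1/2}, up to isomorphism. *)
Record L2_completion (R : realType) (A : tracial_vN R) := L2Completion {
  L2_space :> completeNormedModType R[i];
  L2_ip : L2_space -> L2_space -> R[i];
  L2_inj : A -> L2_space;
  L2_ipP : inner_product L2_ip;
  L2_injL : forall (c : R[i]) (x y : A),
    L2_inj (c *: x + y) = c *: L2_inj x + L2_inj y;
  L2_injE : forall x y : A,
    L2_ip (L2_inj x) (L2_inj y) = ws_tr (ws_star y * x);
  L2_dense : dense (range L2_inj)
}.

(** * Free cumulants and free convolution semigroups *)

Section Cumulants.
Context {R : realType}.
Implicit Types (mu nu : probability (measurableTypeR R) R) (r : nat -> R).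

Definition compactly_supported mu : Prop :=
  exists K : R, mu `[- K, K]%classic = 1%E.

Definition moment mu (n : nat) : R := (\int[mu]_x (x ^+ n))%R.

Definition noncrossing (n : nat) (P : {set {set 'I_n}}) : bool :=
  [forall B in P, forall B' in P, (B != B') ==>
    [forall a : 'I_n, forall b : 'I_n, forall c : 'I_n, forall d : 'I_n,
      ~~ [&& (a < b < c)%N, (c < d)%N, a \in B, c \in B, b \in B' & d \in B']]].

(* The moment-cumulant formula, which determines [r k] for all k >= 1. *)
Definition free_cumulants mu r : Prop :=
  forall n, (0 < n)%N ->
    moment mu n =
      \sum_(P : {set {set 'I_n}} | finset.partition P [set: 'I_n] && noncrossing P)
        \prod_(B in P) r #|B|.

(* Free additive convolution adds the free cumulants, so the condition says
   that mu is the p-fold free convolution power of nu. *)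
Definition freely_infinitely_divisible mu : Prop :=
  forall p : nat, (0 < p)%N ->
    exists nu, compactly_supported nu /\
      exists2 r, free_cumulants nu r & free_cumulants mu (fun k => p%:R * r k).

(* [mut t] is the free convolution power of order t of mu. *)
Definition free_convolution_semigroup (r : nat -> R)
    (mut : R -> probability (measurableTypeR R) R) : Prop :=
  forall t, 0 <= t ->
    compactly_supported (mut t) /\ free_cumulants (mut t) (fun k => t * r k).

Definition has_distribution (A : tracial_vN R) (x : A) mu : Prop :=
  ws_star x = x /\
  forall n, ws_tr (x ^+ n) = ((moment mu n)%:C)%C.

End Cumulants.

(** * Free stochastic measures and diagonal measures *)

Section StochasticMeasure.
Context {R : realType} {A : tracial_vN R}.

Definition vN_filtration (At : R -> set A) : Prop :=
  (forall t, 0 <= t -> vN_subalgebra (At t)) /\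
  (forall s t, 0 <= s -> s <= t -> At s `<=` At t).

(* [X a b] is the value X([a,b)); the values outside 0 <= a <= b are junk. *)
Record free_stochastic_measure (At : R -> set A)
    (mut : R -> probability (measurableTypeR R) R) (X : R -> R -> A) : Prop := {
  fsm_additive : forall a b c, 0 <= a -> a <= b -> b <= c ->
    X a b + X b c = X a c;
  fsm_distribution : forall a b, 0 <= a -> a <= b ->
    has_distribution (X a b) (mut (b - a));
  fsm_free : forall (n : nat) (a b : 'I_n -> R),
    (forall i, 0 <= a i <= b i) ->
    (forall i j, i != j -> `[a i, b i[ `&` `[a j, b j[ = set0 :> set R) ->
    free (fun i => [set X (a i) (b i)]);
  fsm_adapted : forall t a b, 0 <= t -> 0 <= a -> a <= b ->
    `[a, b[ `<=` (`[0, t[ : set R) -> At t (X a b);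
  fsm_free_past : forall t a b, 0 <= t -> 0 <= a -> a <= b ->
    `[a, b[ `&` `[0, t[ = set0 :> set R ->
    free (fun c : bool => if c then [set X a b] else At t)
}.

Definition diagonal_measure (X : R -> R -> A) (k : nat) (D : R -> R -> A) : Prop :=
  forall a b, 0 <= a -> a <= b ->
    opnorm (\sum_(i < N)
        X (a + i%:R / N%:R * (b - a)) (a + i.+1%:R / N%:R * (b - a)) ^+ k
      - D a b) @[N --> \oo] --> (0 : R).

End StochasticMeasure.

(** * Algebraic tensor powers *)

Section Tensor.
Context {R : realType} {A : tracial_vN R}.

Definition set_slot (n : nat) (a : {ffun 'I_n -> A}) (i : 'I_n) (x : A) :
    {ffun 'I_n -> A} := [ffun j => if j == i then x else a j].

Definition multilinear (n : nat) (f : {ffun 'I_n -> A} -> R[i]) : Prop :=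
  forall a i (c : R[i]) x y,
    f (set_slot a i (c *: x + y)) =
      c * f (set_slot a i x) + f (set_slot a i y).

Definition mlform (n : nat) := {f : {ffun 'I_n -> A} -> R[i] | multilinear f}.

Definition pure_fun (n : nat) (a : {ffun 'I_n -> A}) : mlform n -> R[i]^o :=
  fun f => sval f a.

Definition is_tensor (n : nat) : pred (mlform n -> R[i]^o) :=
  fun u => `[< exists s : seq {ffun 'I_n -> A}, u = \sum_(a <- s) pure_fun a >].

(* The n-th algebraic tensor power of A (n >= 1), realized as a space of
   functions on the multilinear forms on A^n: a pure tensor is evaluation at a
   tuple, and finite sums of these are identified exactly when all multilinear
   forms agree on them. *)
Record tens (n : nat) := Tens {
  tens_val : mlform n -> R[i]^o;
  _ : tens_val \in @is_tensor n
}.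

HB.instance Definition _ n := [isSub for @tens_val n].
HB.instance Definition _ n := [Choice of tens n by <:].

Lemma is_tensor_submod (n : nat) : submod_closed (@is_tensor n.+1).
Proof.
split; first by apply/asboolP; exists [::]; rewrite big_nil.
move=> c u v /asboolP[s ->] /asboolP[s' ->]; apply/asboolP.
exists ([seq set_slot a ord0 (c *: a ord0) | a <- s] ++ s').
rewrite big_cat big_map /= scaler_sumr; congr (_ + _).
apply: eq_bigr => a _; apply/funext => f.
have set_id : set_slot a ord0 (a ord0) = a.
  by apply/ffunP => j; rewrite ffunE; case: eqP => // ->.
have f0 : sval f (set_slot a ord0 0) = 0.
  have /eqP := svalP f a ord0 1 0 0.
  by rewrite scaler0 addr0 mul1r -subr_eq0 opprD addrA subrr sub0r oppr_eq0 => /eqP.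
have := svalP f a ord0 c (a ord0) 0; rewrite addr0 f0 addr0 set_id.
by move=> e; rewrite {2}/pure_fun e.
Qed.

HB.instance Definition _ n :=
  GRing.isSubmodClosed.Build R[i] (mlform n.+1 -> R[i]^o) (@is_tensor n.+1)
    (@is_tensor_submod n).
HB.instance Definition _ n := [SubChoice_isSubLmodule of tens n.+1 by <:].

Lemma pure_subproof (n : nat) (a : {ffun 'I_n -> A}) : pure_fun a \in @is_tensor n.
Proof. by apply/asboolP; exists [:: a]; rewrite big_seq1. Qed.

Definition pure (n : nat) (a : {ffun 'I_n -> A}) : tens n := Tens (pure_subproof a).

Definition tensor2 (x y : A) : tens 2 :=
  pure [ffun j : 'I_2 => if j == ord0 then x else y].

(* Some expression of a tensor as a sum of pure tensors. The maps below are
   multilinear (or conjugate multilinear) in the factors, so they do not depend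
   on the choice. *)
Definition decomposition (n : nat) (u : tens n) : seq {ffun 'I_n -> A} :=
  xget [::] [set s | tens_val u = \sum_(a <- s) pure_fun a].

Definition lin_ext (n : nat) (V : nmodType) (f : {ffun 'I_n -> A} -> V)
    (u : tens n) : V := \sum_(a <- decomposition u) f a.

Definition tmul (u : tens 2) : A := lin_ext (fun a => a ord0 * a ord_max) u.

(* <A (x) B, C (x) D> = phi[C^* A] phi[B D^* ] *)
Definition tdot (u v : tens 2) : R[i] :=
  lin_ext (fun a => lin_ext (fun c =>
    ws_tr (ws_star (c ord0) * a ord0) * ws_tr (a ord_max * ws_star (c ord_max)))
    v) u.

Definition tnorm2 (u : tens 2) : R := Num.sqrt (complex.Re (tdot u u)).

(* id (x) phi (x) ... (x) phi (x) id on the (k+2)-th tensor power *)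
Definition tphi (k : nat) (u : tens k.+2) : tens 2 :=
  lin_ext (fun a =>
    (\prod_(j < k.+2 | (0 < j < k.+1)%N) ws_tr (a j)) *:
      tensor2 (a ord0) (a ord_max)) u.

Fixpoint choices (T : Type) (ss : seq (seq T)) : seq (seq T) :=
  if ss is s :: ss' then [seq x :: p | x <- s, p <- choices ss'] else [:: [::]].

(* (a_0 (x) ... (x) a_k) # m_k (A_1 (x) B_1, ..., A_k (x) B_k): slot j is
   B_j a_j A_(j+1), where B_0 = A_(k+1) = 1. *)
Definition mk_slot (k : nat) (a : {ffun 'I_k.+1 -> A})
    (p : seq {ffun 'I_2 -> A}) : {ffun 'I_k.+1 -> A} :=
  [ffun j : 'I_k.+1 =>
    nth [ffun=> 1] ([ffun=> 1] :: p) j ord_max * a j * nth [ffun=> 1] p j ord0].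

Definition sharp_mk (k : nat) (u : tens k.+1) (U : 'I_k -> tens 2) : tens k.+1 :=
  lin_ext (fun a =>
    \sum_(p <- choices [seq decomposition (U j) | j <- enum 'I_k])
      pure (mk_slot a p)) u.

End Tensor.

Arguments tens {R} A n.

(** * Biprocesses and their integrals *)

Section Biprocess.
Context {R : realType} {A : tracial_vN R} (At : R -> set A).

(* (x, y, a, b) stands for x (x) y 1_[a,b). *)
Local Notation elementary := (A * A * R * R)%type.

Definition elementary_fun (e : elementary) (t : R) : tens A 2 :=
  let: (x, y, a, b) := e in if a <= t < b then tensor2 x y else 0.

Definition elementary_adapted (e : elementary) : Prop :=
  let: (x, y, a, b) := e in [/\ 0 <= a, a <= b, At a x & At a y].

Definition simple_expr (U : R -> tens A 2) : set (seq elementary) :=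
  [set s : seq elementary |
    (forall e, e \in s -> elementary_adapted e) /\
    U = fun t => \sum_(e <- s) elementary_fun e t].

(* A biprocess is a map on [0, +oo); simple ones are extended by 0 to R. *)
Definition simple_biprocess (U : R -> tens A 2) : Prop := simple_expr U !=set0.

(* The integral of a simple adapted U against the process D, which does not
   depend on the expression of U. *)
Definition simple_integral (D : R -> A) (U : R -> tens A 2) : A :=
  \sum_(e <- xget [::] (simple_expr U))
    (let: (x, y, a, b) := e in x * (D b - D a) * y).

Definition restrict_biprocess (t1 t2 : R) (U : R -> tens A 2) : R -> tens A 2 :=
  fun t => if t1 <= t < t2 then U t else 0.

Definition adapted_biprocess (W : R -> tens A 2) : Prop :=
  forall t, 0 <= t -> exists2 s : seq (A * A),
    (forall p, p \in s -> At t p.1 /\ At t p.2) &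
    W t = \sum_(p <- s) tensor2 p.1 p.2.

Variable L2 : L2_completion A.

Definition half_line_integral (f : R -> R[i]) (c : R[i]) : Prop :=
  [/\ lebesgue_measure.-integrable `[0, +oo[ (fun s => (complex.Re (f s))%:E),
      lebesgue_measure.-integrable `[0, +oo[ (fun s => (complex.Im (f s))%:E) &
      c = Complex (\int[lebesgue_measure]_(s in `[0, +oo[) complex.Re (f s))%R
                  (\int[lebesgue_measure]_(s in `[0, +oo[) complex.Im (f s))%R].

(* z is the weak integral in L^2(A, phi) of f over [0, +oo) *)
Definition vector_integral (f : R -> A) (z : L2) : Prop :=
  forall y : A,
    half_line_integral (fun s => ws_tr (ws_star y * f s)) (L2_ip z (L2_inj L2 y)).

Definition approximates (Wn : nat -> R -> tens A 2) (W : R -> tens A 2) : Prop :=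
  [/\ forall n, simple_biprocess (Wn n),
      forall n, measurable_fun (`[0, +oo[ : set (measurableTypeR R))
                  (fun s => tnorm2 (Wn n s - W s)),
      (\int[lebesgue_measure]_(s in `[0%R, +oo[)
         ((tnorm2 (Wn n s - W s)) ^+ 2)%:E)%E @[n --> \oo] --> 0%E &
      exists2 z : nat -> L2,
        forall n, vector_integral (fun s => tmul (Wn n s - W s)) (z n) &
        z n @[n --> \oo] --> (0 : L2)].

(* W is an adapted integrable biprocess, and z is its integral against D: the
   common limit of the integrals along all approximating sequences. *)
Definition has_integral (D : R -> A) (W : R -> tens A 2) (z : L2) : Prop :=
  [/\ adapted_biprocess W,
      exists Wn, approximates Wn W &
      forall Wn, approximates Wn W ->
        L2_inj L2 (simple_integral D (Wn n)) @[n --> \oo] --> z].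

End Biprocess.

(** * The integrands of the product formula *)

Section ProductFormula.
Context {R : realType} {A : tracial_vN R}.

Definition increasing (k n : nat) (i : {ffun 'I_k -> 'I_n}) : bool :=
  [forall p : 'I_k, forall q : 'I_k, (p < q)%N ==> (i p < i q)%N].

(* M_1 ... M_(i(1)-1) (x) M_(i(1)+1) ... M_(i(2)-1) (x) ... (x) M_(i(k)+1) ... M_n;
   with indices starting from 0, slot j is the product of the M_l for
   i(j-1) < l < i(j), the bounds being absent for j = 0 and j = k. *)
Definition gaps_tensor (k n : nat) (M : 'I_n -> A) (i : {ffun 'I_k -> 'I_n}) :
    tens A k.+1 :=
  let s := [seq val (i j) | j <- enum 'I_k] in
  pure [ffun j : 'I_k.+1 =>
    \prod_(l < n | (nth 0 (0 :: map succn s) j <= l < nth n s j)%N) M l].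

(* The k-th integrand for k = k'.+1, where [M] is the family of the processes
   M_i and [V] that of the biprocesses V_i. *)
Definition product_integrand (n k' : nat) (M : 'I_n -> R -> A)
    (V : 'I_n -> R -> tens A 2) (t : R) : tens A 2 :=
  tphi (\sum_(i : {ffun 'I_k'.+1 -> 'I_n} | increasing i)
    sharp_mk (gaps_tensor (fun l => M l t) i) (fun j => V (i j) t)).

End ProductFormula.

(* Main.v *)
Require Import Defs.
From mathcomp Require Import all_boot all_order all_algebra.
From mathcomp Require Import complex.
From mathcomp Require Import all_classical all_reals all_analysis.
From mathcomp Require Import ring lra zify.

(** The formula is obtained from a discrete one, by letting the mesh of a
    partition tend to [0].

    On a partition that follows the jumps of the [V i], the increment of [M i]
    over a cell is [V i # x], where [x] is the increment of [X]. Writing the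
    product of the [M i] as the telescoping sum of its increments over the cells
    and multiplying out ([product_increment]), one gets words
    [a_0 x a_1 x .. x a_k], with factors [a_j] in the past of the cell, one for
    each choice of [k] of the indices. As [x] is free from the past, a word is
    close to [tr a_1 .. tr a_(k-1) a_0 x^k a_k] ([condense_negligible]): a centred
    factor between two occurrences of [x] leaves a term that is either orthogonal
    to the past with L2 norm of the order of the length of the cell, or of the
    order of this length to the power 3/2, and the sum of such terms over the
    cells tends to [0] ([negligible_sum]). The traces that appear are those of
    [phi_(k+1)], so the condensed words add up to the k-th integrand evaluated at
    the left end of the cell, applied to [x^k] ([ito_error]). The powers of the
    increments over finer and finer pieces of a cell add up to the diagonal
    measure of the cell, and the evaluation points may be kept at the ends of the
    cell at a small cost, since the integrands are Hoelder continuous of exponent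
    1/2 between the jumps ([riemann_compare]). Hence the product is the limit of
    Riemann sums of the integrands against the diagonal measures
    ([riemann_sum_limit]).

    These Riemann sums converge to the integrals ([holder_has_integral]). All the
    estimates rest on the isometry [isometry_Delta]: the L2 norm of a simple
    integral against [Delta k] is controlled by the two quantities that define
    the approximation of biprocesses. It follows from orthogonality of increments
    that are centred and free from the past, and from the moments of [X] over
    short intervals, which to first order are the free cumulants
    ([moment_poly]). A Hoelder biprocess is approximated by its samples at the
    points of a grid, whose integrals are the Riemann sums, and the isometry
    applied to the difference of two simple biprocesses gives the convergence for
    every approximating sequence ([simple_integral_dist]).

    Two facts about the data need a proof. The increments of [X] are bounded
    multiplication operators of L2, uniformly over the intervals contained in a
    bounded one ([X_bounded]); and the diagonal measures are additive, although
    the partitions that define them are not compatible ([Delta_add]). The second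
    one follows from their inner products, which are limits of sums of
    correlations of powers of increments ([covariance]), and these are estimated
    with mixed moments of free families ([mixed_moment]). *)

Set Implicit Arguments.
Unset Strict Implicit.
Unset Printing Implicit Defensive.
Import Order.TTheory GRing.Theory Num.Theory.
Import numFieldNormedType.Exports.
Local Open Scope classical_set_scope.
Local Open Scope ring_scope.

(** * Complex moduli and positive forms *)

Notation re := complex.Re (only parsing).
Notation "x %:c" := (real_complex _ x) (at level 2, format "x %:c") : ring_scope.

Section ComplexModulus.
Context {R : realType}.
Implicit Types (z w : R[i]) (a b : R).

(** The modulus of [R[i]] takes its values in [R[i]]; estimates need a real number. *)
Definition cabs z : R := re `|z|.

Lemma cabsE z : `|z| = (cabs z)%:c.
Proof. by rewrite /cabs normc_def. Qed.

Lemma cabs_ge0 z : 0 <= cabs z.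
Proof. by rewrite -ler0c -cabsE. Qed.

Lemma cabsM z w : cabs (z * w) = cabs z * cabs w.
Proof. by apply: complexI; rewrite rmorphM -!cabsE normrM. Qed.

Lemma cabs_add z w : cabs (z + w) <= cabs z + cabs w.
Proof. by rewrite -lecR rmorphD -!cabsE ler_normD. Qed.

Lemma cabs_sum (I : Type) (s : seq I) (P : pred I) (f : I -> R[i]) :
  cabs (\sum_(i <- s | P i) f i) <= \sum_(i <- s | P i) cabs (f i).
Proof.
elim/big_ind2: _ => [|x y x' y' h h'|//]; first by rewrite /cabs normr0.
exact: le_trans (cabs_add _ _) (lerD _ _).
Qed.

Lemma cabsN z : cabs (- z) = cabs z.
Proof. by rewrite /cabs normrN. Qed.

Lemma cabs0 : cabs 0 = 0.
Proof. by rewrite /cabs normr0. Qed.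

Lemma cabs1 : cabs 1 = 1.
Proof. by rewrite /cabs normr1. Qed.

Lemma cabs_real a : cabs a%:c = `|a|.
Proof. by rewrite /cabs normc_def /= expr0n addr0 sqrtr_sqr. Qed.

Lemma cabs_re z : `|re z| <= cabs z.
Proof. by rewrite -lecR -cabsE normc_ge_Re. Qed.

Lemma cabs_im z : `|complex.Im z| <= cabs z.
Proof.
rewrite -sqrtr_sqr /cabs normc_def /=; case: z => a b /=.
by rewrite ler_wsqrtr // lerDr sqr_ge0.
Qed.

Lemma mulcJ z : z * z^* = (cabs z ^+ 2)%:c.
Proof. by rewrite -normCK cabsE rmorphXn. Qed.

Lemma re_real_mul a z : re (a%:c * z) = a * re z.
Proof. by case: z => x y /=; rewrite mul0r subr0. Qed.

Lemma conj_real a : (a%:c)^* = a%:c.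
Proof. exact: conjc_real. Qed.

Lemma ge0_re z : 0 <= z -> z = (re z)%:c.
Proof. by move=> /ger0_real /RRe_real ->. Qed.

Lemma re_ge0 z : 0 <= z -> 0 <= re z.
Proof. by case: z => a b; rewrite lecE => /andP[]. Qed.

Lemma conjM z w : (z * w)^* = z^* * w^*.
Proof. exact: rmorphM. Qed.

Lemma conjD z w : (z + w)^* = z^* + w^*.
Proof. exact: rmorphD. Qed.

Lemma conjN z : (- z)^* = - z^*.
Proof. exact: rmorphN. Qed.

Lemma realcM a b : (a * b)%:c = a%:c * b%:c.
Proof. exact: rmorphM. Qed.

Lemma realcD a b : (a + b)%:c = a%:c + b%:c.
Proof. exact: rmorphD. Qed.

Lemma conjcc z : (z^*)^* = z.
Proof. exact: conjCK. Qed.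

End ComplexModulus.

Section PositiveForm.
Context {R : realType} (V : lmodType R[i]) (B : V -> V -> R[i]).
Hypothesis form_linear : forall y (c : R[i]) x x',
  B (c *: x + x') y = c * B x y + B x' y.
Hypothesis form_conj : forall x y, B y x = (B x y)^*.
Hypothesis form_ge0 : forall x, 0 <= B x x.

Definition fnorm (x : V) : R := Num.sqrt (re (B x x)).

Lemma formD x x' y : B (x + x') y = B x y + B x' y.
Proof. by have := form_linear y 1 x x'; rewrite scale1r mul1r. Qed.

Lemma form0 y : B 0 y = 0.
Proof. by have /eqP := formD 0 0 y; rewrite addr0 -subr_eq0 opprD addrA subrr sub0r oppr_eq0 => /eqP. Qed.

Lemma formZ c x y : B (c *: x) y = c * B x y.
Proof. by have := form_linear y c x 0; rewrite form0 !addr0. Qed.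

Lemma formDr x x' y : B y (x + x') = B y x + B y x'.
Proof. by rewrite form_conj formD rmorphD /= -!form_conj. Qed.

Lemma formZr c x y : B y (c *: x) = c^* * B y x.
Proof. by rewrite form_conj formZ rmorphM /= -form_conj. Qed.

Lemma fnorm_ge0 x : 0 <= fnorm x.
Proof. exact: sqrtr_ge0. Qed.

Lemma fnorm_sq x : B x x = (fnorm x ^+ 2)%:c.
Proof. by rewrite sqr_sqrtr ?re_ge0 // -ge0_re. Qed.

Lemma fnorm0 : fnorm 0 = 0.
Proof. by rewrite /fnorm form0 /= sqrtr0. Qed.

Lemma fnormZ c x : fnorm (c *: x) = cabs c * fnorm x.
Proof.
rewrite /fnorm formZ formZr mulrA mulcJ fnorm_sq -rmorphM /=.
rewrite sqrtrM ?sqr_ge0 // sqrtr_sqr ger0_norm ?cabs_ge0 //.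
Qed.

Lemma fnormN x : fnorm (- x) = fnorm x.
Proof. by rewrite -scaleN1r fnormZ cabsN cabs1 mul1r. Qed.

Lemma form_CS x y : cabs (B x y) <= fnorm x * fnorm y.
Proof.
set m := cabs (B x y) ^+ 2; set a := fnorm x ^+ 2; set b := fnorm y ^+ 2.
(* the form is nonnegative at x - t B(x,y) y for every real t *)
have quad t : 0 <= a - 2 * t * m + t ^+ 2 * m * b.
  have := form_ge0 (x + (- (t%:c * B x y)) *: y).
  rewrite formD !formDr !formZ !formZr !fnorm_sq (form_conj x y).
  rewrite conjN conjM conj_real -/a -/b.
  have -> : a%:c + - (t%:c * (B x y)^*) * B x y +
     (- (t%:c * B x y) * (B x y)^* +
      - (t%:c * B x y) * (- (t%:c * (B x y)^*) * b%:c)) =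
     a%:c - 2 * t%:c * (B x y * (B x y)^*) + t%:c ^+ 2 * (B x y * (B x y)^*) * b%:c.
    by ring.
  rewrite mulcJ -/m -!rmorphXn /= -(rmorph_nat (real_complex R)) -!rmorphM -rmorphB -rmorphD.
  by rewrite ler0c.
have m0 : 0 <= m by rewrite sqr_ge0.
have a0 : 0 <= a by rewrite sqr_ge0.
have b0 : 0 <= b by rewrite sqr_ge0.
have mab : m <= a * b.
  have [mz|mn0] := eqVneq m 0; first by rewrite mz mulr_ge0.
  have [bz|bn0] := eqVneq b 0.
    have := quad ((a + 1) / (2 * m)); rewrite bz mulr0 addr0.
    have -> : a - 2 * ((a + 1) / (2 * m)) * m = - 1 by field.
    by rewrite oppr_ge0 ler10.
  have bp : 0 < b by rewrite lt_def bn0.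
  have := quad b^-1.
  have -> : a - 2 * b^-1 * m + b^-1 ^+ 2 * m * b = (a * b - m) / b by field.
  by rewrite pmulr_lge0 ?invr_gt0 // subr_ge0.
by rewrite -ler_sqr ?nnegrE ?mulr_ge0 ?cabs_ge0 ?fnorm_ge0 // exprMn.
Qed.

Lemma fnorm_add x y : fnorm (x + y) <= fnorm x + fnorm y.
Proof.
rewrite -ler_sqr ?nnegrE ?addr_ge0 ?fnorm_ge0 // -lecR -fnorm_sq.
rewrite formD !formDr (form_conj x y) !fnorm_sq.
have -> : (fnorm x ^+ 2)%:c + B x y + ((B x y)^* + (fnorm y ^+ 2)%:c) =
  (fnorm x ^+ 2 + 2 * re (B x y) + fnorm y ^+ 2)%:c.
  rewrite !realcD realcM -[2%:c]/(2 %:R%:c) rmorph_nat -addcJ -[conjc _]/(_^*).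
  by ring.
have := le_trans (le_trans (ler_norm _) (cabs_re _)) (form_CS x y).
by rewrite lecR; lra.
Qed.

Lemma fnorm_sum (I : Type) (s : seq I) (f : I -> V) :
  fnorm (\sum_(i <- s) f i) <= \sum_(i <- s) fnorm (f i).
Proof.
elim: s => [|i s IH]; rewrite ?big_nil ?fnorm0 // !big_cons.
exact: le_trans (fnorm_add _ _) (lerD _ _).
Qed.

End PositiveForm.

(** * Hilbert space norms, involution and trace *)

Section RealNorm.
Context {R : realType} {V : normedModType R[i]}.

(** The norms of a normed space over [R[i]] are elements of [R[i]] as well. *)
Definition vnorm (v : V) : R := re `|v|.

Lemma vnormE v : `|v| = (vnorm v)%:c.
Proof. exact: ge0_re. Qed.

Lemma vnorm_ge0 v : 0 <= vnorm v.
Proof. by rewrite -ler0c -vnormE. Qed.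

Lemma vnorm_add v w : vnorm (v + w) <= vnorm v + vnorm w.
Proof. by rewrite -lecR realcD -!vnormE ler_normD. Qed.

Lemma vnormN v : vnorm (- v) = vnorm v.
Proof. by rewrite /vnorm normrN. Qed.

Lemma vnorm0 : vnorm 0 = 0.
Proof. by rewrite /vnorm normr0. Qed.

Lemma vnormZ c v : vnorm (c *: v) = cabs c * vnorm v.
Proof. by apply: complexI; rewrite realcM -!vnormE -cabsE normrZ. Qed.

Lemma vnorm_eq0 v : vnorm v = 0 -> v = 0.
Proof. by move=> h; apply/normr0_eq0; rewrite vnormE h. Qed.

Lemma vnormB v w : vnorm (v - w) = vnorm (w - v).
Proof. by rewrite -vnormN opprB. Qed.

Lemma vnorm_sum (I : Type) (s : seq I) (f : I -> V) :
  vnorm (\sum_(i <- s) f i) <= \sum_(i <- s) vnorm (f i).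
Proof.
elim: s => [|i s IH]; rewrite ?big_nil ?vnorm0 // !big_cons.
exact: le_trans (vnorm_add _ _) (lerD _ _).
Qed.

(** Moves all limits in L2 to the reals. *)
Lemma vcvgP (u : nat -> V) (l : V) :
  (u @ \oo --> l) <-> (vnorm (u n - l) @[n --> \oo] --> (0 : R)).
Proof.
split=> h.
  apply/cvgrPdist_le => e e0.
  have /cvgrPdist_le/(_ e%:c) := h; rewrite ltcR => /(_ e0).
  apply: filterS => n; rewrite vnormE lecR sub0r normrN ger0_norm ?vnorm_ge0 //.
  by rewrite vnormB.
apply/cvgrPdist_le => e e0.
have er : e = (re e)%:c by rewrite [LHS]ge0_re // ltW.
have e0' : 0 < re e by rewrite -ltcR -er.
have /cvgrPdist_le/(_ _ e0') := h.
apply: filterS => n; rewrite er vnormE lecR sub0r normrN ger0_norm ?vnorm_ge0 //.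
by rewrite vnormB.
Qed.

End RealNorm.

Lemma vcauchy {R : realType} {V : completeNormedModType R[i]} (u : nat -> V) :
  (forall e : R, 0 < e -> exists N, forall m n, (N <= m)%N -> (N <= n)%N ->
     vnorm (u m - u n) <= e) ->
  exists l : V, u @ \oo --> l.
Proof.
move=> h; suff uc : cvgn u by exists (limn u).
apply/cauchy_cvgP/cauchy_exP => e e0.
have er : e = (re e)%:c by rewrite [LHS]ge0_re // ltW.
have e0' : 0 < re e by rewrite -ltcR -er.
have [N hN] := h (re e / 2) ltac:(lra).
exists (u N); exists N => // n Nn.
rewrite /= -ball_normE /= er vnormE ltcR.
by apply: le_lt_trans (hN N n _ Nn) _; [exact: leqnn|lra].
Qed.

Section Hilbert.
Context {R : realType} {H : normedModType R[i]} (ip : H -> H -> R[i]).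
Hypothesis ipP : inner_product ip.

Lemma ipL y c x x' : ip (c *: x + x') y = c * ip x y + ip x' y.
Proof. by case: ipP. Qed.

Lemma ipJ x y : ip y x = (ip x y)^*.
Proof. by case: ipP. Qed.

Lemma ip_sq x : ip x x = (vnorm x ^+ 2)%:c.
Proof. by case: ipP => _ _ ->; rewrite vnormE rmorphXn. Qed.

Lemma ip_ge0 x : 0 <= ip x x.
Proof. by rewrite ip_sq ler0c sqr_ge0. Qed.

Lemma fnorm_ip x : fnorm ip x = vnorm x.
Proof. by rewrite /fnorm ip_sq /= sqrtr_sqr ger0_norm ?vnorm_ge0. Qed.

Lemma ip_CS x y : cabs (ip x y) <= vnorm x * vnorm y.
Proof. rewrite -!fnorm_ip; exact: (form_CS ipL ipJ ip_ge0). Qed.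

Lemma ip_inj v w : (forall u, ip v u = ip w u) -> v = w.
Proof.
move=> h; apply/eqP; rewrite -subr_eq0; apply/eqP/vnorm_eq0/eqP.
rewrite -sqrf_eq0; apply/eqP/complexI; rewrite -ip_sq.
have := ipL (v - w) (-1) w v; rewrite h scaleN1r addrC [_ - w]addrC => ->.
by rewrite mulN1r addNr.
Qed.

End Hilbert.

Section StarAlgebra.
Context {R : realType} {A : tracial_vN R}.
Implicit Types (x y z : A) (c : R[i]).

Local Notation ip := (@ws_ip R A).
Local Notation ipP := (ws_ipP A).

Lemma star_eq x y :
  (forall v w, ip (ws_rep x v) w = ip (ws_rep y v) w) -> x = y.
Proof.
move=> h; apply: (@ws_rep_inj R A); apply/funext => v.
by apply: (ip_inj ipP) => w.
Qed.

Lemma starM x y : ws_star (x * y) = ws_star y * ws_star x.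
Proof. by apply: star_eq => v w; rewrite ws_repS !ws_repM /= !ws_repS. Qed.

Lemma starK x : ws_star (ws_star x) = x.
Proof.
apply: star_eq => v w; rewrite ws_repS (ipJ ipP) ws_repS -(ipJ ipP).
by [].
Qed.

Lemma starL c x y : ws_star (c *: x + y) = c^* *: ws_star x + ws_star y.
Proof.
apply: star_eq => v w; rewrite ws_repS !ws_repL (ipL ipP) !ws_repS.
rewrite (ipJ ipP _ v) (ipL ipP) conjD conjM -!(ipJ ipP).
by [].
Qed.

Lemma star1 : ws_star (1 : A) = 1.
Proof. by apply: star_eq => v w; rewrite ws_repS ws_rep1. Qed.

Lemma starD x y : ws_star (x + y) = ws_star x + ws_star y.
Proof. by have := starL 1 x y; rewrite !scale1r rmorph1 scale1r. Qed.

Lemma star0 : ws_star (0 : A) = 0.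
Proof. by apply: (addrI (ws_star 0)); rewrite -starD !addr0. Qed.

Lemma starZ c x : ws_star (c *: x) = c^* *: ws_star x.
Proof. by have := starL c x 0; rewrite star0 !addr0. Qed.

Lemma starN x : ws_star (- x) = - ws_star x.
Proof. by rewrite -scaleN1r starZ rmorphN rmorph1 scaleN1r. Qed.

Lemma starB x y : ws_star (x - y) = ws_star x - ws_star y.
Proof. by rewrite starD starN. Qed.

Lemma starX x n : ws_star (x ^+ n) = ws_star x ^+ n.
Proof. by elim: n => [|n IH]; rewrite ?star1 // exprS starM IH exprSr. Qed.

Lemma star_sum (I : Type) (s : seq I) (f : I -> A) :
  ws_star (\sum_(i <- s) f i) = \sum_(i <- s) ws_star (f i).
Proof. by elim: s => [|i s IH]; rewrite ?big_nil ?star0 // !big_cons starD IH. Qed.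

Lemma trD x y : ws_tr (x + y) = ws_tr x + ws_tr y.
Proof. by have := ws_trL 1 x y; rewrite scale1r mul1r. Qed.

Lemma tr0 : ws_tr (0 : A) = 0.
Proof. by apply: (addrI (ws_tr (0 : A))); rewrite -trD !addr0. Qed.

Lemma trZ c x : ws_tr (c *: x) = c * ws_tr x.
Proof. by have := ws_trL c x 0; rewrite tr0 !addr0. Qed.

Lemma trN x : ws_tr (- x) = - ws_tr x.
Proof. by rewrite -scaleN1r trZ mulN1r. Qed.

Lemma trB x y : ws_tr (x - y) = ws_tr x - ws_tr y.
Proof. by rewrite trD trN. Qed.

Lemma tr_sum (I : Type) (s : seq I) (f : I -> A) :
  ws_tr (\sum_(i <- s) f i) = \sum_(i <- s) ws_tr (f i).
Proof. by elim: s => [|i s IH]; rewrite ?big_nil ?tr0 // !big_cons trD IH. Qed.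

(** The trace is hermitian because it is positive: the trace of
    [(x + c)^* (x + c)] is real for every scalar [c]. *)
Lemma tr_star x : ws_tr (ws_star x) = (ws_tr x)^*.
Proof.
have im c : complex.Im (c * ws_tr (ws_star x) + c^* * ws_tr x) = 0.
  have h y : complex.Im (ws_tr (ws_star y * y)) = 0.
    exact/ger0_Im/ws_tr_ge0.
  have := h (x + c *: 1); have := h x; have := h (c *: 1 : A).
  rewrite !starD !starZ !star1 !mulrDl !mulrDr !trD.
  rewrite -!scalerAl -!scalerAr !mulr1 !mul1r !trZ ws_tr1.
  move: (ws_tr (ws_star x * x)) (ws_tr x) (ws_tr (ws_star x)) => [a b] [d e] [f g].
  by case: c => k l /=; lra.
have := im 1; have := im 'i%C.
move: (ws_tr x) (ws_tr (ws_star x)) => [a b] [d e] /=.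
rewrite !(mul0r, mul1r, add0r, subr0, addr0, mulN1r, oppr0) => h1 h2.
by congr Complex; lra.
Qed.

Definition trip x y : R[i] := ws_tr (ws_star y * x).

Lemma tripL y c x x' : trip (c *: x + x') y = c * trip x y + trip x' y.
Proof. by rewrite /trip mulrDr -scalerAr ws_trL. Qed.

Lemma tripJ x y : trip y x = (trip x y)^*.
Proof. by rewrite /trip -tr_star starM starK. Qed.

Lemma trip_ge0 x : 0 <= trip x x.
Proof. exact: ws_tr_ge0. Qed.

(** The L2 norm of an element of the algebra. *)
Definition n2 : A -> R := fnorm trip.

Lemma n2_ge0 x : 0 <= n2 x. Proof. exact: fnorm_ge0. Qed.

Lemma n2_sq x : ws_tr (ws_star x * x) = (n2 x ^+ 2)%:c.
Proof. exact: (fnorm_sq trip_ge0). Qed.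

Lemma n2_add x y : n2 (x + y) <= n2 x + n2 y.
Proof. exact: (fnorm_add tripL tripJ trip_ge0). Qed.

Lemma n2Z c x : n2 (c *: x) = cabs c * n2 x.
Proof. exact: (fnormZ tripL tripJ trip_ge0). Qed.

Lemma n2N x : n2 (- x) = n2 x.
Proof. exact: (fnormN tripL tripJ trip_ge0). Qed.

Lemma n2_sub x y : n2 (x - y) <= n2 x + n2 y.
Proof. by apply: le_trans (n2_add _ _) _; rewrite n2N. Qed.

Lemma n2_0 : n2 0 = 0.
Proof. exact: (fnorm0 tripL). Qed.

Lemma n2_sum (I : Type) (s : seq I) (f : I -> A) :
  n2 (\sum_(i <- s) f i) <= \sum_(i <- s) n2 (f i).
Proof. exact: (fnorm_sum tripL tripJ trip_ge0). Qed.

Lemma n2_star x : n2 (ws_star x) = n2 x.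
Proof. by rewrite /n2 /fnorm /trip starK ws_trC. Qed.

Lemma n2_eq0 x : n2 x = 0 -> x = 0.
Proof.
by move=> h; apply: (@ws_tr_faithful R A); rewrite n2_sq h expr0n.
Qed.

Lemma n2_1 : n2 1 = 1.
Proof. by rewrite /n2 /fnorm /trip star1 mulr1 ws_tr1 sqrtr1. Qed.

Lemma tr_CS x y : cabs (ws_tr (x * y)) <= n2 x * n2 y.
Proof.
have : cabs (trip y (ws_star x)) <= n2 y * n2 (ws_star x).
  exact: (form_CS tripL tripJ trip_ge0).
by rewrite /trip starK mulrC n2_star.
Qed.

Lemma tr_n2 x : cabs (ws_tr x) <= n2 x.
Proof. by have := tr_CS x 1; rewrite !mulr1 n2_1 mulr1. Qed.

End StarAlgebra.

(** * Multiplication operators on L2 *)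

Section OperatorBound.
Context {R : realType} {A : tracial_vN R}.
Implicit Types (x y z h : A) (M : R).
Local Notation H := (ws_hilbert A).
Local Notation ip := (@ws_ip R A).
Local Notation ipP := (ws_ipP A).

(** A bicommutant consists of continuous linear maps, so that the elements of
    the algebra act by bounded operators. *)
Lemma rep_linear_continuous x : linear (ws_rep x) /\ continuous (ws_rep x).
Proof.
have : range (@ws_rep R A) (ws_rep x) by exists x.
by rewrite -ws_bicommutant => -[? ? _].
Qed.

Lemma repD x y v : ws_rep (x + y) v = ws_rep x v + ws_rep y v.
Proof. by rewrite -[x]scale1r ws_repL !scale1r. Qed.

Lemma rep0 v : ws_rep (0 : A) v = 0.
Proof. by apply: (addrI (ws_rep (0 : A) v)); rewrite -repD !addr0. Qed.

Lemma repZ c x v : ws_rep (c *: x) v = c *: ws_rep x v.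
Proof. by rewrite -[c *: x]addr0 ws_repL rep0 addr0. Qed.

Lemma repN x v : ws_rep (- x) v = - ws_rep x v.
Proof. by rewrite -scaleN1r repZ scaleN1r. Qed.

Lemma repB x y v : ws_rep (x - y) v = ws_rep x v - ws_rep y v.
Proof. by rewrite repD repN. Qed.

Lemma rep_linD x v w : ws_rep x (v + w) = ws_rep x v + ws_rep x w.
Proof.
by have [l _] := rep_linear_continuous x; have := l 1 v w; rewrite !scale1r.
Qed.

Lemma rep_lin0 x : ws_rep x 0 = 0.
Proof. by apply: (addrI (ws_rep x 0)); rewrite -rep_linD !addr0. Qed.

Lemma rep_linZ x c v : ws_rep x (c *: v) = c *: ws_rep x v.
Proof.
have [l _] := rep_linear_continuous x.
by have := l c v 0; rewrite rep_lin0 !addr0.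
Qed.

Lemma linear_bounded (f : H -> H) : linear f -> continuous f ->
  exists2 M, 0 < M & forall v, vnorm (f v) <= M * vnorm v.
Proof.
move=> fl /(_ (0 : H)).
have f0 : f 0 = 0.
  by have /eqP := fl 1 0 0; rewrite !scale1r addr0 -subr_eq0 opprD addrA subrr
    sub0r oppr_eq0 => /eqP.
have fZ c v : f (c *: v) = c *: f v by have := fl c v 0; rewrite f0 !addr0.
rewrite /continuous_at f0 => /cvgrPdist_le/(_ 1 ltr01)/nbhs_ballP[e /= e0 he].
have er : e = (re e)%:c by rewrite [LHS]ge0_re // ltW.
have e0' : 0 < re e by rewrite -ltcR -er.
exists (2 / re e); first by rewrite divr_gt0.
move=> v; have [v0|vn0] := eqVneq (vnorm v) 0.
  by rewrite (vnorm_eq0 v0) f0 !vnorm0 mulr0.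
have vp : 0 < vnorm v by rewrite lt_def vn0 vnorm_ge0.
set t := re e / (2 * vnorm v).
have t0 : 0 < t by rewrite divr_gt0 // mulr_gt0.
have := he (t%:c *: v).
rewrite -ball_normE /= !sub0r !normrN vnormE er ltcR vnormZ cabs_real (gtr0_norm t0).
have -> : t * vnorm v = re e / 2 by rewrite /t; field; rewrite vn0.
move=> /(_ ltac:(lra)); rewrite vnormE lecR fZ vnormZ cabs_real (gtr0_norm t0).
rewrite -ler_pdivlMl // mulr1 => /le_trans; apply.
by rewrite le_eqVlt; apply/orP; left; apply/eqP; rewrite /t; field; rewrite vn0 gt_eqF.
Qed.

Lemma bounded_continuous (f : H -> H) M : linear f ->
  (forall v, vnorm (f v) <= M * vnorm v) -> continuous f.
Proof.
move=> fl fb v; apply/cvgrPdist_le => e e0.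
have er : e = (re e)%:c by rewrite [LHS]ge0_re // ltW.
have e0' : 0 < re e by rewrite -ltcR -er.
have K0 : 0 < `|M| + 1 by rewrite ltr_wpDl.
have d0 : 0 < (re e / (`|M| + 1))%:c by rewrite ltcR divr_gt0.
apply/nbhs_ballP; exists ((re e / (`|M| + 1))%:c) => //= w.
rewrite -ball_normE /= vnormE ltcR => hw.
have -> : f v - f w = f (v - w) by rewrite addrC -scaleN1r -fl scaleN1r addrC.
rewrite vnormE er lecR (le_trans (fb _)) //.
apply: (@le_trans _ _ ((`|M| + 1) * vnorm (v - w))).
  by rewrite ler_wpM2r ?vnorm_ge0 // (le_trans (ler_norm _)) // lerDl.
by rewrite -ler_pdivlMl // mulrC ltW.
Qed.

Definition opbound M x := forall v, vnorm (ws_rep x v) <= M * vnorm v.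

Lemma opbound_ex x : exists2 M, 0 < M & opbound M x.
Proof. by have [l c] := rep_linear_continuous x; apply: linear_bounded. Qed.

Lemma opboundD M N x y : opbound M x -> opbound N y -> opbound (M + N) (x + y).
Proof.
by move=> hx hy v; rewrite repD mulrDl (le_trans (vnorm_add _ _)) // lerD.
Qed.

Lemma opboundZ M c x : opbound M x -> opbound (cabs c * M) (c *: x).
Proof.
by move=> hx v; rewrite repZ vnormZ -mulrA ler_wpM2l ?cabs_ge0.
Qed.

Lemma opboundM M N x y : 0 <= M ->
  opbound M x -> opbound N y -> opbound (M * N) (x * y).
Proof.
move=> M0 hx hy v; rewrite ws_repM /= -mulrA.
by apply: le_trans (hx _) _; rewrite ler_wpM2l.
Qed.

Lemma opbound_star M x : 0 <= M -> opbound M x -> opbound M (ws_star x).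
Proof.
move=> M0 hx v; set w := ws_rep (ws_star x) v.
have : vnorm w ^+ 2 <= vnorm v * (M * vnorm w).
  rewrite -lecR -(ip_sq ipP) {1}/w ws_repS.
  rewrite -[X in X <= _]RRe_real; last first.
    by rewrite -ws_repS -/w (ip_sq ipP) complex_real.
  rewrite lecR (le_trans (ler_norm _)) // (le_trans (cabs_re _)) //.
  by rewrite (le_trans (ip_CS ipP _ _)) // ler_wpM2l ?vnorm_ge0.
have [->|wn0] := eqVneq (vnorm w) 0; first by rewrite mulr_ge0 ?vnorm_ge0.
by rewrite expr2 mulrA ler_pM2r ?[vnorm v * _]mulrC // lt_def wn0 vnorm_ge0.
Qed.

Lemma opboundW M N x : M <= N -> opbound M x -> opbound N x.
Proof. by move=> MN hx v; apply: le_trans (hx v) _; rewrite ler_wpM2r ?vnorm_ge0. Qed.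

(** ** Square roots near the identity *)

(** Iterates of [z = (h + z^2) / 2], whose solution is [1 - (1 - h)^(1/2)]. *)
Fixpoint sqrt_iter h n : A :=
  if n is n'.+1 then 2^-1 *: (h + sqrt_iter h n' * sqrt_iter h n') else 0.

Lemma cabs_half : cabs (2^-1 : R[i]) = 2^-1.
Proof.
have -> : (2^-1 : R[i]) = (2^-1)%:c by rewrite rmorphV ?unitfE ?pnatr_eq0 // rmorph_nat.
by rewrite cabs_real ger0_norm // invr_ge0.
Qed.

Lemma sqrt_iter_bound h n : opbound 2^-1 h -> opbound 2^-1 (sqrt_iter h n).
Proof.
move=> hh; elim: n => [|n IH] /=.
  by move=> v; rewrite rep0 vnorm0 mulr_ge0 ?invr_ge0 ?vnorm_ge0.
have := opboundZ 2^-1 (opboundD hh (opboundM _ IH IH)).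
rewrite cabs_half => /(_ ltac:(lra)); apply: opboundW.
lra.
Qed.

Lemma sqrt_iter_star h n : ws_star h = h -> ws_star (sqrt_iter h n) = sqrt_iter h n.
Proof.
move=> hs; elim: n => [|n IH] /=; first exact: star0.
rewrite starZ starD starM IH hs; congr (_ *: _).
have -> : (2^-1 : R[i]) = (2^-1)%:c by rewrite rmorphV ?unitfE ?pnatr_eq0 // rmorph_nat.
exact: conj_real.
Qed.

Lemma sqrt_iter_step h n : opbound 2^-1 h ->
  opbound (2^-1 ^+ n) (sqrt_iter h n.+1 - sqrt_iter h n).
Proof.
move=> hh; elim: n => [|n IH].
  rewrite expr0 /= mul0r addr0 subr0; apply: opboundW (opboundZ _ hh).
  by rewrite cabs_half; lra.
set z := sqrt_iter h n.+1; set w := sqrt_iter h n.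
have -> : sqrt_iter h n.+2 - z = 2^-1 *: (z * (z - w) + (z - w) * w).
  rewrite {1}/z /= -/z -/w -scalerBr opprD addrACA subrr add0r.
  by rewrite mulrBr mulrBl addrA subrK.
have hz := sqrt_iter_bound n.+1 hh; have hw := sqrt_iter_bound n hh.
apply: opboundW (opboundZ _ (opboundD (opboundM _ hz IH) (opboundM _ IH hw))).
- by rewrite cabs_half exprS; lra.
- by rewrite invr_ge0.
- by rewrite exprn_ge0 // invr_ge0.
Qed.

Lemma le0_geometric (a C : R) : (forall n, a <= C * 2^-1 ^+ n) -> a <= 0.
Proof.
move=> h; rewrite leNgt; apply/negP => a0.
have : C * 2^-1 ^+ n @[n --> \oo] --> C * 0.
  by apply: cvgM; [exact: cvg_cst|apply: cvg_expr; rewrite ger0_norm ?invr_ge0 // invf_lt1 // ltr1n].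
rewrite mulr0 => /cvgrPdist_lt/(_ _ a0)[N _ /(_ N (leqnn N))] /=.
rewrite sub0r normrN => /(le_lt_trans (ler_norm _)).
by rewrite ltNge h.
Qed.

(** The bicommutant condition makes the algebra complete for the operator
    norm: the pointwise limit still commutes with the commutant. *)
Lemma geometric_limit (z : nat -> A) :
  (forall n, opbound (2^-1 ^+ n) (z n.+1 - z n)) ->
  exists x, forall n, opbound (2 * 2^-1 ^+ n) (x - z n).
Proof.
move=> hz.
have tail m n v : vnorm (ws_rep (z (n + m)%N) v - ws_rep (z n) v) <=
    (2 * 2^-1 ^+ n - 2 * 2^-1 ^+ (n + m)) * vnorm v.
  elim: m => [|m IH]; first by rewrite addn0 !subrr vnorm0 mul0r.
  have := hz (n + m)%N v; rewrite -addnS repB => h1.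
  have -> : ws_rep (z (n + m.+1)%N) v - ws_rep (z n) v =
    (ws_rep (z (n + m.+1)%N) v - ws_rep (z (n + m)%N) v) +
    (ws_rep (z (n + m)%N) v - ws_rep (z n) v) by rewrite addrA subrK.
  apply: le_trans (vnorm_add _ _) _; apply: le_trans (lerD h1 IH) _.
  by rewrite -mulrDl ler_wpM2r ?vnorm_ge0 // addnS exprS; lra.
have half_ge0 n : 0 <= 2^-1 ^+ n :> R by rewrite exprn_ge0 // invr_ge0.
have tail' m n v : (n <= m)%N ->
    vnorm (ws_rep (z m) v - ws_rep (z n) v) <= 2 * 2^-1 ^+ n * vnorm v.
  move=> nm; rewrite -(subnKC nm); apply: le_trans (tail _ _ _) _.
  by rewrite ler_wpM2r ?vnorm_ge0 // gerBl mulr_ge0.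
have lim_ex v : exists l : H, forall n,
    vnorm (l - ws_rep (z n) v) <= 2 * 2^-1 ^+ n * vnorm v.
  have [l hl] : exists l : H, (fun n => ws_rep (z n) v) @ \oo --> l.
    apply: vcauchy => e e0.
    have : 4 * vnorm v * 2^-1 ^+ n @[n --> \oo] --> (4 * vnorm v) * 0.
      by apply: cvgM; [exact: cvg_cst|apply: cvg_expr; rewrite ger0_norm ?invr_ge0 // invf_lt1 // ltr1n].
    rewrite mulr0 => /cvgrPdist_le/(_ _ e0)[N _ /(_ N (leqnn N))] /=.
    rewrite sub0r normrN => /(le_trans (ler_norm _)) hN.
    exists N => m n Nm Nn.
    have -> : ws_rep (z m) v - ws_rep (z n) v = (ws_rep (z m) v - ws_rep (z N) v) -
       (ws_rep (z n) v - ws_rep (z N) v) by rewrite opprB addrA subrK.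
    apply: le_trans (vnorm_add _ _) _; rewrite vnormN.
    by have := tail' _ _ v Nm; have := tail' _ _ v Nn; lra.
  exists l => n; apply/ler_addgt0Pr => e e0.
  move/vcvgP: hl => /cvgrPdist_le/(_ _ e0)[N _ hN].
  have := hN (maxn N n) (leq_maxl _ _); rewrite /= sub0r normrN ger0_norm ?vnorm_ge0 // => h1.
  have h2 := tail' _ _ v (leq_maxr N n).
  have -> : l - ws_rep (z n) v = (ws_rep (z (maxn N n)) v - ws_rep (z n) v) -
    (ws_rep (z (maxn N n)) v - l) by rewrite opprB [RHS]addrC subrKA.
  by apply: le_trans (vnorm_add _ _) _; rewrite vnormN lerD.
have [T hT] := choice lim_ex.
have T_lin : linear T.
  move=> c v w; apply/eqP; rewrite -subr_eq0; apply/eqP/vnorm_eq0/le_anti.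
  rewrite vnorm_ge0 andbT.
  apply: (@le0_geometric _ (2 * (vnorm (c *: v + w) + cabs c * vnorm v + vnorm w))) => n.
  have -> : T (c *: v + w) - (c *: T v + T w) =
     (T (c *: v + w) - ws_rep (z n) (c *: v + w)) -
     (c *: (T v - ws_rep (z n) v) + (T w - ws_rep (z n) w)).
    by rewrite rep_linD rep_linZ scalerBr [in RHS]addrACA -[in RHS]opprD opprB subrKA.
  apply: le_trans (vnorm_add _ _) _; rewrite vnormN.
  have h1 := hT (c *: v + w) n; have h3 := hT w n.
  have h2 : vnorm (c *: (T v - ws_rep (z n) v)) <= cabs c * (2 * 2^-1 ^+ n * vnorm v).
    by rewrite vnormZ ler_wpM2l ?cabs_ge0.
  have := vnorm_add (c *: (T v - ws_rep (z n) v)) (T w - ws_rep (z n) w).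
  by lra.
have [M0 M0p hM0] := opbound_ex (z 0).
have T_bd v : vnorm (T v) <= (2 + M0) * vnorm v.
  have -> : T v = (T v - ws_rep (z 0) v) + ws_rep (z 0) v by rewrite subrK.
  apply: le_trans (vnorm_add _ _) _; have := hT v 0%N; have := hM0 v.
  by rewrite expr0; lra.
have : commutant (commutant (range (@ws_rep R A))) T.
  split=> //; first exact: bounded_continuous T_bd.
  move=> s [s_lin s_cont s_com]; apply/funext => v /=.
  have [Ms Msp hs] := linear_bounded s_lin s_cont.
  apply/eqP; rewrite -subr_eq0; apply/eqP/vnorm_eq0/le_anti.
  rewrite vnorm_ge0 andbT.
  apply: (@le0_geometric _ (4 * (Ms * vnorm v))) => n.
  have sE : s (ws_rep (z n) v) = ws_rep (z n) (s v).
    by have := s_com (ws_rep (z n)) ltac:(by exists (z n)) => /(congr1 (fun f => f v)).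
  have sB w w' : s w - s w' = s (w - w') by rewrite addrC -scaleN1r -s_lin scaleN1r addrC.
  have -> : T (s v) - s (T v) = (T (s v) - ws_rep (z n) (s v)) -
      s (T v - ws_rep (z n) v) by rewrite -sB sE opprB addrA subrK.
  apply: le_trans (vnorm_add _ _) _; rewrite vnormN.
  have h1 := hT (s v) n; have h2 := hs (T v - ws_rep (z n) v).
  have h3 : Ms * vnorm (T v - ws_rep (z n) v) <= Ms * (2 * 2^-1 ^+ n * vnorm v).
    by rewrite ler_wpM2l // ltW.
  have h4 : 2 * 2^-1 ^+ n * vnorm (s v) <= 2 * 2^-1 ^+ n * (Ms * vnorm v).
    by rewrite ler_wpM2l // mulr_ge0.
  by lra.
rewrite ws_bicommutant => -[x _ xT]; exists x => n v.
by rewrite repB xT.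
Qed.

(** [1 - h = (1 - z)^2], where [z] is the fixed point of [z = (h + z^2) / 2]. *)
Lemma sqrt_near1 h : ws_star h = h -> opbound 2^-1 h ->
  exists z, 1 - h = ws_star z * z.
Proof.
move=> hs hh; have [x hx] := geometric_limit (fun n => sqrt_iter_step n hh).
have half_ge0 n : 0 <= 2^-1 ^+ n :> R by rewrite exprn_ge0 // invr_ge0.
have op_eq0 y C : (forall n, opbound (C * 2^-1 ^+ n) y) -> y = 0.
  move=> hy; apply: (@ws_rep_inj R A); apply/funext => v.
  rewrite rep0; apply/vnorm_eq0/le_anti; rewrite vnorm_ge0 andbT.
  apply: (@le0_geometric _ (C * vnorm v)) => n.
  by rewrite mulrAC; apply: hy.
have xs : ws_star x = x.
  apply/eqP; rewrite -subr_eq0; apply/eqP/(op_eq0 _ 4) => n.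
  have -> : ws_star x - x = ws_star (x - sqrt_iter h n) + (-1) *: (x - sqrt_iter h n).
    by rewrite starB sqrt_iter_star // scaleN1r opprB addrA subrK.
  apply: opboundW (opboundD (opbound_star _ (hx n)) (opboundZ _ (hx n))).
    by rewrite cabsN cabs1; lra.
  by rewrite mulr_ge0.
have [Mx Mx0 hMx] := opbound_ex x.
have xfix : x = 2^-1 *: (h + x * x).
  apply/eqP; rewrite -subr_eq0; apply/eqP/(op_eq0 _ (4 + 2 * Mx)) => n.
  set w := sqrt_iter h n.
  have -> : x - 2^-1 *: (h + x * x) = (x - sqrt_iter h n.+1) +
      (- 2^-1) *: ((x - w) * x + w * (x - w)).
    rewrite /= -/w mulrBl mulrBr addrA subrK scaleNr -addrA -opprD -scalerDr.
    by rewrite [x * x - _]addrC addrA addrK.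
  have hw := sqrt_iter_bound n hh.
  apply: opboundW (opboundD (hx n.+1) (opboundZ _ (opboundD (opboundM _ (hx n) hMx)
    (opboundM _ hw (hx n))))).
  - rewrite cabsN cabs_half exprS; have := half_ge0 n; have : 0 <= Mx * 2^-1 ^+ n.
      by rewrite mulr_ge0 // ltW.
    by lra.
  - by rewrite mulr_ge0.
  - by rewrite invr_ge0.
exists (1 - x); rewrite starB star1 xs mulrBl !mulrBr mulr1 mul1r.
have {1}-> : h = x + x - x * x.
  have e : x + x = h + x * x.
    rewrite -mulr2n -scaler_nat {1}xfix scalerA.
    by rewrite divff ?pnatr_eq0 // scale1r.
  by rewrite e addrK.
by rewrite mulr1 !opprB opprD !addrA; congr (_ - _); rewrite addrAC.
Qed.

(** The trace of [y^* (1 - h) y] is nonnegative when [1 - h] is of the form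
    [z^* z]; here [h = x^* x / (2 M^2)], whose norm is at most [1/2]. *)
Lemma n2_opbound M x y : 0 < M -> opbound M x -> n2 (x * y) <= 2 * M * n2 y.
Proof.
move=> M0 hx; set c := (2 * M ^+ 2)^-1; set h := c%:c *: (ws_star x * x).
have c0 : 0 < c by rewrite invr_gt0 mulr_gt0 // exprn_gt0.
have hs : ws_star h = h by rewrite starZ starM starK conj_real.
have hb : opbound 2^-1 h.
  apply: opboundW (opboundZ _ (opboundM (ltW M0) (opbound_star (ltW M0) hx) hx)).
  rewrite cabs_real gtr0_norm // le_eqVlt; apply/orP; left; apply/eqP.
  by rewrite /c; field; rewrite gt_eqF.
have [z hz] := sqrt_near1 hs hb.
have := ws_tr_ge0 (z * y).
rewrite starM -mulrA [ws_star z * _]mulrA -hz mulrBl mulrBr mul1r trB n2_sq.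
have e : ws_star y * (ws_star x * x * y) = ws_star (x * y) * (x * y).
  by rewrite starM !mulrA.
rewrite /h -scalerAl -scalerAr trZ e n2_sq -realcM.
rewrite -rmorphB ler0c subr_ge0 => h1.
have h2 : n2 (x * y) ^+ 2 <= (2 * M * n2 y) ^+ 2.
  have : c^-1 * (c * n2 (x * y) ^+ 2) <= c^-1 * n2 y ^+ 2.
    by rewrite ler_wpM2l // invr_ge0 ltW.
  rewrite mulKf ?gt_eqF // => /le_trans; apply; rewrite /c invrK.
  have : 0 <= M ^+ 2 * n2 y ^+ 2 by rewrite mulr_ge0 ?sqr_ge0.
  by rewrite !exprMn; lra.
by rewrite -ler_sqr ?nnegrE ?mulr_ge0 ?n2_ge0 // ltW.
Qed.

(** The estimates use elements of the algebra only as left and right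
    multipliers of L2, for which the best constant need not be known. *)
Definition l2bounded C x :=
  (forall y, n2 (x * y) <= C * n2 y) /\ (forall y, n2 (y * x) <= C * n2 y).

(** The adjoint exchanges left and right multiplication. *)
Lemma l2bounded_left C x :
  (forall y, n2 (x * y) <= C * n2 y) -> (forall y, n2 (ws_star x * y) <= C * n2 y) ->
  l2bounded C x.
Proof.
move=> h1 h2; split=> // y; rewrite -n2_star starM -(n2_star y); exact: h2.
Qed.

Lemma l2bounded_ex x : exists2 C, 0 <= C & l2bounded C x.
Proof.
have [M M0 hM] := opbound_ex x; exists (2 * M); first by rewrite mulr_ge0 // ltW.
by apply: l2bounded_left => y; apply: n2_opbound => //; apply: opbound_star => //; apply: ltW.
Qed.

Lemma l2boundedW C D x : C <= D -> l2bounded C x -> l2bounded D x.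
Proof.
move=> CD [h1 h2]; split=> y; [apply: le_trans (h1 y) _|apply: le_trans (h2 y) _];
by rewrite ler_wpM2r ?n2_ge0.
Qed.

Lemma l2boundedD C D x y : l2bounded C x -> l2bounded D y -> l2bounded (C + D) (x + y).
Proof.
move=> [h1 h2] [g1 g2]; split=> z; rewrite ?mulrDl ?[z * _]mulrDr;
  by rewrite (le_trans (n2_add _ _)) // lerD.
Qed.

Lemma l2boundedM C D x y : 0 <= C -> 0 <= D ->
  l2bounded C x -> l2bounded D y -> l2bounded (C * D) (x * y).
Proof.
move=> C0 D0 [h1 h2] [g1 g2]; split=> z.
  by rewrite -!mulrA; apply: le_trans (h1 _) _; rewrite ler_wpM2l.
rewrite mulrA [C * D]mulrC -[leRHS]mulrA; apply: le_trans (g2 _) _.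
by rewrite ler_wpM2l.
Qed.

Lemma l2boundedZ C c x : l2bounded C x -> l2bounded (cabs c * C) (c *: x).
Proof.
move=> [h1 h2]; split=> z; rewrite -[leRHS]mulrA.
  by rewrite -scalerAl n2Z ler_wpM2l ?cabs_ge0.
by rewrite -scalerAr n2Z ler_wpM2l ?cabs_ge0.
Qed.

Lemma l2bounded1 : l2bounded 1 1.
Proof. by split=> y; rewrite (mul1r, mulr1) mul1r. Qed.

Lemma l2bounded0 : l2bounded 0 0.
Proof. by split=> y; rewrite (mul0r, mulr0) n2_0 mul0r. Qed.

Lemma n2_l2bounded C x : l2bounded C x -> n2 x <= C.
Proof. by move=> [/(_ 1)]; rewrite n2_1 !mulr1. Qed.

Lemma has_ubound_opnorm x :
  has_ubound [set complex.Re `|ws_rep x v| | v in [set v | `|v| <= 1]].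
Proof.
have [M M0 hM] := opbound_ex x; exists M => _ [v /= v1 <-].
rewrite -/(vnorm _) (le_trans (hM _)) //.
by rewrite -[leRHS]mulr1 ler_wpM2l ?(ltW M0) // -lecR -vnormE.
Qed.

Lemma opnorm_bound x : opbound (opnorm x) x.
Proof.
move=> v; have [v0|vn0] := eqVneq (vnorm v) 0.
  by rewrite (vnorm_eq0 v0) rep_lin0 !vnorm0 mulr0.
have vp : 0 < vnorm v by rewrite lt_def vn0 vnorm_ge0.
rewrite -ler_pdivrMr // mulrC.
have -> : (vnorm v)^-1 * vnorm (ws_rep x v) = vnorm (ws_rep x (((vnorm v)^-1)%:c *: v)).
  by rewrite rep_linZ vnormZ cabs_real gtr0_norm // invr_gt0.
apply: ub_le_sup; first exact: has_ubound_opnorm.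
exists (((vnorm v)^-1)%:c *: v) => //=.
by rewrite vnormE vnormZ cabs_real gtr0_norm ?invr_gt0 // mulVf // lexx.
Qed.

Lemma opnorm_ge0 x : 0 <= opnorm x.
Proof.
apply: ub_le_sup; first exact: has_ubound_opnorm.
by exists 0; rewrite /= ?normr0 // rep_lin0 normr0.
Qed.

(** Turns the norm limits that define the diagonal measures into L2 limits. *)
Lemma n2_opnorm x : n2 x <= 2 * opnorm x.
Proof.
apply/ler_addgt0Pr => e e0.
have h : opbound (opnorm x + e / 2) x.
  by apply: opboundW (opnorm_bound x); rewrite lerDl; lra.
have := n2_opbound 1 _ h; rewrite n2_1 !mulr1 => /(_ _)/le_trans; apply; last by lra.
by have := opnorm_ge0 x; lra.
Qed.

End OperatorBound.

(** * Subalgebras, centring and freeness *)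

Section Subalgebras.
Context {R : realType} {A : tracial_vN R}.
Implicit Types (x y : A) (B : set A).

(** Being in a bicommutant means commuting with the commutant. *)
Lemma vN_star_subalgebra B : vN_subalgebra B -> star_subalgebra B.
Proof.
move=> [Bstar Bbi].
have inB x : (forall s, commutant (ws_rep @` B) s -> ws_rep x \o s = s \o ws_rep x) -> B x.
  move=> h; have : commutant (commutant (ws_rep @` B)) (ws_rep x).
    by split=> //; case: (rep_linear_continuous x).
  by rewrite Bbi => -[y By] /(@ws_rep_inj R A) <-.
have com x s : B x -> commutant (ws_rep @` B) s -> forall v, s (ws_rep x v) = ws_rep x (s v).
  move=> Bx [_ _ hs] v; have := hs (ws_rep x) (ex_intro2 _ _ x Bx erefl).
  by move/(congr1 (fun f => f v)).
split=> [|c x y Bx By|x y Bx By|]; last exact: Bstar.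
- by apply: inB => s hs; rewrite ws_rep1.
- apply: inB => s hs; apply/funext => v /=; rewrite !ws_repL.
  by have [sl _ _] := hs; rewrite sl (com x s) // (com y s).
- by apply: inB => s hs; apply/funext => v /=; rewrite !ws_repM /= (com x s) // (com y s).
Qed.

Section Closure.
Variables (B : set A) (hB : star_subalgebra B).

Lemma sub1 : B 1. Proof. by case: hB. Qed.
Lemma subL c x y : B x -> B y -> B (c *: x + y). Proof. by case: hB => _ h _ _; apply: h. Qed.
Lemma subM x y : B x -> B y -> B (x * y). Proof. by case: hB => _ _ h _; apply: h. Qed.
Lemma subS x : B x -> B (ws_star x). Proof. by case: hB => _ _ _; apply. Qed.
Lemma subD x y : B x -> B y -> B (x + y).
Proof. by move=> Bx By; rewrite -[x]scale1r; apply: subL. Qed.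
Lemma sub0 : B 0.
Proof. by rewrite -[0](addNr 1) -scaleN1r; apply: subL; exact: sub1. Qed.
Lemma subZ c x : B x -> B (c *: x).
Proof. by move=> Bx; rewrite -[_ *: _]addr0; apply: subL => //; exact: sub0. Qed.
Lemma subN x : B x -> B (- x). Proof. by rewrite -scaleN1r; apply: subZ. Qed.
Lemma subB x y : B x -> B y -> B (x - y).
Proof. by move=> Bx By; apply: subD => //; apply: subN. Qed.
Lemma subX x n : B x -> B (x ^+ n).
Proof. by move=> Bx; elim: n => [|n IH]; [exact: sub1|rewrite exprS; apply: subM]. Qed.
Lemma sub_sum (I : Type) (s : seq I) (f : I -> A) :
  (forall i, B (f i)) -> B (\sum_(i <- s) f i).
Proof.
move=> h; elim: s => [|i s IH]; rewrite ?big_nil ?big_cons; first exact: sub0.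
exact: subD.
Qed.
End Closure.

Lemma generated_subalgebra (S : set A) : star_subalgebra (generated S).
Proof.
split=> [B hB _|c x y hx hy B hB SB|x y hx hy B hB SB|x hx B hB SB].
- exact: sub1.
- by apply: subL => //; [apply: hx|apply: hy].
- by apply: subM => //; [apply: hx|apply: hy].
- by apply: subS => //; apply: hx.
Qed.

Lemma sub_generated (S : set A) x : S x -> generated S x.
Proof. by move=> Sx B _; apply. Qed.

Definition centre x : A := x - (ws_tr x) *: 1.

Lemma tr_centre x : ws_tr (centre x) = 0.
Proof. by rewrite trB trZ ws_tr1 mulr1 subrr. Qed.

Lemma centreE x : x = centre x + (ws_tr x) *: 1.
Proof. by rewrite subrK. Qed.

Lemma centre_mid l x y :
  l * x * y = l * centre x * y + ws_tr x *: (l * y).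
Proof. by rewrite {1}(centreE x) mulrDr mulrDl -scalerAr mulr1 -scalerAl. Qed.

Lemma tr_centre_mid l x y :
  ws_tr (l * x * y) = ws_tr (l * centre x * y) + ws_tr x * ws_tr (l * y).
Proof.
by rewrite centre_mid trD trZ.
Qed.

Lemma tr_centre_left x y :
  ws_tr (x * y) = ws_tr (centre x * y) + ws_tr x * ws_tr y.
Proof. by have := tr_centre_mid 1 x y; rewrite !mul1r. Qed.

Lemma tr_centre_right x y :
  ws_tr (y * x) = ws_tr (y * centre x) + ws_tr x * ws_tr y.
Proof. by have := tr_centre_mid y x 1; rewrite !mulr1. Qed.

Lemma sub_centre B x : star_subalgebra B -> B x -> B (centre x).
Proof. by move=> hB Bx; apply: subB => //; apply: subZ => //; apply: sub1. Qed.

Lemma star_centre x : ws_star (centre x) = centre (ws_star x).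
Proof. by rewrite /centre starB starZ star1 tr_star. Qed.

Lemma n2_centre x : n2 (centre x) <= n2 x.
Proof.
rewrite -ler_sqr ?nnegrE ?n2_ge0 // -lecR -!n2_sq star_centre.
have -> : ws_tr (centre (ws_star x) * centre x) =
    ws_tr (ws_star x * x) - (cabs (ws_tr x) ^+ 2)%:c.
  rewrite -mulcJ -tr_star {2}/centre mulrBr -scalerAr mulr1 trB trZ tr_centre mulr0 subr0.
  by rewrite /centre mulrBl -scalerAl mul1r trB trZ mulrC.
by rewrite gerBl ler0c sqr_ge0.
Qed.

(** Freeness in terms of lists of centred factors: a recursion on the list is
    easier to check on a given word than conditions on its indices. *)
Fixpoint alternates (F : bool -> set A) (c : bool) (l : seq A) : Prop :=
  if l is x :: l' then [/\ F c x, ws_tr x = 0 & alternates F (~~ c) l'] else True.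

Lemma free_alternates (S F : bool -> set A) :
  Defs.free S -> (forall c, F c `<=` generated (S c)) ->
  forall c l, l != [::] -> alternates F c l -> ws_tr (\prod_(x <- l) x) = 0.
Proof.
move=> hf FS c l l0 hl.
have alt_nth j d m : alternates F d m -> (j < size m)%N ->
    F (odd j (+) d) (nth 1 m j) /\ ws_tr (nth 1 m j) = 0.
  elim: m d j => [|x m IH] d [|j] //= [hx tx hm] jm //.
  by have := IH _ _ hm jm; rewrite addbN addNb.
rewrite (big_nth 1) big_mkord.
apply: (hf (size l) (fun j => odd j (+) c)).
- by rewrite lt0n size_eq0.
- by move=> j jl; have [h1 h2] := alt_nth j _ _ hl jl; split=> //; apply: FS.
- by move=> j _ /=; case: (odd j); case: c {hl}.
Qed.

End Subalgebras.

Section FreePair.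
Context {R : realType} {A : tracial_vN R} (B G : set A).
Hypothesis (hB : star_subalgebra B) (hG : star_subalgebra G).
Let F c := if c then G else B.
Hypothesis hfree : forall c l, l != [::] -> alternates F c l ->
  ws_tr (\prod_(x <- l) x) = 0.

Implicit Types (b x y z : A).

Let bigE := (big_cons, big_nil, mulr1).

Lemma free_tr_mul b x : B b -> G x -> ws_tr (b * x) = ws_tr b * ws_tr x.
Proof.
move=> Bb Gx; rewrite tr_centre_left (tr_centre_right x) tr_centre mulr0 addr0.
have := @hfree false [:: centre b; centre x] isT; rewrite !bigE => ->; first by rewrite add0r.
by do !split; rewrite ?tr_centre //; apply: sub_centre.
Qed.

(** Centring [b'], then [b], leaves alternating centred words, except where
    both are replaced with their traces. *)
Lemma free_tr3 b x y : B b -> G x -> ws_tr x = 0 -> G y -> ws_tr y = 0 ->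
  forall b', B b' -> ws_tr (b * x * b' * y) = ws_tr b * ws_tr b' * ws_tr (x * y).
Proof.
move=> Bb Gx tx Gy ty b' Bb'.
have cB b0 : B b0 -> B (centre b0) by apply: sub_centre.
have altE (l : seq A) c : l != [::] -> alternates F c l -> ws_tr (\prod_(u <- l) u) = 0.
  exact: hfree.
rewrite tr_centre_mid.
have -> : ws_tr (b * x * centre b' * y) = 0.
  rewrite -2!mulrA tr_centre_left !mulrA.
  have := @altE [:: centre b; x; centre b'; y] false isT; rewrite !bigE !mulrA => ->.
    have := @altE [:: x; centre b'; y] true isT; rewrite !bigE !mulrA => ->.
      by rewrite mulr0 addr0.
    by do !split; rewrite ?tr_centre //; apply: cB.
  by do !split; rewrite ?tr_centre //; apply: cB.
rewrite add0r -mulrA free_tr_mul //; last exact: subM.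
by rewrite mulrCA mulrA.
Qed.

(** In the trace of [(x b y)^* (x b y)], first [x^* x] and then [b^* b] may be
    replaced with its trace: the centred parts give alternating words. *)
Lemma free_centre_mid b x y : B b -> ws_tr b = 0 ->
  G x -> G y -> ws_tr x = 0 -> ws_tr y = 0 ->
  n2 (x * b * y) = n2 x * n2 b * n2 y.
Proof.
move=> Bb tb Gx Gy tx ty.
have trS z : ws_tr z = 0 -> ws_tr (ws_star z) = 0 by move=> h; rewrite tr_star h rmorph0.
apply/eqP; rewrite -(@eqrXn2 _ 2) ?mulr_ge0 ?n2_ge0 //; apply/eqP/complexI.
rewrite -n2_sq !starM !mulrA.
have -> : ws_star y * ws_star b * ws_star x * x * b * y =
  ws_star y * ws_star b * (ws_star x * x) * b * y by rewrite !mulrA.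
rewrite -[_ * b * y]mulrA tr_centre_mid !mulrA.
have := @hfree true [:: ws_star y; ws_star b; centre (ws_star x * x); b; y] isT.
rewrite !bigE !mulrA => ->; last first.
  by do !split; rewrite ?tr_centre //; (try exact: trS); (try exact: subS);
    apply: sub_centre => //; apply: subM => //; apply: subS.
rewrite add0r n2_sq.
have -> : ws_star y * ws_star b * b * y = ws_star y * (ws_star b * b) * y by rewrite !mulrA.
rewrite tr_centre_mid.
have := @hfree true [:: ws_star y; centre (ws_star b * b); y] isT.
rewrite !bigE !mulrA => ->; last first.
  by do !split; rewrite ?tr_centre //; (try exact: trS); (try exact: subS);
    apply: sub_centre => //; apply: subM => //; apply: subS.
by rewrite add0r !n2_sq -!realcM !exprMn mulrA.
Qed.

Lemma free_centre_mid2 b b' x y z : B b -> ws_tr b = 0 -> B b' -> ws_tr b' = 0 ->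
  G x -> G y -> G z -> ws_tr x = 0 -> ws_tr y = 0 -> ws_tr z = 0 ->
  n2 (x * b * y * b' * z) = n2 x * n2 b * (n2 y * n2 b' * n2 z).
Proof.
move=> Bb tb Bb' tb' Gx Gy Gz tx ty tz.
have trS u : ws_tr u = 0 -> ws_tr (ws_star u) = 0 by move=> h; rewrite tr_star h rmorph0.
rewrite -free_centre_mid //.
apply/eqP; rewrite -(@eqrXn2 _ 2) ?mulr_ge0 ?n2_ge0 //; apply/eqP/complexI.
rewrite -n2_sq !starM !mulrA.
set w' := ws_star z * ws_star b' * ws_star y * ws_star b.
have -> : w' * ws_star x * x * b * y * b' * z =
   w' * (ws_star x * x) * b * y * b' * z by rewrite !mulrA.
rewrite -[_ * b * y * _ * _]mulrA -[_ * b * y * _]mulrA -[_ * b * _]mulrA tr_centre_mid !mulrA.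
have := @hfree true [:: ws_star z; ws_star b'; ws_star y; ws_star b;
   centre (ws_star x * x); b; y; b'; z] isT.
rewrite !bigE !mulrA => ->; last first.
  by do !split; rewrite ?tr_centre //; (try exact: trS); (try exact: subS);
    apply: sub_centre => //; apply: subM => //; apply: subS.
rewrite add0r n2_sq /w'.
have -> : ws_star z * ws_star b' * ws_star y * ws_star b * b * y * b' * z =
   ws_star z * ws_star b' * ws_star y * (ws_star b * b) * y * b' * z by rewrite !mulrA.
rewrite -[_ * y * b' * _]mulrA -[_ * y * _]mulrA tr_centre_mid !mulrA.
have := @hfree true [:: ws_star z; ws_star b'; ws_star y;
   centre (ws_star b * b); y; b'; z] isT.
rewrite !bigE !mulrA => ->; last first.
  by do !split; rewrite ?tr_centre //; (try exact: trS); (try exact: subS);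
    apply: sub_centre => //; apply: subM => //; apply: subS.
rewrite add0r n2_sq.
have -> : ws_star z * ws_star b' * ws_star y * y * b' * z =
  ws_star (y * b' * z) * (y * b' * z) by rewrite !starM !mulrA.
by rewrite !n2_sq -!realcM !exprMn mulrA.
Qed.

End FreePair.

(** * Words in a short free increment *)

Section Words.
Context {R : realType} {A : tracial_vN R}.
Implicit Types (b x y z : A) (B G D : set A) (l : seq A).

Let F B G (c : bool) : set A := if c then G else B.

(** What the expansion of a word needs to know of an increment [x] over an
    interval of length [eta ^ 2]: it is free from the past [B], its powers have
    L2 norm of order [eta] and trace of order [eta ^ 2]. [G] is the algebra of
    [x], and [D] the past at the end of the interval. *)
Record free_cell (kappa : R) (E : nat) B G D (eta : R) x : Prop := FreeCell {
  fc_B : star_subalgebra B;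
  fc_G : star_subalgebra G;
  fc_D : star_subalgebra D;
  fc_BD : B `<=` D;
  fc_GD : G `<=` D;
  fc_x : G x;
  fc_free : forall c l, l != [::] -> alternates (F B G) c l ->
    ws_tr (\prod_(y <- l) y) = 0;
  fc_eta0 : 0 <= eta;
  fc_eta1 : eta <= 1;
  fc_n2 : forall e, (0 < e <= E)%N -> n2 (x ^+ e) <= kappa * eta;
  fc_tr : forall e, (0 < e <= E)%N -> cabs (ws_tr (x ^+ e)) <= kappa * eta ^+ 2;
  fc_bd : forall e, (0 < e <= E)%N -> l2bounded kappa (x ^+ e);
  fc_cbd : forall e, (0 < e <= E)%N -> l2bounded kappa (centre (x ^+ e))
}.

(** The terms that disappear from the sum over a partition as the mesh tends
    to [0]: the first part is summed by orthogonality, the second one by the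
    triangle inequality. *)
Definition negligible B D (eta C : R) w := exists y z,
  [/\ w = y + z, D y, forall b, B b -> ws_tr (b * y) = 0,
      n2 y <= C * eta ^+ 2 & n2 z <= C * eta ^+ 3].

Lemma negligibleD B D eta C C' w w' : star_subalgebra D ->
  negligible B D eta C w -> negligible B D eta C' w' ->
  negligible B D eta (C + C') (w + w').
Proof.
move=> hD [y [z [-> Dy ty ny nz]]] [y' [z' [-> Dy' ty' ny' nz']]].
exists (y + y'), (z + z'); split.
- by rewrite addrACA.
- exact: subD.
- by move=> b Bb; rewrite mulrDr trD ty // ty' // addr0.
- by rewrite mulrDl (le_trans (n2_add _ _)) // lerD.
- by rewrite mulrDl (le_trans (n2_add _ _)) // lerD.
Qed.

Lemma negligibleZ B D eta C c w : star_subalgebra D ->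
  negligible B D eta C w -> negligible B D eta (cabs c * C) (c *: w).
Proof.
move=> hD [y [z [-> Dy ty ny nz]]]; exists (c *: y), (c *: z); split.
- by rewrite scalerDr.
- exact: subZ.
- by move=> b Bb; rewrite -scalerAr trZ ty // mulr0.
- by rewrite n2Z -mulrA ler_wpM2l // cabs_ge0.
- by rewrite n2Z -mulrA ler_wpM2l // cabs_ge0.
Qed.

Lemma negligibleW B D eta C C' w : 0 <= eta -> C <= C' ->
  negligible B D eta C w -> negligible B D eta C' w.
Proof.
move=> e0 CC [y [z [-> Dy ty ny nz]]]; exists y, z; split => //.
- by apply: le_trans ny _; rewrite ler_wpM2r // exprn_ge0.
- by apply: le_trans nz _; rewrite ler_wpM2r // exprn_ge0.
Qed.

Lemma negligible_small B D eta C w : star_subalgebra D -> 0 <= eta -> 0 <= C ->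
  n2 w <= C * eta ^+ 3 -> negligible B D eta C w.
Proof.
move=> hD e0 C0 h; exists 0, w; split => //.
- by rewrite add0r.
- exact: sub0.
- by move=> b _; rewrite mulr0 tr0.
- by rewrite n2_0 mulr_ge0 // exprn_ge0.
Qed.

Definition xtail x l := \prod_(b <- l) (x * b).

(** The word [x^e b x b_1 .. x b_m] in which the factors between two powers of
    [x] are replaced with their traces, as the contraction of a tensor does. *)
Fixpoint condense x e b l : A :=
  if l is b' :: l' then ws_tr b *: condense x e.+1 b' l' else x ^+ e * b.

Lemma condenseE x e b l : condense x e b l =
  (\prod_(b' <- belast b l) ws_tr b') *: (x ^+ (e + size l) * last b l).
Proof.
elim: l e b => [|b' l IH] e b /=; first by rewrite big_nil scale1r addn0.
by rewrite IH scalerA big_cons addSnnS.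
Qed.

Lemma n2_le3 (a a' w : A) c c' : 0 <= c -> 0 <= c' ->
  l2bounded c a -> l2bounded c' a' -> n2 (a * w * a') <= c * c' * n2 w.
Proof.
move=> c0 c0' [ha _] [_ ha']; apply: le_trans (ha' _) _.
by rewrite [c * c']mulrC -mulrA ler_wpM2l.
Qed.

Section Estimates.
Variables (kappa c : R) (E : nat).
Hypotheses (kappa1 : 1 <= kappa) (c1 : 1 <= c).

Let k0 : 0 <= kappa. Proof. exact: le_trans kappa1. Qed.
Let c0 : 0 <= c. Proof. exact: le_trans c1. Qed.

Lemma l2bounded_xtail B G D eta x l : (0 < E)%N -> free_cell kappa E B G D eta x ->
  (forall b, b \in l -> l2bounded c b) ->
  l2bounded ((kappa * c) ^+ size l) (xtail x l).
Proof.
move=> E0 h; elim: l => [|b l IH] hl.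
  by rewrite /xtail big_nil expr0; apply: l2bounded1.
rewrite /xtail big_cons exprS; apply: l2boundedM; rewrite ?exprn_ge0 ?mulr_ge0 //.
  apply: l2boundedM => //; last by apply: hl; rewrite mem_head.
  by rewrite -[x]expr1; apply: (fc_bd h).
by apply: IH => b' hb'; apply: hl; rewrite in_cons hb' orbT.
Qed.

(** Centring the three powers of [x] leaves one centred alternating word, whose
    norm is a product of norms, and terms with a trace, of order [eta ^ 2],
    times the norm of another power, of order [eta]. *)
Lemma three_blocks B G D eta x b b' e f g : free_cell kappa E B G D eta x ->
  B b -> ws_tr b = 0 -> l2bounded c b -> B b' -> ws_tr b' = 0 -> l2bounded c b' ->
  (0 < e <= E)%N -> (0 < f <= E)%N -> (0 < g <= E)%N ->
  n2 (x ^+ e * b * x ^+ f * b' * x ^+ g) <= 4 * kappa ^+ 3 * c ^+ 2 * eta ^+ 3.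
Proof.
move=> h Bb tb bb Bb' tb' bb' he hf hg.
have eta0 := fc_eta0 h.
set xe := centre (x ^+ e); set xf := centre (x ^+ f); set xg := centre (x ^+ g).
have -> : x ^+ e * b * x ^+ f * b' * x ^+ g =
  ws_tr (x ^+ e) *: (b * x ^+ f * b' * x ^+ g) +
  (ws_tr (x ^+ f) *: (xe * (b * b') * x ^+ g) +
  (ws_tr (x ^+ g) *: (xe * (b * xf * b')) + xe * b * xf * b' * xg)).
  have := centre_mid 1 (x ^+ e) (b * x ^+ f * b' * x ^+ g).
  rewrite !mul1r !mulrA => ->; rewrite addrC; congr (_ + _).
  have := centre_mid (xe * b) (x ^+ f) (b' * x ^+ g).
  rewrite !mulrA => ->; rewrite addrC; congr (_ + _).
  have := centre_mid (xe * b * xf * b') (x ^+ g) 1.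
  by rewrite !mulr1 ?mulrA => ->; rewrite addrC.
have GX d : G (x ^+ d) by exact: (subX (fc_G h) _ (fc_x h)).
have Gc d : G (centre (x ^+ d)) by exact: (sub_centre (fc_G h) (GX d)).
have nc d : (0 < d <= E)%N -> n2 (centre (x ^+ d)) <= kappa * eta.
  by move=> hd; apply: le_trans (n2_centre _) (fc_n2 h hd).
have bn := n2_l2bounded bb; have bn' := n2_l2bounded bb'.
have h1 : n2 (b * x ^+ f * b' * x ^+ g) <= c * kappa * c * (kappa * eta).
  have [] : l2bounded (c * kappa * c) (b * x ^+ f * b').
    by do 2?apply: l2boundedM => //; rewrite ?mulr_ge0 //; apply: fc_bd h _ _.
  move=> hl _; apply: le_trans (hl _) _; rewrite ler_wpM2l ?mulr_ge0 //.
  exact: fc_n2 h _ hg.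
have h2 : n2 (xe * (b * b') * x ^+ g) <= kappa * (c * c) * (kappa * eta).
  have [] : l2bounded (kappa * (c * c)) (xe * (b * b')).
    by apply: l2boundedM; rewrite ?mulr_ge0 //; [apply: fc_cbd h _ _|apply: l2boundedM].
  move=> hl _; apply: le_trans (hl _) _; rewrite ler_wpM2l ?mulr_ge0 //.
  exact: fc_n2 h _ hg.
have h3 : n2 (xe * (b * xf * b')) <= c * kappa * c * (kappa * eta).
  have [] : l2bounded (c * kappa * c) (b * xf * b').
    by do 2?apply: l2boundedM => //; rewrite ?mulr_ge0 //; apply: fc_cbd h _ _.
  move=> _ hr; apply: le_trans (hr _) _; rewrite ler_wpM2l ?mulr_ge0 //.
  exact: nc.
have h4 : n2 (xe * b * xf * b' * xg) <= kappa * eta * c * (kappa * eta * c * (kappa * eta)).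
  rewrite (free_centre_mid2 (fc_B h) (fc_G h) (fc_free h)) ?tr_centre //; try exact: Gc.
  by do !apply: ler_pM; rewrite ?mulr_ge0 ?n2_ge0 //; apply: nc.
have te := fc_tr h he; have tf := fc_tr h hf; have tg := fc_tr h hg.
have lift u (v : A) w : cabs u <= kappa * eta ^+ 2 -> n2 v <= w -> n2 (u *: v) <= kappa * eta ^+ 2 * w.
  by move=> hu hv; rewrite n2Z ler_pM ?cabs_ge0 ?n2_ge0.
have := lift _ _ _ te h1; have := lift _ _ _ tf h2; have := lift _ _ _ tg h3; move: h4.
set w4 := xe * b * xf * b' * xg; set w3 := _ *: _; set w2 := _ *: (xe * (b * b') * _); set w1 := _ *: _.
move=> h4' h3' h2' h1'.
have := n2_add w1 (w2 + (w3 + w4)); have := n2_add w2 (w3 + w4); have := n2_add w3 w4.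
by lra.
Qed.

(** With both powers centred the norm is of order [eta ^ 2] only, but the word
    is orthogonal to the past; the terms with a trace are of order [eta ^ 3]. *)
Lemma two_blocks B G D eta x a b a' e f : free_cell kappa E B G D eta x ->
  B a -> l2bounded c a -> B b -> ws_tr b = 0 -> l2bounded c b ->
  B a' -> l2bounded c a' -> (0 < e <= E)%N -> (0 < f <= E)%N ->
  negligible B D eta (2 * kappa ^+ 2 * c ^+ 3) (a * x ^+ e * b * x ^+ f * a').
Proof.
move=> h Ba ba Bb tb bb Ba' ba' he hf.
have eta0 := fc_eta0 h.
set xe := centre (x ^+ e); set xf := centre (x ^+ f).
have GX d : G (x ^+ d) by exact: (subX (fc_G h) _ (fc_x h)).
have Gc d : G (centre (x ^+ d)) by exact: (sub_centre (fc_G h) (GX d)).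
have nc d : (0 < d <= E)%N -> n2 (centre (x ^+ d)) <= kappa * eta.
  by move=> hd; apply: le_trans (n2_centre _) (fc_n2 h hd).
have bn := n2_l2bounded bb.
exists (a * (xe * b * xf) * a'), (ws_tr (x ^+ e) *: ((a * b) * x ^+ f * a') +
  ws_tr (x ^+ f) *: (a * xe * (b * a'))).
split.
- have := centre_mid a (x ^+ e) (b * x ^+ f * a'); rewrite !mulrA => ->.
  have := centre_mid (a * xe * b) (x ^+ f) a'; rewrite ?mulrA => ->.
  by rewrite -addrA [X in _ + X]addrC.
- have DB := @fc_BD _ _ _ _ _ _ _ h; have DG := @fc_GD _ _ _ _ _ _ _ h.
  have hD := fc_D h.
  apply: (subM hD); last exact: DB.
  apply: (subM hD); first exact: DB.
  apply: (subM hD); last by apply: DG; exact: Gc.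
  by apply: (subM hD); [apply: DG; exact: Gc|apply: DB].
- move=> d Bd.
  have -> : ws_tr (d * (a * (xe * b * xf) * a')) = ws_tr ((a' * d * a) * xe * b * xf).
    by rewrite !mulrA ws_trC !mulrA.
  rewrite (free_tr3 (fc_B h) (fc_G h) (fc_free h)) ?tb ?tr_centre ?mulr0 ?mul0r //;
    try exact: Gc.
  by do 2?apply: (subM (fc_B h)).
- apply: le_trans (n2_le3 _ c0 c0 ba ba') _.
  rewrite (free_centre_mid (fc_B h) (fc_G h) (fc_free h)) ?tr_centre //; try exact: Gc.
  have : n2 xe * n2 b * n2 xf <= kappa * eta * c * (kappa * eta).
    by do !apply: ler_pM; rewrite ?mulr_ge0 ?n2_ge0 //; apply: nc.
  have c3 : 0 <= kappa ^+ 2 * c ^+ 3 * eta ^+ 2 by rewrite !mulr_ge0 // exprn_ge0.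
  move=> h1; apply: le_trans (ler_wpM2l _ h1) _; first by rewrite mulr_ge0.
  by lra.
have h1 : n2 (a * b * x ^+ f * a') <= c * c * c * (kappa * eta).
  apply: le_trans (n2_le3 _ _ c0 (l2boundedM c0 c0 ba bb) ba') _; rewrite ?mulr_ge0 //.
  by rewrite ler_wpM2l ?mulr_ge0 //; apply: fc_n2 h _ hf.
have h2 : n2 (a * xe * (b * a')) <= c * (c * c) * (kappa * eta).
  apply: le_trans (n2_le3 _ c0 _ ba (l2boundedM c0 c0 bb ba')) _; rewrite ?mulr_ge0 //.
  by rewrite ler_wpM2l ?mulr_ge0 //; apply: nc.
have te := fc_tr h he; have tf := fc_tr h hf.
have lift u (v : A) w : cabs u <= kappa * eta ^+ 2 -> n2 v <= w -> n2 (u *: v) <= kappa * eta ^+ 2 * w.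
  by move=> hu hv; rewrite n2Z ler_pM ?cabs_ge0 ?n2_ge0.
have := lift _ _ _ te h1; have := lift _ _ _ tf h2.
set w2 := _ *: (a * xe * _); set w1 := _ *: _ => h2' h1'.
by have := n2_add w1 w2; lra.
Qed.

(** Induction on the number of factors that follow: the next one is centred.
    Its trace merges two powers of [x] into a shorter word; its centred part
    is a second separation of powers of [x], as in [three_blocks]. *)
Lemma centred_factor m : exists2 C, 0 <= C &
  forall B G D eta x a b b' l e f, free_cell kappa E B G D eta x -> size l = m ->
    B a -> l2bounded c a -> B b -> ws_tr b = 0 -> l2bounded c b ->
    (forall y, y \in b' :: l -> B y /\ l2bounded (c / 2) y) ->
    (0 < e <= E)%N -> (0 < f)%N -> (f + m <= E)%N ->
    negligible B D eta C (a * x ^+ e * b * x ^+ f * b' * xtail x l).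
Proof.
elim: m => [|m [C C_ge0 IH]].
  exists (2 * kappa ^+ 2 * c ^+ 3); first by rewrite !mulr_ge0 // exprn_ge0.
  move=> B G D eta x a b b' l e f h /size0nil -> Ba ba Bb tb bb hl he f0 hf.
  rewrite /xtail big_nil mulr1; apply: (two_blocks h) => //.
  - by have [] := hl b' (mem_head _ _).
  - have [_] := hl b' (mem_head _ _); apply: l2boundedW.
    by rewrite ler_pdivrMr // ler_peMr // ler1n.
  - by rewrite f0 -(addn0 f).
set Q := c * (4 * kappa ^+ 3 * c ^+ 2) * (c * (kappa * c) ^+ m).
have Q0 : 0 <= Q by rewrite !mulr_ge0 // exprn_ge0 // mulr_ge0.
exists (c * C + Q); first by rewrite addr_ge0 // mulr_ge0.
move=> B G D eta x a b b' [//|b'' l] e f h [hl] Ba ba Bb tb bb hbl he f0 hf.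
have [Bb' bb'] := hbl b' (mem_head _ _).
have ch : c / 2 <= c by rewrite ler_pdivrMr // ler_peMr // ler1n.
have hfE : (0 < f <= E)%N by rewrite f0 (leq_trans _ hf) // leq_addr.
have E0 : (0 < E)%N by case/andP: hfE => ? /(leq_trans _); apply.
have tb' : cabs (ws_tr b') <= c.
  by apply: le_trans (tr_n2 _) (le_trans (n2_l2bounded bb') ch).
have -> : a * x ^+ e * b * x ^+ f * b' * xtail x (b'' :: l) =
  ws_tr b' *: (a * x ^+ e * b * x ^+ f.+1 * b'' * xtail x l) +
  (a * (x ^+ e * b * x ^+ f * centre b' * x) * (b'' * xtail x l)).
  rewrite /xtail big_cons centre_mid addrC; congr (_ + _); last by rewrite !mulrA.
  by rewrite exprSr !mulrA.
apply: negligibleD; first exact: fc_D h.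
  apply: (@negligibleW _ _ _ (cabs (ws_tr b') * C)); first exact: fc_eta0 h.
    by rewrite ler_wpM2r.
  apply: negligibleZ; first exact: fc_D h.
  apply: (IH B G) => //; last by rewrite addSnnS.
  by move=> y hy; apply: hbl; rewrite in_cons hy orbT.
apply: negligible_small => //; [exact: fc_D h|exact: fc_eta0 h|].
have hcl y : y \in b'' :: l -> l2bounded c y.
  by move=> hy; have [_ ] := hbl y ltac:(by rewrite in_cons hy orbT); apply: l2boundedW.
have hbd : l2bounded (c * (kappa * c) ^+ m) (b'' * xtail x l).
  apply: l2boundedM; rewrite ?exprn_ge0 ?mulr_ge0 //; first by apply: hcl; rewrite mem_head.
  rewrite -hl; apply: (l2bounded_xtail E0 h) => y hy.
  by apply: hcl; rewrite in_cons hy orbT.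
apply: le_trans (n2_le3 _ _ _ ba hbd) _ => //.
  by rewrite !mulr_ge0 // exprn_ge0 // mulr_ge0.
have cb : l2bounded c (centre b').
  apply: (@l2boundedW _ _ (c / 2 + cabs (- ws_tr b') * 1)); last first.
    rewrite /centre -scaleNr; apply: l2boundedD => //; apply: l2boundedZ; exact: l2bounded1.
  by rewrite cabsN mulr1; have := le_trans (tr_n2 _) (n2_l2bounded bb'); lra.
have := three_blocks h Bb tb bb (sub_centre (fc_B h) Bb') (tr_centre _) cb he hfE
  (g := 1) ltac:(by []).
rewrite expr1 => h3; rewrite /Q.
have hc2 : 0 <= c * (c * (kappa * c) ^+ m) by rewrite !mulr_ge0 // exprn_ge0 // mulr_ge0.
apply: le_trans (ler_wpM2l hc2 h3) _.
by rewrite le_eqVlt; apply/orP; left; apply/eqP; ring.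
Qed.

(** The factors are centred one after the other: the trace of a factor is what
    the condensed form keeps, and a centred factor between two powers of [x]
    makes the term negligible. *)
Lemma condense_negligible m : exists2 C, 0 <= C &
  forall B G D eta x a b l e, free_cell kappa E B G D eta x -> size l = m ->
    B a -> l2bounded c a ->
    (forall y, y \in b :: l -> B y /\ l2bounded (c / 2) y) ->
    (0 < e)%N -> (e + m <= E)%N ->
    negligible B D eta C (a * (x ^+ e * b * xtail x l) - a * condense x e b l).
Proof.
elim: m => [|m [C C_ge0 IH]].
  exists 0 => // B G D eta x a b l e h /size0nil -> _ _ _ _ _.
  rewrite /xtail big_nil mulr1 /= subrr; apply: negligible_small => //.
  - exact: fc_D h.
  - exact: fc_eta0 h.
  - by rewrite n2_0 mul0r.
have [C' C'0 hC'] := centred_factor m.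
exists (c * C + C'); first by rewrite addr_ge0 // mulr_ge0.
move=> B G D eta x a b [//|b' l] e h [hl] Ba ba hbl e0 he.
have [Bb bb] := hbl b (mem_head _ _).
have ch : c / 2 <= c by rewrite ler_pdivrMr // ler_peMr // ler1n.
have tb : cabs (ws_tr b) <= c.
  by apply: le_trans (tr_n2 _) (le_trans (n2_l2bounded bb) ch).
have -> : a * (x ^+ e * b * xtail x (b' :: l)) - a * condense x e b (b' :: l) =
  ws_tr b *: (a * (x ^+ e.+1 * b' * xtail x l) - a * condense x e.+1 b' l) +
  a * x ^+ e * centre b * x ^+ 1 * b' * xtail x l.
  rewrite /= scalerBr [in RHS]addrAC -scalerAr; congr (_ - _).
  rewrite /xtail big_cons centre_mid mulrDr addrC -scalerAr; congr (_ + _).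
    by rewrite expr1 !mulrA.
  by rewrite exprSr !mulrA.
apply: negligibleD; first exact: fc_D h.
  apply: (@negligibleW _ _ _ (cabs (ws_tr b) * C)); first exact: fc_eta0 h.
    by rewrite ler_wpM2r.
  apply: negligibleZ; first exact: fc_D h.
  apply: (IH B G) => //; last by rewrite addSnnS.
  by move=> y hy; apply: hbl; rewrite in_cons hy orbT.
apply: (hC' B G) => //.
- exact: sub_centre (fc_B h) Bb.
- exact: tr_centre.
- apply: (@l2boundedW _ _ (c / 2 + cabs (- ws_tr b) * 1)); last first.
    rewrite /centre -scaleNr; apply: l2boundedD => //; apply: l2boundedZ; exact: l2bounded1.
  by rewrite cabsN mulr1; have := le_trans (tr_n2 _) (n2_l2bounded bb); lra.
- by move=> y hy; apply: hbl; rewrite in_cons hy orbT.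
- by rewrite e0 (leq_trans _ he) // leq_addr.
- by rewrite (leq_trans _ he) // addSnnS add0n leq_addl.
Qed.

End Estimates.
End Words.

(** * Calculus of tensors *)

Section TensorCalculus.
Context {R : realType} {A : tracial_vN R}.
Implicit Types (x y z : A) (c : R[i]).

Lemma tens_valD n (u v : tens A n.+1) : tens_val (u + v) = tens_val u + tens_val v.
Proof. by []. Qed.

Lemma tens_val_sum n (I : Type) (s : seq I) (f : I -> tens A n.+1) :
  tens_val (\sum_(i <- s) f i) = \sum_(i <- s) tens_val (f i).
Proof. by elim: s => [|i s IH]; rewrite ?big_nil // !big_cons tens_valD IH. Qed.

Lemma tens_decomp n (u : tens A n.+1) : u = \sum_(a <- decomposition u) pure a.
Proof.
apply: val_inj; rewrite /= tens_val_sum /decomposition.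
have [s us] : exists s, tens_val u = \sum_(a <- s) pure_fun a.
  by case: u => u hu /=; apply/asboolP.
exact: (@xgetPex _ [::] [set s | tens_val u = \sum_(a <- s) pure_fun a] (ex_intro _ s us)).
Qed.

(** Tensors are identified by scalar multilinear forms; where linear
    functionals separate points, identities for such forms extend to
    multilinear maps with values in the space. *)
Definition separated (V : lmodType R[i]) := forall v : V,
  (forall l : V -> R[i], (forall c u w, l (c *: u + w) = c * l u + l w) -> l v = 0) ->
  v = 0.

(** The functionals [x |-> tr (y^* x)] separate points. *)
Lemma separated_alg : separated A.
Proof.
move=> x h; apply: (@ws_tr_faithful R A).
by apply: (h (fun z => ws_tr (ws_star x * z))) => c u w; rewrite mulrDr -scalerAr ws_trL.
Qed.

Lemma separated_scalar : separated R[i]^o.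
Proof. by move=> x; apply=> c u w. Qed.

Lemma separated_tens n : separated (tens A n.+1).
Proof.
move=> u h; apply: val_inj; apply/funext => f.
by apply: (h (fun v => tens_val v f)) => c v w.
Qed.

Definition mlin n (V : lmodType R[i]) (f : {ffun 'I_n -> A} -> V) := forall a i c x y,
  f (set_slot a i (c *: x + y)) = c *: f (set_slot a i x) + f (set_slot a i y).

Lemma functional_sum (V : lmodType R[i]) (l : V -> R[i]) (I : Type) (s : seq I) (f : I -> V) :
  (forall c u w, l (c *: u + w) = c * l u + l w) ->
  l (\sum_(i <- s) f i) = \sum_(i <- s) l (f i).
Proof.
move=> hl.
have l0 : l 0 = 0.
  by have /eqP := hl 1 0 0; rewrite scale1r addr0 mul1r -subr_eq0 opprD addrA subrr
    sub0r oppr_eq0 => /eqP.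
elim: s => [|i s IH]; rewrite ?big_nil // !big_cons -IH.
by have := hl 1 (f i) (\sum_(j <- s) f j); rewrite scale1r mul1r.
Qed.

(** Followed by a functional, [f] is a multilinear form, on which both sums
    agree by the definition of the tensor power. *)
Lemma multilinear_sum n (V : lmodType R[i]) (f : {ffun 'I_n.+1 -> A} -> V) s s' :
  separated V -> mlin f ->
  \sum_(a <- s) pure a = \sum_(a <- s') pure a :> tens A n.+1 ->
  \sum_(a <- s) f a = \sum_(a <- s') f a.
Proof.
move=> sepV fl e; apply/eqP; rewrite -subr_eq0; apply/eqP/sepV => l hl.
have lf : multilinear (l \o f) by move=> a i c x y /=; rewrite fl hl.
have h t : l (\sum_(a <- t) f a) = tens_val (\sum_(a <- t) pure a) (exist _ _ lf).
  rewrite functional_sum // tens_val_sum.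
  by elim: t => [|a t IH]; rewrite ?big_nil // !big_cons IH.
have lB u w : l (u - w) = l u - l w.
  by rewrite addrC -scaleN1r hl mulN1r addrC.
by rewrite lB !h e subrr.
Qed.

(** Frees the extension of a multilinear map from the decomposition that is
    chosen in its definition. *)
Lemma lin_extE n (V : lmodType R[i]) (f : {ffun 'I_n.+1 -> A} -> V) s :
  separated V -> mlin f -> lin_ext f (\sum_(a <- s) pure a) = \sum_(a <- s) f a.
Proof. by move=> sepV fl; apply: multilinear_sum => //; rewrite -tens_decomp. Qed.

Lemma lin_ext_linear n (V : lmodType R[i]) (f : {ffun 'I_n.+1 -> A} -> V) :
  separated V -> mlin f -> forall c u v, lin_ext f (c *: u + v) = c *: lin_ext f u + lin_ext f v.
Proof.
move=> sepV fl c u v.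
have set_id (a : {ffun 'I_n.+1 -> A}) : set_slot a ord0 (a ord0) = a.
  by apply/ffunP => j; rewrite ffunE; case: eqP => // ->.
have slot0 (W : lmodType R[i]) (g : {ffun 'I_n.+1 -> A} -> W) : mlin g ->
    forall a, g (set_slot a ord0 (c *: a ord0)) = c *: g a.
  move=> gl a; have g0 : g (set_slot a ord0 0) = 0.
    by have /eqP := gl a ord0 1 0 0; rewrite !scale1r addr0 -subr_eq0 opprD addrA subrr
      sub0r oppr_eq0 => /eqP.
  by have := gl a ord0 c (a ord0) 0; rewrite !addr0 g0 addr0 set_id.
have pure_mlin : mlin (@pure R A n.+1).
  by move=> a i d x y; apply: val_inj; apply/funext => g; apply: (svalP g).
pose s := [seq set_slot a ord0 (c *: a ord0) | a <- decomposition u] ++ decomposition v.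
have -> : c *: u + v = \sum_(a <- s) pure a.
  rewrite big_cat big_map /= -tens_decomp {1}[u]tens_decomp scaler_sumr; congr (_ + _).
  by apply: eq_bigr => a _; rewrite slot0.
rewrite lin_extE // big_cat big_map /= scaler_sumr; congr (_ + _).
by apply: eq_bigr => a _; rewrite slot0.
Qed.

(** ** Elementary tensors of order two *)

Definition pair_fun (x y : A) : {ffun 'I_2 -> A} :=
  [ffun j : 'I_2 => if j == ord0 then x else y].

Lemma pair_fun0 x y : pair_fun x y ord0 = x. Proof. by rewrite ffunE. Qed.
Lemma pair_fun1 x y : pair_fun x y ord_max = y. Proof. by rewrite ffunE. Qed.

Lemma pair_funE (a : {ffun 'I_2 -> A}) : a = pair_fun (a ord0) (a ord_max).
Proof.
apply/ffunP => j; rewrite ffunE; case: eqP => [-> //|h]; congr (a _).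
by apply: val_inj; case: j h => [[|[|//]]] /= hj h //; case: h; apply: val_inj.
Qed.

Lemma slot0 (a : {ffun 'I_2 -> A}) x : set_slot a ord0 x = pair_fun x (a ord_max).
Proof. by rewrite [LHS]pair_funE !ffunE. Qed.

Lemma slot1 (a : {ffun 'I_2 -> A}) x : set_slot a ord_max x = pair_fun (a ord0) x.
Proof. by rewrite [LHS]pair_funE !ffunE. Qed.

Lemma mlin2 (V : lmodType R[i]) (f : {ffun 'I_2 -> A} -> V) :
  (forall c x x' y, f (pair_fun (c *: x + x') y) = c *: f (pair_fun x y) + f (pair_fun x' y)) ->
  (forall c x y y', f (pair_fun x (c *: y + y')) = c *: f (pair_fun x y) + f (pair_fun x y')) ->
  mlin f.
Proof.
move=> h0 h1 a i c x y.
have [->|->] : i = ord0 \/ i = ord_max.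
  by case: i => [[|[|//]] hi]; [left|right]; apply: val_inj.
  by rewrite !slot0.
by rewrite !slot1.
Qed.

(** The action of the biprocess value [u] on an increment: [(x (x) y) # d] is
    [x d y]. *)
Definition sharp (u : tens A 2) (d : A) : A := lin_ext (fun a => a ord0 * d * a ord_max) u.

Definition tsum (s : seq (A * A)) : tens A 2 := \sum_(p <- s) tensor2 p.1 p.2.

Lemma tsumE s : tsum s = \sum_(a <- [seq pair_fun p.1 p.2 | p <- s]) pure a.
Proof. by rewrite big_map. Qed.

Lemma tsum_ex (u : tens A 2) : exists s, u = tsum s.
Proof.
exists [seq (a ord0, a ord_max) | a : {ffun 'I_2 -> A} <- decomposition u].
rewrite {1}[u]tens_decomp /tsum big_map; apply: eq_bigr => a _ /=.
by rewrite {1}[a]pair_funE.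
Qed.

Lemma sharp_mlin d : mlin (fun a : {ffun 'I_2 -> A} => a ord0 * d * a ord_max).
Proof.
apply: mlin2 => c x x' y; rewrite !pair_fun0 !pair_fun1.
  by rewrite !mulrDl -!scalerAl.
by rewrite mulrDr -scalerAr.
Qed.

Lemma sharp_tsum s d : sharp (tsum s) d = \sum_(p <- s) p.1 * d * p.2.
Proof.
rewrite tsumE /sharp lin_extE; [|exact: separated_alg|exact: sharp_mlin].
by rewrite big_map; apply: eq_bigr => p _; rewrite pair_fun0 pair_fun1.
Qed.

Lemma sharpL c (u v : tens A 2) d : sharp (c *: u + v) d = c *: sharp u d + sharp v d.
Proof. by apply: lin_ext_linear; [exact: separated_alg|exact: sharp_mlin]. Qed.

Lemma tmul_mlin : mlin (fun a : {ffun 'I_2 -> A} => a ord0 * a ord_max).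
Proof.
apply: mlin2 => c x x' y; rewrite !pair_fun0 !pair_fun1.
  by rewrite mulrDl -scalerAl.
by rewrite mulrDr -scalerAr.
Qed.

Lemma tmul_tsum s : tmul (tsum s) = \sum_(p <- s) p.1 * p.2.
Proof.
rewrite tsumE /tmul lin_extE; [|exact: separated_alg|exact: tmul_mlin].
by rewrite big_map; apply: eq_bigr => p _; rewrite pair_fun0 pair_fun1.
Qed.

Lemma tdot_tsum s s' : tdot (tsum s) (tsum s') =
  \sum_(p <- s) \sum_(q <- s') ws_tr (ws_star q.1 * p.1) * ws_tr (p.2 * ws_star q.2).
Proof.
have inner (a : {ffun 'I_2 -> A}) : lin_ext (fun c : {ffun 'I_2 -> A} =>
    ws_tr (ws_star (c ord0) * a ord0) * ws_tr (a ord_max * ws_star (c ord_max))) (tsum s') =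
    \sum_(q <- s') ws_tr (ws_star q.1 * a ord0) * ws_tr (a ord_max * ws_star q.2).
  (* conjugate linear in the factors of the second tensor *)
  apply: (can_inj conjCK); rewrite /lin_ext rmorph_sum /=.
  set f := fun c : {ffun 'I_2 -> A} => (ws_tr (ws_star (c ord0) * a ord0) *
    ws_tr (a ord_max * ws_star (c ord_max)))^* : R[i]^o.
  have fl : mlin f.
    apply: mlin2 => c x x' y; rewrite /f !pair_fun0 !pair_fun1 starL.
      by rewrite mulrDl trD -scalerAl trZ mulrDl -mulrA conjD (conjM c^*) conjcc.
    by rewrite mulrDr trD -scalerAr trZ mulrDr mulrCA conjD (conjM c^*) conjcc.
  rewrite [LHS](_ : _ = lin_ext f (tsum s')) // tsumE.
  rewrite (lin_extE _ separated_scalar fl) big_map rmorph_sum; apply: eq_bigr => q _.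
  by rewrite /f pair_fun0 pair_fun1.
rewrite /tdot; set g := fun a : {ffun 'I_2 -> A} => lin_ext _ _.
have -> : g = (fun a => \sum_(q <- s') ws_tr (ws_star q.1 * a ord0) *
    ws_tr (a ord_max * ws_star q.2)) by apply/funext => a; apply: inner.
rewrite tsumE (lin_extE _ separated_scalar).
  by rewrite big_map; apply: eq_bigr => p _; apply: eq_bigr => q _; rewrite pair_fun0 pair_fun1.
apply: mlin2 => c x x' y; rewrite !pair_fun0 !pair_fun1 scaler_sumr -big_split /=;
  apply: eq_bigr => q _.
  by rewrite mulrDr trD -scalerAr trZ mulrDl -mulrA.
by rewrite mulrDl trD -scalerAl trZ mulrDr mulrCA.
Qed.

Lemma tensor2_mlin : mlin (@pure R A 2).
Proof. by move=> a i d x y; apply: val_inj; apply/funext => g; apply: (svalP g). Qed.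

Lemma tensor2Ll c x x' y : tensor2 (c *: x + x') y = c *: tensor2 x y + tensor2 x' y :> tens A 2.
Proof.
have := tensor2_mlin (pair_fun 0 y) ord0 c x x'.
by rewrite !slot0 pair_fun1.
Qed.

Lemma tensor2Lr c x y y' : tensor2 x (c *: y + y') = c *: tensor2 x y + tensor2 x y' :> tens A 2.
Proof.
have := tensor2_mlin (pair_fun x 0) ord_max c y y'.
by rewrite !slot1 pair_fun0.
Qed.

Lemma tsum_cat s s' : tsum (s ++ s') = tsum s + tsum s'.
Proof. by rewrite /tsum big_cat. Qed.

Lemma tensor20l y : tensor2 0 y = 0 :> tens A 2.
Proof.
have /eqP := tensor2Ll 1 0 0 y; rewrite !scale1r addr0 -subr_eq0 opprD addrA subrr sub0r.
by rewrite oppr_eq0 => /eqP.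
Qed.

Lemma tensor2Zl c x y : tensor2 (c *: x) y = c *: tensor2 x y :> tens A 2.
Proof. by have := tensor2Ll c x 0 y; rewrite tensor20l !addr0. Qed.

Lemma tsumZ c s : c *: tsum s = tsum [seq (c *: p.1, p.2) | p <- s].
Proof.
by rewrite /tsum big_map scaler_sumr; apply: eq_bigr => p _; rewrite tensor2Zl.
Qed.

Lemma tdotL (v : tens A 2) c u u' : tdot (c *: u + u') v = c * tdot u v + tdot u' v.
Proof.
have [s ->] := tsum_ex u; have [s' ->] := tsum_ex u'; have [t ->] := tsum_ex v.
rewrite tsumZ -tsum_cat !tdot_tsum big_cat big_map /= mulr_sumr; congr (_ + _).
apply: eq_bigr => p _; rewrite mulr_sumr; apply: eq_bigr => q _.
by rewrite -scalerAr trZ mulrA.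
Qed.

Lemma tdotJ (u v : tens A 2) : tdot v u = (tdot u v)^*.
Proof.
have [s ->] := tsum_ex u; have [t ->] := tsum_ex v.
rewrite !tdot_tsum exchange_big rmorph_sum /=; apply: eq_bigr => p _.
rewrite rmorph_sum /=; apply: eq_bigr => q _.
by rewrite conjM -!tr_star !starM !starK.
Qed.

Lemma tdot_tensor2 x y x' y' : tdot (tensor2 x y) (tensor2 x' y') =
  ws_tr (ws_star x' * x) * ws_tr (y * ws_star y').
Proof.
have h a b : tensor2 a b = tsum [:: (a, b)] by rewrite /tsum big_seq1.
by rewrite !h tdot_tsum !big_seq1.
Qed.

(** The inner product is a Schur product of two Gram matrices. By induction, the
    other first factors are made orthogonal to one of them, which splits off an
    elementary tensor. *)
Lemma tdot_ge0 (u : tens A 2) : 0 <= tdot u u.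
Proof.
have [s ->] := tsum_ex u.
have [n] := ubnP (size s); elim: n s => [|n IH] [|[x y] s] //= hs.
  by rewrite tdot_tsum big_nil.
have [->|x0] := eqVneq x 0.
  have -> : tsum ((0, y) :: s) = tsum s by rewrite /tsum big_cons /= tensor20l add0r.
  exact: IH.
have nx0 : ws_tr (ws_star x * x) != 0.
  by apply: contra x0 => /eqP /(@ws_tr_faithful R A) ->.
pose lam (p : A * A) := ws_tr (ws_star x * p.1) / ws_tr (ws_star x * x).
pose s' := [seq (p.1 - lam p *: x, p.2) | p <- s].
pose z := \sum_(p <- s) lam p *: p.2 + y.
have -> : tsum ((x, y) :: s) = tsum s' + tensor2 x z.
  have -> : tensor2 x z = \sum_(p <- s) lam p *: tensor2 x p.2 + tensor2 x y.
    rewrite /z; elim: (s) => [|p t IHt]; rewrite ?big_nil ?add0r // !big_cons.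
    by rewrite -!addrA tensor2Lr IHt.
  rewrite addrA /tsum big_cons /= addrC; congr (_ + _).
  rewrite big_map -big_split /=; apply: eq_bigr => p _.
  by rewrite [p.1 - _]addrC -scaleNr tensor2Ll scaleNr [RHS]addrC addNKr.
have cross : tdot (tsum s') (tensor2 x z) = 0.
  have -> : tensor2 x z = tsum [:: (x, z)] by rewrite /tsum big_seq1.
  rewrite tdot_tsum big_map big1 // => p _; rewrite big_seq1 /=.
  by rewrite mulrBr trB -scalerAr trZ /lam mulfVK // subrr mul0r.
rewrite (formD tdotL) !(formDr tdotL tdotJ) cross addr0 (tdotJ _ (tensor2 x z)).
rewrite cross rmorph0 add0r addr_ge0 //; first by apply: IH; rewrite size_map.
rewrite tdot_tensor2 mulr_ge0 ?ws_tr_ge0 //.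
by rewrite ws_trC ws_tr_ge0.
Qed.

Lemma tnorm2_ge0 (u : tens A 2) : 0 <= tnorm2 u. Proof. exact: sqrtr_ge0. Qed.

Lemma tnorm2_sq (u : tens A 2) : tdot u u = (tnorm2 u ^+ 2)%:c.
Proof. exact: (fnorm_sq tdot_ge0). Qed.

Lemma tnorm2_add (u v : tens A 2) : tnorm2 (u + v) <= tnorm2 u + tnorm2 v.
Proof. exact: (fnorm_add tdotL tdotJ tdot_ge0). Qed.

Lemma tnorm2N (u : tens A 2) : tnorm2 (- u) = tnorm2 u.
Proof. exact: (fnormN tdotL tdotJ tdot_ge0). Qed.

Lemma tnorm2_0 : tnorm2 (0 : tens A 2) = 0.
Proof. exact: (fnorm0 tdotL). Qed.

Lemma tnorm2_tensor2 x y : tnorm2 (tensor2 x y) = n2 x * n2 y.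
Proof.
rewrite /tnorm2 tdot_tensor2 (ws_trC y) !n2_sq -realcM /= -exprMn sqrtr_sqr.
by rewrite ger0_norm // mulr_ge0 ?n2_ge0.
Qed.

End TensorCalculus.

(** * The integrands as sums of elementary tensors *)

Section IntegrandEvaluation.
Context {R : realType} {A : tracial_vN R}.
Implicit Types (x y z : A) (c : R[i]).

Lemma tphi_mlin k : mlin (fun a : {ffun 'I_k.+2 -> A} =>
  (\prod_(j < k.+2 | (0 < j < k.+1)%N) ws_tr (a j)) *: tensor2 (a ord0) (a ord_max)).
Proof.
move=> a i c x y.
have slotE z j : set_slot a i z j = if j == i then z else a j by rewrite ffunE.
have prod_out z : ~~ (0 < i < k.+1)%N ->
    \prod_(j < k.+2 | (0 < j < k.+1)%N) ws_tr (set_slot a i z j) =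
    \prod_(j < k.+2 | (0 < j < k.+1)%N) ws_tr (a j).
  move=> hi; apply: eq_bigr => j hj; rewrite slotE; case: eqP => // ji.
  by rewrite ji (negbTE hi) in hj.
have [i0|i0] := eqVneq i ord0.
  subst i; rewrite !prod_out // !slotE !eqxx eq_sym /=.
  by rewrite tensor2Ll scalerDr scalerA mulrC -scalerA.
have [im|im] := eqVneq i ord_max.
  subst i; rewrite !prod_out /= ?ltnn // !slotE !eqxx /=.
  by rewrite tensor2Lr scalerDr scalerA mulrC -scalerA.
have hi : (0 < i < k.+1)%N.
  rewrite lt0n -(inj_eq val_inj) /= in i0 *; rewrite i0 /= ltn_neqAle -ltnS ltn_ord andbT.
  by apply: contra im => /eqP h; apply/eqP/val_inj.
have e0 z : set_slot a i z ord0 = a ord0 by rewrite slotE eq_sym (negbTE i0).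
have em z : set_slot a i z ord_max = a ord_max by rewrite slotE eq_sym (negbTE im).
rewrite !e0 !em (bigD1 i) //= [in RHS](bigD1 i) //= [X in _ + X *: _](bigD1 i) //=.
rewrite !slotE eqxx.
have rest z : \prod_(j < k.+2 | (0 < j < k.+1)%N && (j != i)) ws_tr (set_slot a i z j) =
    \prod_(j < k.+2 | (0 < j < k.+1)%N && (j != i)) ws_tr (a j).
  by apply: eq_bigr => j /andP[_ ji]; rewrite slotE (negbTE ji).
by rewrite !rest ws_trL mulrDl scalerDl -!mulrA -!scalerA.
Qed.

Lemma tphi_sum k (s : seq {ffun 'I_k.+2 -> A}) : tphi (\sum_(a <- s) pure a) =
  \sum_(a <- s) (\prod_(j < k.+2 | (0 < j < k.+1)%N) ws_tr (a j)) *: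
    tensor2 (a ord0) (a ord_max).
Proof. by rewrite /tphi lin_extE //; [exact: separated_tens|exact: tphi_mlin]. Qed.

(** The sum over all choices is multilinear in each of the tensors that the
    lists decompose, so the lists may be exchanged one at a time. *)
Lemma choices_sum k (V : lmodType R[i]) (ss ss' : seq (seq {ffun 'I_2 -> A}))
    (G : seq {ffun 'I_2 -> A} -> V) :
  separated V -> size ss = k -> size ss' = k ->
  (forall j, (j < k)%N ->
    \sum_(a <- nth [::] ss j) pure a = \sum_(a <- nth [::] ss' j) pure a :> tens A 2) ->
  (forall p1 p2, (size p1 + size p2).+1 = k -> mlin (fun x : {ffun 'I_2 -> A} => G (p1 ++ x :: p2))) ->
  \sum_(p <- choices ss) G p = \sum_(p <- choices ss') G p.
Proof.
move=> sepV; elim: k ss ss' G => [|k IH] [//|s ss] [//|s' ss'] G //= [hs] [hs'] e hG.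
have size_choices (tt : seq (seq {ffun 'I_2 -> A})) p : p \in choices tt -> size p = size tt.
  elim: tt p => [|t tt IHt] p /=; first by rewrite inE => /eqP ->.
  by case/allpairsP => -[x q] [/= _ /IHt hq ->] /=; rewrite hq.
rewrite !big_allpairs_dep.
transitivity (\sum_(x <- s) \sum_(p <- choices ss') G (x :: p)).
  apply: eq_bigr => x _; apply: (IH ss ss' (fun p => G (x :: p))) => //.
    by move=> j jk; apply: (e j.+1).
  by move=> p1 p2 h; apply: (hG (x :: p1) p2); rewrite /= addSn h.
rewrite exchange_big [RHS]exchange_big /= big_seq [RHS]big_seq; apply: eq_bigr => p hp.
apply: (multilinear_sum sepV); last exact: (e 0%N).
by apply: (hG [::]); rewrite add0n (size_choices _ _ hp) hs'.
Qed.

Lemma mk_slot_set k (a : {ffun 'I_k.+1 -> A}) p i z :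
  mk_slot (set_slot a i z) p = set_slot (mk_slot a p) i
    (nth [ffun=> 1] ([ffun=> 1] :: p) i ord_max * z * nth [ffun=> 1] p i ord0).
Proof. by apply/ffunP => j; rewrite !ffunE; case: eqP => [->|]. Qed.

Lemma mk_slot_mlin k p : mlin (fun a : {ffun 'I_k.+1 -> A} => pure (mk_slot a p)).
Proof.
move=> a i c x y; rewrite !mk_slot_set mulrDr mulrDl -scalerAr -scalerAl.
by apply: val_inj; apply/funext => g; apply: (svalP g).
Qed.

Lemma mk_slot_mlin_arg k (a : {ffun 'I_k.+1 -> A}) p1 p2 : (size p1 + size p2).+1 = k ->
  mlin (fun x : {ffun 'I_2 -> A} => pure (mk_slot a (p1 ++ x :: p2))).
Proof.
move=> hk.
have lk : (size p1 < k.+1)%N by rewrite -hk ltnS leqW ?leq_addr.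
have rk : ((size p1).+1 < k.+1)%N by rewrite -hk !ltnS leq_addr.
have nth0 (x : {ffun 'I_2 -> A}) j : j != size p1 ->
    nth [ffun=> 1] (p1 ++ x :: p2) j = nth [ffun=> 1] (p1 ++ [ffun=> 1] :: p2) j.
  move=> hj; rewrite !nth_cat; case: ltnP => // h.
  have h' : (size p1 < j)%N by rewrite ltn_neqAle eq_sym hj.
  by rewrite -(subnSK h').
have hl x y z : mk_slot a (p1 ++ pair_fun x y :: p2) = set_slot
    (mk_slot a (p1 ++ pair_fun z y :: p2)) (Ordinal lk)
    (nth [ffun=> 1] ([ffun=> 1] :: p1 ++ pair_fun z y :: p2) (size p1) ord_max
      * a (Ordinal lk) * x).
  apply/ffunP => -[j hj]; rewrite !ffunE -(inj_eq val_inj) /=; case: eqP => [e|/eqP ne].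
    have -> : Ordinal hj = Ordinal lk by apply: val_inj.
    subst j; congr (_ * _ * _); last by rewrite nth_cat ltnn subnn /= pair_fun0.
    case hm: (size p1) => [//|m] /=.
    by rewrite !nth_cat hm ltnS leqnn.
  congr (_ * _ * _); last by rewrite nth0 // [in RHS]nth0.
  case: j hj ne => [//|j] hj ne /=; have [->|nj] := eqVneq j (size p1).
    by rewrite !nth_cat ltnn subnn /= !pair_fun1.
  by rewrite nth0 // [in RHS]nth0.
have hr x y z : mk_slot a (p1 ++ pair_fun x y :: p2) = set_slot
    (mk_slot a (p1 ++ pair_fun x z :: p2)) (Ordinal rk)
    (y * a (Ordinal rk) * nth [ffun=> 1] (p1 ++ pair_fun x z :: p2) (size p1).+1 ord0).
  apply/ffunP => -[j hj]; rewrite !ffunE -(inj_eq val_inj) /=; case: eqP => [e|/eqP ne].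
    have -> : Ordinal hj = Ordinal rk by apply: val_inj.
    subst j => /=; congr (_ * _ * _); first by rewrite nth_cat ltnn subnn /= pair_fun1.
    by rewrite nth0 ?[in RHS]nth0 // gtn_eqF.
  congr (_ * _ * _).
    case: j hj ne => [//|j] hj; rewrite eqSS => ne /=.
    by rewrite nth0 // [in RHS]nth0.
  have [->|nj] := eqVneq j (size p1).
    by rewrite !nth_cat ltnn subnn /= !pair_fun0.
  by rewrite nth0 // [in RHS]nth0.
have pl n (b : {ffun 'I_n.+1 -> A}) i c x y : pure (set_slot b i (c *: x + y)) =
    c *: pure (set_slot b i x) + pure (set_slot b i y).
  by apply: val_inj; apply/funext => g; apply: (svalP g).
apply: mlin2 => c x x' y.
  by rewrite (hl (c *: x + x') y 0) mulrDr -scalerAr pl -!hl.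
by rewrite (hr x (c *: x' + y) 0) !mulrDl -!scalerAl pl -!hr.
Qed.

(** The tuple of factors produced by the action of [m_k] on elementary
    arguments given as pairs. *)
Definition slots k (a : {ffun 'I_k.+1 -> A}) (q : seq (A * A)) : {ffun 'I_k.+1 -> A} :=
  [ffun j : 'I_k.+1 => (nth (1, 1) ((1, 1) :: q) j).2 * a j * (nth (1, 1) q j).1].

Lemma mk_slot_slots k (a : {ffun 'I_k.+1 -> A}) (q : seq (A * A)) :
  mk_slot a [seq pair_fun p.1 p.2 | p <- q] = slots a q.
Proof.
have one : [ffun=> 1] = pair_fun 1 1 :> {ffun 'I_2 -> A}.
  by apply/ffunP => j; rewrite !ffunE; case: ifP.
have h r j : nth [ffun=> 1] [seq pair_fun p.1 p.2 | p <- r] j =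
    pair_fun (nth (1, 1) r j).1 (nth (1, 1) r j).2 :> {ffun 'I_2 -> A}.
  elim: r j => [|p r IH] [|j] //=; by rewrite ?nth_nil.
apply/ffunP => j; rewrite !ffunE h pair_fun0; congr (_ * _ * _).
have -> : [ffun=> 1] :: [seq pair_fun p.1 p.2 | p <- q] =
   [seq pair_fun p.1 p.2 | p <- (1, 1) :: q] by rewrite /= -one.
by rewrite h pair_fun1.
Qed.

Lemma choices_map (T T' : Type) (f : T -> T') (ss : seq (seq T)) :
  choices [seq [seq f u | u <- s] | s <- ss] = [seq [seq f u | u <- p] | p <- choices ss].
Proof.
elim: ss => [//|s ss IH] /=; rewrite IH allpairs_mapl allpairs_mapr map_allpairs.
by [].
Qed.

Lemma sharp_mk_pure k (a : {ffun 'I_k.+1 -> A}) (U : 'I_k -> tens A 2)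
    (s : 'I_k -> seq (A * A)) : (forall j, U j = tsum (s j)) ->
  sharp_mk (pure a) U =
    \sum_(q <- choices [seq s j | j <- enum 'I_k]) pure (slots a q).
Proof.
move=> hU; rewrite /sharp_mk -[pure a](big_seq1 +%R a (@pure R A k.+1)) lin_extE.
- rewrite big_seq1; set s' := [seq [seq pair_fun p.1 p.2 | p <- s j] | j <- enum 'I_k].
  transitivity (\sum_(p <- choices s') pure (mk_slot a p)).
    apply: (@choices_sum k) => [|||j jk|p1 p2 hk].
    + exact: separated_tens.
    + by rewrite size_map size_enum_ord.
    + by rewrite size_map size_enum_ord.
    + rewrite (nth_map (Ordinal jk)) ?size_enum_ord // -tens_decomp.
      rewrite /s' (nth_map (Ordinal jk)) ?size_enum_ord // -tsumE; exact: hU.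
    + exact: mk_slot_mlin_arg hk.
  have -> : s' = [seq [seq pair_fun p.1 p.2 | p <- t] | t <- [seq s j | j <- enum 'I_k]].
    by rewrite -map_comp.
  by rewrite choices_map big_map; apply: eq_bigr => q _; rewrite mk_slot_slots.
- exact: separated_tens.
- move=> b i c x y; rewrite scaler_sumr -big_split /=; apply: eq_bigr => p _.
  exact: mk_slot_mlin.
Qed.

Definition gaps k n (M : 'I_n -> A) (i : {ffun 'I_k -> 'I_n}) : {ffun 'I_k.+1 -> A} :=
  let s := [seq val (i j) | j <- enum 'I_k] in
  [ffun j : 'I_k.+1 => \prod_(l < n | (nth 0 (0 :: map succn s) j <= l < nth n s j)%N) M l].

(** Allows the decompositions of the biprocesses that are read off their
    expressions as sums of elementary biprocesses. *)
Lemma product_integrandE n k (M : 'I_n -> R -> A) (V : 'I_n -> R -> tens A 2) t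
    (s : 'I_n -> seq (A * A)) : (forall i, V i t = tsum (s i)) ->
  product_integrand k M V t =
    \sum_(i : {ffun 'I_k.+1 -> 'I_n} | increasing i)
      \sum_(q <- choices [seq s (i j) | j <- enum 'I_k.+1])
        let b := slots (gaps (fun l => M l t) i) q in
        (\prod_(j < k.+2 | (0 < j < k.+1)%N) ws_tr (b j)) *: tensor2 (b ord0) (b ord_max).
Proof.
move=> hV; rewrite /product_integrand.
pose S (i : {ffun 'I_k.+1 -> 'I_n}) := [seq slots (gaps (fun l => M l t) i) q |
  q <- choices [seq s (i j) | j <- enum 'I_k.+1]].
have -> : \sum_(i : {ffun 'I_k.+1 -> 'I_n} | increasing i)
    sharp_mk (gaps_tensor (fun l => M l t) i) (fun j => V (i j) t) =
    \sum_(a <- flatten [seq S i | i <- enum {ffun 'I_k.+1 -> 'I_n} & increasing i]) pure a.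
  rewrite big_flatten big_map big_filter big_enum_cond /=; apply: eq_bigr => i _.
  by rewrite (@sharp_mk_pure k.+1 _ _ (fun j => s (i j))) // big_map.
rewrite tphi_sum big_flatten big_map big_filter big_enum_cond /=; apply: eq_bigr => i _.
by rewrite big_map.
Qed.

End IntegrandEvaluation.

(** * Orthogonality of adapted increments *)

Section Orthogonality.
Context {R : realType} {A : tracial_vN R}.
Implicit Types (x y : A).

Lemma n2_sqD x y : ws_tr (ws_star x * y) = 0 -> n2 (x + y) ^+ 2 = n2 x ^+ 2 + n2 y ^+ 2.
Proof.
move=> h; apply: complexI; rewrite realcD -!n2_sq starD mulrDl !mulrDr !trD h addr0.
have -> : ws_tr (ws_star y * x) = 0 by rewrite -[x]starK -starM tr_star h rmorph0.
by rewrite add0r.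
Qed.

(** A summand is orthogonal to the earlier ones, which lie in its past. *)
Lemma pythagoras (C : nat -> set A) (y : nat -> A) Q :
  (forall q, star_subalgebra (C q)) -> (forall q, C q `<=` C q.+1) ->
  (forall q, (q < Q)%N -> C q.+1 (y q)) ->
  (forall q, (q < Q)%N -> forall b, C q b -> ws_tr (b * y q) = 0) ->
  n2 (\sum_(q < Q) y q) ^+ 2 = \sum_(q < Q) n2 (y q) ^+ 2.
Proof.
move=> hC CS Cy ty.
have mono : forall q q', (q <= q')%N -> C q `<=` C q'.
  move=> q q' /subnKC <-; elim: (q' - q)%N => [|m IH]; first by rewrite addn0.
  by rewrite addnS => x /IH /CS.
elim: Q Cy ty => [|Q IH] Cy ty; first by rewrite !big_ord0 n2_0 expr0n.
rewrite !big_ord_recr /= n2_sqD ?IH // => [q hq|q hq|]; first exact/Cy/ltnW.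
  exact/ty/ltnW.
apply: ty => //; apply: (subS (hC _)); apply: (sub_sum (hC _)) => q.
by apply: (mono q.+1) => //; apply: Cy; rewrite ltnW // ltnS.
Qed.

Definition adapted_tens (B : set A) (u : tens A 2) :=
  exists2 s : seq (A * A), (forall p, p \in s -> B p.1 /\ B p.2) & u = tsum s.

Lemma adapted_tens_sum (B : set A) (I : Type) (s : seq I) (P : pred I) (f : I -> tens A 2) :
  (forall i, P i -> adapted_tens B (f i)) -> adapted_tens B (\sum_(i <- s | P i) f i).
Proof.
move=> h; apply: (big_ind (adapted_tens B)) => //.
  by exists [::] => //; rewrite /tsum big_nil.
move=> u v [s1 h1 ->] [s2 h2 ->]; exists (s1 ++ s2); last by rewrite tsum_cat.
by move=> p; rewrite mem_cat => /orP[/h1|/h2].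
Qed.

Lemma adapted_tensZ (B : set A) c u : star_subalgebra B ->
  adapted_tens B u -> adapted_tens B (c *: u).
Proof.
move=> hB [s hs ->]; rewrite tsumZ; eexists; last reflexivity.
by move=> _ /mapP[p /hs[h1 h2] ->]; split=> //; apply: subZ.
Qed.

Lemma adapted_tensD (B : set A) u v :
  adapted_tens B u -> adapted_tens B v -> adapted_tens B (u + v).
Proof.
move=> [s1 h1 ->] [s2 h2 ->]; exists (s1 ++ s2); last by rewrite tsum_cat.
by move=> p; rewrite mem_cat => /orP[/h1|/h2].
Qed.

Lemma adapted_tensB (B : set A) u v : star_subalgebra B ->
  adapted_tens B u -> adapted_tens B v -> adapted_tens B (u - v).
Proof. by move=> hB hu hv; apply: adapted_tensD => //; rewrite -scaleN1r; apply: adapted_tensZ. Qed.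

Lemma adapted_tensW (B C : set A) u : B `<=` C -> adapted_tens B u -> adapted_tens C u.
Proof. by move=> BC [s hs ->]; exists s => // p /hs[/BC ? /BC ?]. Qed.

Lemma adapted_tensor2 (B : set A) x y : B x -> B y -> adapted_tens B (tensor2 x y).
Proof.
move=> Bx By; exists [:: (x, y)]; last by rewrite /tsum big_seq1.
by move=> p; rewrite inE => /eqP ->.
Qed.

Lemma sharpD (u v : tens A 2) d : sharp (u + v) d = sharp u d + sharp v d.
Proof. by have := sharpL 1 u v d; rewrite !scale1r. Qed.

Lemma sharp0 d : sharp (0 : tens A 2) d = 0.
Proof. by have := sharp_tsum [::] d; rewrite /tsum !big_nil. Qed.

Lemma sharpZ c (u : tens A 2) d : sharp (c *: u) d = c *: sharp u d.
Proof. by have := sharpL c u 0 d; rewrite sharp0 !addr0. Qed.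

Lemma sharpB (u v : tens A 2) d : sharp (u - v) d = sharp u d - sharp v d.
Proof. by rewrite -scaleN1r sharpD sharpZ scaleN1r. Qed.

Lemma sharp_sum (I : Type) (s : seq I) (P : pred I) (f : I -> tens A 2) d :
  sharp (\sum_(i <- s | P i) f i) d = \sum_(i <- s | P i) sharp (f i) d.
Proof.
apply: (big_morph (fun u => sharp u d)) => [u v|]; [exact: sharpD|exact: sharp0].
Qed.

Lemma sharp_tensor2 x y d : sharp (tensor2 x y) d = x * d * y.
Proof.
have -> : tensor2 x y = tsum [:: (x, y)] by rewrite /tsum big_seq1.
by rewrite sharp_tsum big_seq1.
Qed.

Lemma sharpDr (u : tens A 2) d d' : sharp u (d + d') = sharp u d + sharp u d'.
Proof.
have [s ->] := tsum_ex u; rewrite !sharp_tsum -big_split /=.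
by apply: eq_bigr => p _; rewrite mulrDr mulrDl.
Qed.

Lemma sharpZr (u : tens A 2) c d : sharp u (c *: d) = c *: sharp u d.
Proof.
have [s ->] := tsum_ex u; rewrite !sharp_tsum scaler_sumr.
by apply: eq_bigr => p _; rewrite -scalerAr -scalerAl.
Qed.

Lemma sharp0r (u : tens A 2) : sharp u 0 = 0.
Proof. by have := sharpZr u 0 0; rewrite !scale0r. Qed.

Lemma sharpBr (u : tens A 2) d d' : sharp u (d - d') = sharp u d - sharp u d'.
Proof. by rewrite -scaleN1r sharpDr sharpZr scaleN1r. Qed.

Lemma sharp_sumr (u : tens A 2) (I : Type) (s : seq I) (P : pred I) (f : I -> A) :
  sharp u (\sum_(i <- s | P i) f i) = \sum_(i <- s | P i) sharp u (f i).
Proof. exact: (big_morph (sharp u) (sharpDr u) (sharp0r u)). Qed.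

Lemma sharp1 (u : tens A 2) : sharp u 1 = tmul u.
Proof.
have [s ->] := tsum_ex u; rewrite sharp_tsum tmul_tsum.
by apply: eq_bigr => p _; rewrite mulr1.
Qed.

Lemma tmulD (u v : tens A 2) : tmul (u + v) = tmul u + tmul v.
Proof. by rewrite -!sharp1 sharpD. Qed.

Lemma tmulB (u v : tens A 2) : tmul (u - v) = tmul u - tmul v.
Proof. by rewrite -!sharp1 sharpB. Qed.

Lemma tmul0 : tmul (0 : tens A 2) = 0.
Proof. by rewrite -sharp1 sharp0. Qed.

Lemma tmulZ c (u : tens A 2) : tmul (c *: u) = c *: tmul u.
Proof. by rewrite -!sharp1 sharpZ. Qed.

Lemma tmul_sum (I : Type) (s : seq I) (P : pred I) (f : I -> tens A 2) :
  tmul (\sum_(i <- s | P i) f i) = \sum_(i <- s | P i) tmul (f i).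
Proof. by rewrite -sharp1 sharp_sum; apply: eq_bigr => i _; rewrite sharp1. Qed.

Lemma tmul_tensor2 x y : tmul (tensor2 x y) = x * y.
Proof. by rewrite -sharp1 sharp_tensor2 mulr1. Qed.

Section Free.
Variables (B G : set A).
Hypotheses (hB : star_subalgebra B) (hG : star_subalgebra G).
Hypothesis hfree : forall c l, l != [::] ->
  alternates (fun c : bool => if c then G else B) c l -> ws_tr (\prod_(x <- l) x) = 0.

(** The isometry behind stochastic integration: by freeness the trace of
    [(u # x)^* (u # x)] is that of [x^2] times the square norm of [u]. *)
Lemma n2_sharp u x : adapted_tens B u -> G x -> ws_star x = x -> ws_tr x = 0 ->
  n2 (sharp u x) = n2 x * tnorm2 u.
Proof.
move=> [s hs ->] Gx xs tx.
apply/eqP; rewrite -(@eqrXn2 _ 2) ?mulr_ge0 ?n2_ge0 ?tnorm2_ge0 //; apply/eqP/complexI.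
rewrite exprMn (realcM (n2 x ^+ 2)) -tnorm2_sq -!n2_sq sharp_tsum star_sum mulr_suml tr_sum.
under eq_bigr do rewrite mulr_sumr tr_sum.
rewrite tdot_tsum exchange_big mulr_sumr; apply: eq_big_seq => p hp.
rewrite mulr_sumr; apply: eq_big_seq => q hq.
have [Bp1 Bp2] := hs p hp; have [Bq1 Bq2] := hs q hq.
rewrite !starM xs.
have -> : ws_tr (ws_star q.2 * (x * ws_star q.1) * (p.1 * x * p.2)) =
   ws_tr (p.2 * ws_star q.2 * x * (ws_star q.1 * p.1) * x).
  by rewrite mulrA ws_trC !mulrA.
rewrite (free_tr3 hB hG hfree) //; try by apply: (subM hB) => //; apply: (subS hB).
by ring.
Qed.

(** A centred increment free from the past makes [u # x] orthogonal to it. *)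
Lemma tr_sharp b u x : adapted_tens B u -> G x -> ws_tr x = 0 -> B b ->
  ws_tr (b * sharp u x) = 0.
Proof.
move=> [s hs ->] Gx tx Bb; rewrite sharp_tsum mulr_sumr tr_sum big_seq big1 // => p /hs[B1 B2].
have -> : ws_tr (b * (p.1 * x * p.2)) = ws_tr (p.2 * b * p.1 * x).
  by rewrite mulrA ws_trC !mulrA.
rewrite (free_tr_mul hB hG hfree) ?tx ?mulr0 //.
by apply: (subM hB) => //; apply: (subM hB).
Qed.

End Free.

End Orthogonality.

(** * The free stochastic measure *)

Section Moments.
Context {R : realType}.

Lemma poly_bounded (p : {poly R}) (T : R) :
  exists2 C, 0 <= C & forall h, 0 <= h <= T -> `|p.[h]| <= C.
Proof.
elim/poly_ind: p => [|p c [C C0 hC]].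
  by exists 0 => // h _; rewrite horner0 normr0.
exists (C * `|T| + `|c|); first by rewrite addr_ge0 ?mulr_ge0.
move=> h /andP[h0 hT]; rewrite hornerMXaddC (le_trans (ler_normD _ _)) // lerD2r.
rewrite normrM ler_pM //; first by apply: hC; rewrite h0.
by rewrite !ger0_norm // (le_trans h0).
Qed.

(** By the moment-cumulant formula: a partition with more than one block
    contributes a multiple of [h ^ 2] to the moment of order [h]. *)
Lemma moment_poly (r : nat -> R) (mut : R -> probability (measurableTypeR R) R) n :
  free_convolution_semigroup r mut -> (0 < n)%N ->
  exists p : {poly R}, forall h, 0 <= h ->
    moment (mut h) n = h * r n + h ^+ 2 * p.[h].
Proof.
move=> hmut n0.
pose one := [set [set: 'I_n]]%SET : {set {set 'I_n}}.
have part1 : finset.partition one [set: 'I_n]%SET && noncrossing one.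
  apply/andP; split.
    apply/and3P; split.
    - by rewrite finset.cover1.
    - exact: finset.trivIset1.
    - by rewrite finset.in_set1 eq_sym -card_gt0 finset.cardsT card_ord.
  apply/forall_inP => B /finset.set1P ->; apply/forall_inP => B' /finset.set1P ->.
  by rewrite eqxx.
exists (\sum_(P : {set {set 'I_n}} |
   (finset.partition P [set: 'I_n]%SET && noncrossing P) && (P != one))
   (\prod_(B in P) r #|B|) *: 'X^(#|P| - 2)) => h h0.
have [_ /(_ n n0) ->] := hmut h h0.
rewrite (bigD1 one) //= finset.big_set1 finset.cardsT card_ord; congr (_ + _).
rewrite horner_sum mulr_sumr; apply: eq_bigr => P /andP[/andP[hP _] P1].
rewrite big_split /= prodr_const hornerZ hornerXn mulrCA -exprD mulrC; congr (_ * _ ^+ _).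
have [/eqP cP _ hP0] := and3P hP.
suff : (1 < #|P|)%N by move=> /subnKC.
rewrite ltnNge; apply: contra P1 => P1; apply/eqP.
have [/eqP|] := posnP #|P|.
  rewrite finset.cards_eq0 => /eqP P0; move: cP; rewrite P0 /finset.cover finset.big_set0 => /setP/(_ (Ordinal n0)).
  by rewrite finset.in_setT finset.in_set0.
move=> P0; have /finset.cards1P[B PB] : #|P| == 1%N by rewrite eqn_leq P1.
by rewrite PB /one -cP PB finset.cover1.
Qed.

End Moments.

Section Process.
Context {R : realType} {A : tracial_vN R} (At : R -> set A) (r : nat -> R)
  (mut : R -> probability (measurableTypeR R) R) (X : R -> R -> A).
Hypotheses (hAt : vN_filtration At) (hmut : free_convolution_semigroup r mut)
  (hX : free_stochastic_measure At mut X).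

Lemma At_sub t : 0 <= t -> star_subalgebra (At t).
Proof. by case: hAt => h _ t0; apply: vN_star_subalgebra; apply: h. Qed.

Lemma At_mono s t : 0 <= s -> s <= t -> At s `<=` At t.
Proof. by case: hAt => _; apply. Qed.

Lemma X_star a b : 0 <= a -> a <= b -> ws_star (X a b) = X a b.
Proof. by move=> a0 ab; case: (fsm_distribution hX a0 ab). Qed.

Lemma X_add a b c : 0 <= a -> a <= b -> b <= c -> X a b + X b c = X a c.
Proof. exact: (fsm_additive hX). Qed.

Lemma X_diff a b : 0 <= a -> a <= b -> X 0 b - X 0 a = X a b.
Proof. by move=> a0 ab; rewrite -(@X_add 0 a b) // addrC addKr. Qed.

Lemma X_adapted t a b : 0 <= a -> a <= b -> b <= t -> At t (X a b).
Proof.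
move=> a0 ab bt; apply: (fsm_adapted hX) => //.
  by rewrite (le_trans a0) // (le_trans ab).
move=> x /=; rewrite !in_itv /= => /andP[ax xb].
by rewrite (le_trans a0) //= (lt_le_trans xb).
Qed.

Definition GX a b : set A := generated [set X a b].

Lemma GX_sub a b : star_subalgebra (GX a b).
Proof. exact: generated_subalgebra. Qed.

Lemma GX_X a b : GX a b (X a b).
Proof. exact: sub_generated. Qed.

Lemma GX_Xn a b n : GX a b (X a b ^+ n).
Proof. exact: (subX (GX_sub a b) n (@GX_X a b)). Qed.

Lemma GX_At a b t : 0 <= a -> a <= b -> b <= t -> GX a b `<=` At t.
Proof.
move=> a0 ab bt x; apply; last by move=> _ ->; apply: X_adapted.
by apply: At_sub; rewrite (le_trans a0) // (le_trans ab).
Qed.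

Lemma X_free a b : 0 <= a -> a <= b -> forall c l, l != [::] ->
  alternates (fun c : bool => if c then GX a b else At a) c l ->
  ws_tr (\prod_(x <- l) x) = 0.
Proof.
move=> a0 ab; apply: (@free_alternates _ _ (fun c : bool => if c then [set X a b] else At a)).
  apply: (fsm_free_past hX) => //; rewrite -subset0 => x [] /=.
  by rewrite !in_itv /= => /andP[ax _] /andP[_]; rewrite ltNge ax.
by case=> // x /= hx; apply: sub_generated.
Qed.

Lemma tr_Xn a b n : 0 <= a -> a <= b -> ws_tr (X a b ^+ n) = (moment (mut (b - a)) n)%:c.
Proof. by move=> a0 ab; have [_ ->] := fsm_distribution hX a0 ab. Qed.

Lemma tr_Xn_expand n (T : R) : (0 < n)%N -> exists2 C, 0 <= C &
  forall a b, 0 <= a -> a <= b -> b - a <= T ->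
    `|moment (mut (b - a)) n - (b - a) * r n| <= C * (b - a) ^+ 2.
Proof.
move=> n0; have [p hp] := moment_poly hmut n0.
have [C C0 hC] := poly_bounded p T; exists C => // a b a0 ab bT.
have h0 : 0 <= b - a by rewrite subr_ge0.
rewrite hp // addrC addKr normrM ger0_norm ?sqr_ge0 // mulrC ler_wpM2r ?sqr_ge0 //.
by apply: hC; rewrite h0.
Qed.

Lemma tr_Xn_bound n (T : R) : (0 < n)%N -> exists2 C, 0 <= C &
  forall a b, 0 <= a -> a <= b -> b - a <= T ->
    `|moment (mut (b - a)) n| <= C * (b - a).
Proof.
move=> n0; have [C C0 hC] := tr_Xn_expand T n0.
exists (C * `|T| + `|r n|); first by rewrite addr_ge0 ?mulr_ge0.
move=> a b a0 ab bT; have := hC a b a0 ab bT.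
have h0 : 0 <= b - a by rewrite subr_ge0.
set h := b - a in h0 bT *; move=> h1.
rewrite -[moment _ _](subrK (h * r n)).
apply: le_trans (ler_normD _ _) _; rewrite [leRHS]mulrDl lerD //.
  apply: le_trans h1 _; rewrite expr2 mulrA ler_wpM2r // ler_wpM2l //.
  by rewrite (le_trans bT) // ler_norm.
by rewrite normrM mulrC (ger0_norm h0).
Qed.

Lemma n2_Xn a b n : 0 <= a -> a <= b -> n2 (X a b ^+ n) ^+ 2 = moment (mut (b - a)) (n + n).
Proof.
move=> a0 ab; apply: complexI; rewrite -n2_sq starX X_star // -exprD tr_Xn //.
Qed.

Lemma n2_Xn_bound n (T : R) : (0 < n)%N -> exists2 C, 0 <= C &
  forall a b, 0 <= a -> a <= b -> b - a <= T -> n2 (X a b ^+ n) <= C * Num.sqrt (b - a).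
Proof.
move=> n0; have [C C0 hC] := @tr_Xn_bound (n + n) T ltac:(by rewrite addn_gt0 n0).
exists (Num.sqrt C); first exact: sqrtr_ge0.
move=> a b a0 ab bT; rewrite -sqrtrM // -[leLHS]ger0_norm ?n2_ge0 // -sqrtr_sqr.
by rewrite ler_wsqrtr // n2_Xn // (le_trans (ler_norm _)) // hC.
Qed.

(** ** A uniform bound of the process on a bounded interval *)

(** By Cauchy-Schwarz the numbers [n2 (x^m y) / (K^m n2 y)] at least square
    when [m] doubles; they are bounded, so the first one is at most [1]. *)
Lemma l2bounded_growth (x : A) K : ws_star x = x -> 0 < K ->
  (forall m, n2 (x ^+ m) <= K ^+ m) -> l2bounded K x.
Proof.
move=> xs K0 hK.
suff h y : n2 (x * y) <= K * n2 y by apply: l2bounded_left; rewrite ?xs.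
have [D D0 [_ hD]] := l2bounded_ex y.
have [->|ny0] := eqVneq y 0; first by rewrite mulr0 n2_0 mulr0.
have ny : 0 < n2 y.
  by rewrite lt_def n2_ge0 andbT; apply: contra ny0 => /eqP /n2_eq0 ->.
rewrite leNgt; apply/negP => hlt.
(* the ratios u (2^n) grow at least geometrically if u 1 > 1 *)
pose u m := n2 (x ^+ m * y) / (K ^+ m * n2 y).
have den m : 0 < K ^+ m * n2 y by rewrite mulr_gt0 // exprn_gt0.
have u_ge0 m : 0 <= u m by rewrite divr_ge0 ?n2_ge0 // ltW.
have u_sq m : u m ^+ 2 <= u (m + m)%N.
  have : n2 (x ^+ m * y) ^+ 2 <= n2 (x ^+ (m + m) * y) * n2 y.
    have -> : n2 (x ^+ m * y) ^+ 2 = re (ws_tr (ws_star y * (x ^+ (m + m) * y))).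
      have -> : ws_star y * (x ^+ (m + m) * y) = ws_star (x ^+ m * y) * (x ^+ m * y).
        by rewrite starM starX xs exprD !mulrA.
      by rewrite n2_sq.
    apply: le_trans (ler_norm _) (le_trans (cabs_re _) _).
    by apply: le_trans (tr_CS _ _) _; rewrite n2_star mulrC.
  have [d1 d2] := (den m, den (m + m)%N).
  rewrite /u expr_div_n ler_pdivrMr ?exprn_gt0 // mulrAC ler_pdivlMr //.
  have Kn : 0 <= K ^+ m * K ^+ m * n2 y by rewrite !mulr_ge0 ?exprn_ge0 // ltW.
  by move=> /(ler_wpM2l Kn); rewrite (exprD K); lra.
have u_bd m : u m <= D / n2 y.
  rewrite /u ler_pdivrMr // mulrCA divfK ?gt_eqF // mulrC.
  by apply: le_trans (hD _) _; rewrite ler_wpM2l.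
have u1 : 1 < u 1%N by rewrite /u !expr1 ltr_pdivlMr ?mulr_gt0 // mul1r.
have d0 : 0 < u 1%N - 1 by rewrite subr_gt0.
have grow n : 1 + n.+1%:R * (u 1%N - 1) <= u (2 ^ n)%N.
  elim: n => [|n IH]; first by rewrite expn0; lra.
  rewrite expnS mul2n -addnn; apply: le_trans (u_sq _).
  have h1 : (1 + n.+1%:R * (u 1%N - 1)) ^+ 2 <= u (2 ^ n)%N ^+ 2.
    by rewrite ler_sqr ?nnegrE // addr_ge0 // mulr_ge0 // ltW.
  apply: le_trans h1; rewrite -[n.+2%:R]natr1.
  have n1 : 1 <= n.+1%:R :> R by rewrite ler1n.
  have : 0 <= (n.+1%:R - 1) * (u 1%N - 1) by rewrite mulr_ge0 ?subr_ge0 // ltW.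
  have : 0 <= (n.+1%:R * (u 1%N - 1)) ^+ 2 by rewrite sqr_ge0.
  by lra.
have [n hn] : exists n : nat, D / n2 y / (u 1%N - 1) < n%:R.
  exists (Num.truncn (D / n2 y / (u 1%N - 1))).+1; apply: truncnS_gt.
have := grow n; have := u_bd (2 ^ n)%N; move: hn; rewrite ltr_pdivrMr // -natr1.
by lra.
Qed.

(** [X 0 T] is [X 0 s] plus the trace of [X s T] plus a centred increment, whose
    product with [y] is orthogonal to the past of [s]. *)
Lemma X0_bounded_past T s y : 0 <= s -> s <= T -> At s y ->
  forall K0 C1, l2bounded K0 (X 0 T) -> cabs (ws_tr (X s T)) <= C1 ->
  n2 (X 0 s * y) <= (K0 + C1) * n2 y.
Proof.
move=> s0 sT Ay K0 C1 [hK0 _] hC1.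
have As := At_sub s0.
set c := ws_tr (X s T) in hC1; set x := centre (X s T).
have Gx : GX s T x by apply: (sub_centre (GX_sub s T)); apply: GX_X.
have e : X 0 T * y = (X 0 s * y + c *: y) + x * y.
  rewrite -(X_add (lexx 0) s0 sT) mulrDl -addrA; congr (_ + _).
  by rewrite {1}(centreE (X s T)) mulrDl -scalerAl mul1r addrC.
have X0s : At s (X 0 s) by apply: X_adapted.
have Aw : At s (X 0 s * y + c *: y).
  by apply: (subD As); [apply: (subM As)|apply: (subZ As)].
have orth : ws_tr (ws_star (X 0 s * y + c *: y) * (x * y)) = 0.
  rewrite mulrA ws_trC mulrA.
  rewrite (free_tr_mul As (GX_sub s T) (X_free s0 sT)) ?tr_centre ?mulr0 //.
  by apply: (subM As) => //; apply: (subS As).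
have h1 : n2 (X 0 s * y + c *: y) <= K0 * n2 y.
  apply: le_trans (hK0 y); rewrite e.
  by rewrite -ler_sqr ?nnegrE ?n2_ge0 // (n2_sqD orth) lerDl sqr_ge0.
have -> : X 0 s * y = (X 0 s * y + c *: y) - c *: y by rewrite addrK.
apply: le_trans (n2_sub _ _) _; rewrite n2Z mulrDl lerD //.
by rewrite ler_wpM2r // n2_ge0.
Qed.

(** A bound uniform in the interval, which the definition of the process does
    not give: the bound of [X 0 T] on L2 is passed on to the powers of [X 0 s],
    which lie in the past of [s], and from their growth to [X 0 s]. *)
Lemma X_bounded T : 0 <= T -> exists2 K, 0 < K &
  forall a b, 0 <= a -> a <= b -> b <= T -> l2bounded K (X a b).
Proof.
move=> T0.
have [K0 K0_ge0 hK0] := l2bounded_ex (X 0 T).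
have [C C0 hC] := @tr_Xn_bound 1 T isT.
pose K := K0 + C * T + 1.
have Kp : 0 < K by rewrite ltr_wpDl // addr_ge0 // mulr_ge0.
have h s : 0 <= s -> s <= T -> l2bounded K (X 0 s).
  move=> s0 sT.
  have trb : cabs (ws_tr (X s T)) <= C * T.
    rewrite -[X s T]expr1 tr_Xn // cabs_real (le_trans (hC s T _ _ _)) //.
      by rewrite gerBl.
    by rewrite ler_wpM2l // gerBl.
  have past y : At s y -> n2 (X 0 s * y) <= K * n2 y.
    move=> Ay; apply: le_trans (X0_bounded_past s0 sT Ay hK0 trb) _.
    by rewrite ler_wpM2r ?n2_ge0 // lerDl.
  apply: l2bounded_growth => //; first exact: X_star.
  elim=> [|m IH]; first by rewrite !expr0 n2_1.
  rewrite !exprS; apply: le_trans (past _ _) _; last by rewrite ler_wpM2l // ltW.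
  by apply: (subX (At_sub s0)); apply: X_adapted.
exists (K + K); first by rewrite addr_gt0.
move=> a b a0 ab bT; rewrite -X_diff // -scaleN1r.
apply: l2boundedD; first by apply: h => //; rewrite (le_trans a0).
rewrite -[K]mul1r -(cabs1 (R := R)) -cabsN; apply: l2boundedZ; apply: h => //.
exact: le_trans bT.
Qed.

Lemma X_free_cell T E : 0 <= T -> exists2 kappa, 1 <= kappa &
  forall a b, 0 <= a -> a <= b -> b <= T -> b - a <= 1 ->
    free_cell kappa E (At a) (GX a b) (At b) (Num.sqrt (b - a)) (X a b).
Proof.
move=> T0; have [K K0 hK] := X_bounded T0.
have /choice[c1 hc1] : forall e, exists c, (0 < e)%N -> 0 <= c /\
    forall a b, 0 <= a -> a <= b -> b - a <= 1 -> n2 (X a b ^+ e) <= c * Num.sqrt (b - a).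
  case=> [|e]; first by exists 0.
  by have [C C0 hC] := @n2_Xn_bound e.+1 1 isT; exists C.
have /choice[c2 hc2] : forall e, exists c, (0 < e)%N -> 0 <= c /\
    forall a b, 0 <= a -> a <= b -> b - a <= 1 ->
      `|moment (mut (b - a)) e| <= c * (b - a).
  case=> [|e]; first by exists 0.
  by have [C C0 hC] := @tr_Xn_bound e.+1 1 isT; exists C.
pose g e := `|c1 e| + `|c2 e| + K ^+ e.
have g0 e : 0 <= g e by rewrite !addr_ge0 // exprn_ge0 // ltW.
pose kappa := 1 + \sum_(e < E.+1) g e.
have gk e : (e <= E)%N -> g e <= kappa.
  move=> eE; rewrite /kappa (bigD1 (Ordinal (_ : e < E.+1)%N)) //=.
  by rewrite addrCA lerDl addr_ge0 // sumr_ge0.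
exists kappa; first by rewrite lerDl sumr_ge0.
move=> a b a0 ab bT ba1.
have h0 : 0 <= b - a by rewrite subr_ge0.
have sq0 := sqrtr_ge0 (b - a).
have b0 : 0 <= b by rewrite (le_trans a0).
have trb e : (0 < e)%N -> cabs (ws_tr (X a b ^+ e)) <= `|c2 e| * (b - a).
  move=> e0; rewrite tr_Xn // cabs_real; have [_ /(_ a b a0 ab ba1)] := hc2 e e0.
  by move/le_trans; apply; rewrite ler_wpM2r // ler_norm.
have Kb e : l2bounded (K ^+ e) (X a b ^+ e).
  elim: e => [|e IH]; first by rewrite !expr0; apply: l2bounded1.
  by rewrite !exprS; apply: l2boundedM; rewrite ?exprn_ge0 ?(ltW K0) //; apply: hK.
have gE e : g e = `|c1 e| + `|c2 e| + K ^+ e by [].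
have Ke e : 0 <= K ^+ e by rewrite exprn_ge0 // ltW.
split.
- exact: At_sub.
- exact: GX_sub.
- exact: At_sub.
- exact: At_mono.
- exact: GX_At.
- exact: GX_X.
- exact: X_free.
- by [].
- by rewrite -sqrtr1 ler_wsqrtr.
- move=> e /andP[e0 /gk]; rewrite gE => eE; have [_ /(_ a b a0 ab ba1)] := hc1 e e0.
  move/le_trans; apply; rewrite ler_wpM2r //; apply: le_trans (ler_norm _) _.
  by have := Ke e; have := normr_ge0 (c2 e); lra.
- move=> e /andP[e0 /gk]; rewrite gE => eE; rewrite sqr_sqrtr //.
  apply: le_trans (trb e e0) _; rewrite ler_wpM2r //.
  by have := Ke e; have := normr_ge0 (c1 e); lra.
- move=> e /andP[e0 /gk]; rewrite gE => eE; apply: l2boundedW (Kb e).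
  by have := normr_ge0 (c2 e); have := normr_ge0 (c1 e); lra.
- move=> e /andP[e0 /gk]; rewrite gE => eE.
  apply: (@l2boundedW _ _ (K ^+ e + cabs (- ws_tr (X a b ^+ e)) * 1)); last first.
    by rewrite /centre -scaleNr; apply: l2boundedD => //; apply: l2boundedZ; exact: l2bounded1.
  rewrite cabsN mulr1; have := trb e e0; have := normr_ge0 (c1 e).
  have : `|c2 e| * (b - a) <= `|c2 e| by rewrite -[leRHS]mulr1 ler_wpM2l.
  by lra.
Qed.

(** ** Sums over a partition *)

(** The parts orthogonal to the past have square norms of order
    [(t q.+1 - t q) ^ 2], and the others norms of order
    [(t q.+1 - t q) * sqrt h]. *)
Lemma negligible_sum (t : nat -> R) Q (w : nat -> A) C h S :
  0 <= t 0%N -> (forall q, t q <= t q.+1) -> 0 <= C -> 0 <= h ->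
  (forall q, (q < Q)%N -> t q.+1 - t q <= h) -> t Q - t 0%N <= S ->
  (forall q, (q < Q)%N ->
     negligible (At (t q)) (At (t q.+1)) (Num.sqrt (t q.+1 - t q)) C (w q)) ->
  n2 (\sum_(q < Q) w q) <= C * (Num.sqrt (h * S) + Num.sqrt h * S).
Proof.
move=> t0 tm C0 h0 hh hS hw.
have tge0 q : 0 <= t q by elim: q => [//|q /le_trans]; apply.
have d0 q : 0 <= t q.+1 - t q by rewrite subr_ge0.
have tel : \sum_(q < Q) (t q.+1 - t q) <= S.
  by rewrite -(big_mkord xpredT (fun q => t q.+1 - t q)) telescope_sumr.
have /choice[yz hyz] : forall q, exists p : A * A, (q < Q)%N ->
    [/\ w q = p.1 + p.2, At (t q.+1) p.1,
      forall b, At (t q) b -> ws_tr (b * p.1) = 0,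
      n2 p.1 <= C * Num.sqrt (t q.+1 - t q) ^+ 2 &
      n2 p.2 <= C * Num.sqrt (t q.+1 - t q) ^+ 3].
  move=> q; case: (ltnP q Q) => hq; last by exists (0, 0).
  by have [y [z ?]] := hw q hq; exists (y, z).
rewrite (_ : \sum_(q < Q) w q = \sum_(q < Q) (yz q).1 + \sum_(q < Q) (yz q).2); last first.
  by rewrite -big_split /=; apply: eq_bigr => q _; have [-> _ _ _ _] := hyz q (ltn_ord q).
apply: le_trans (n2_add _ _) _; rewrite mulrDr lerD //.
  rewrite -[leLHS]ger0_norm ?n2_ge0 // -sqrtr_sqr -[X in X * _]ger0_norm //.
  rewrite -sqrtr_sqr -sqrtrM ?sqr_ge0 // ler_wsqrtr //.
  rewrite (@pythagoras _ _ (fun q => At (t q)) (fun q => (yz q).1)).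
  - apply: (@le_trans _ _ (\sum_(q < Q) C ^+ 2 * (h * (t q.+1 - t q)))); last first.
      by rewrite -!mulr_sumr ler_wpM2l ?sqr_ge0 // ler_wpM2l.
    apply: ler_sum => q _; have [_ _ _ hy _] := hyz q (ltn_ord q).
    apply: (@le_trans _ _ ((C * (t q.+1 - t q)) ^+ 2)).
      rewrite ler_sqr ?nnegrE ?n2_ge0 ?mulr_ge0 //.
      by apply: le_trans hy _; rewrite sqr_sqrtr.
    by rewrite exprMn ler_wpM2l ?sqr_ge0 // expr2 ler_wpM2r // hh.
  - by move=> q; apply: At_sub.
  - by move=> q; apply: At_mono.
  - by move=> q hq; have [] := hyz q hq.
  - by move=> q hq; have [] := hyz q hq.
apply: le_trans (n2_sum _ _) _.
apply: (@le_trans _ _ (\sum_(q < Q) C * (Num.sqrt h * (t q.+1 - t q)))); last first.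
  by rewrite -!mulr_sumr ler_wpM2l // ler_wpM2l // sqrtr_ge0.
apply: ler_sum => q _; have [_ _ _ _ hz] := hyz q (ltn_ord q).
apply: le_trans hz _; rewrite ler_wpM2l // exprS sqr_sqrtr // ler_wpM2r //.
by rewrite ler_wsqrtr // hh.
Qed.

(** The Ito isometry for the powers of the increments, after these are centred;
    the second term comes from their means. *)
Lemma isometry_X (t : nat -> R) Q k (u : nat -> tens A 2) :
  0 <= t 0%N -> (forall q, t q <= t q.+1) ->
  (forall q, (q < Q)%N -> adapted_tens (At (t q)) (u q)) ->
  n2 (\sum_(q < Q) sharp (u q) (X (t q) (t q.+1) ^+ k)) <=
    Num.sqrt (\sum_(q < Q) moment (mut (t q.+1 - t q)) (k + k) * tnorm2 (u q) ^+ 2) +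
    n2 (\sum_(q < Q) (moment (mut (t q.+1 - t q)) k)%:c *: tmul (u q)).
Proof.
move=> t0 tm hu.
have tge0 q : 0 <= t q by elim: q => [//|q /le_trans]; apply.
pose d q := X (t q) (t q.+1) ^+ k.
rewrite (_ : \sum_(q < Q) _ = \sum_(q < Q) sharp (u q) (centre (d q)) +
  \sum_(q < Q) (moment (mut (t q.+1 - t q)) k)%:c *: tmul (u q)); last first.
  rewrite -big_split /=; apply: eq_bigr => q _.
  by rewrite -/(d q) {1}(centreE (d q)) sharpDr sharpZr sharp1 /d tr_Xn.
apply: le_trans (n2_add _ _) _; rewrite lerD //.
rewrite -[leLHS]ger0_norm ?n2_ge0 // -sqrtr_sqr ler_wsqrtr //.
have Gd q : GX (t q) (t q.+1) (centre (d q)).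
  by apply: (sub_centre (GX_sub _ _)); apply: GX_Xn.
have ds q : ws_star (centre (d q)) = centre (d q).
  by rewrite star_centre starX X_star.
rewrite (@pythagoras _ _ (fun q => At (t q)) (fun q => sharp (u q) (centre (d q)))).
- apply: ler_sum => q _.
  rewrite (n2_sharp (At_sub (tge0 q)) (GX_sub _ _) (X_free (tge0 q) (tm q)) (hu q (ltn_ord q)))
    ?tr_centre // exprMn ler_wpM2r ?sqr_ge0 // -n2_Xn //.
  by rewrite ler_sqr ?nnegrE ?n2_ge0 // n2_centre.
- by move=> q; apply: At_sub.
- by move=> q; apply: At_mono.
- move=> q hq; have [s hs ->] := hu q hq; rewrite sharp_tsum big_seq.
  apply: (big_ind (At (t q.+1))) => [|x y|p /hs[p1 p2]].
  + exact: (sub0 (At_sub _)).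
  + exact: (subD (At_sub _)).
  + have As := At_sub (tge0 q.+1); apply: (subM As); last exact: (At_mono _ (tm q)).
    apply: (subM As); first exact: (At_mono _ (tm q)).
    exact: (GX_At (tge0 q) (tm q)).
- move=> q hq b Ab.
  by apply: (tr_sharp (At_sub (tge0 q)) (GX_sub _ _) (X_free (tge0 q) (tm q)) (hu q hq));
    rewrite ?tr_centre.
Qed.

End Process.

(** * Mixed moments of free families *)

Section FreeWords.
Context {R : realType} {A : tracial_vN R} (I : finType) (y : I -> A).
Hypothesis hfree : Defs.free (fun i => [set y i]).

Local Notation block := (I * nat)%type.
Implicit Types (l m : seq block).

Definition block_prod l := \prod_(p <- l) y p.1 ^+ p.2.

Definition degree l := (\sum_(p <- l) p.2)%N.

Variables (g : I -> R) (E : nat).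
Hypothesis g01 : forall i, 0 <= g i <= 1.
Hypothesis hg : forall i e, (0 < e <= E)%N -> cabs (ws_tr (y i ^+ e)) <= g i.

(** Each letter counts once, however often it occurs: one factor for the letter
    is gained from its first appearance, and merging blocks loses nothing. *)
Definition weight l := \prod_(i | i \in [seq p.1 | p <- l]) g i.

Lemma weight_ge0 l : 0 <= weight l.
Proof. by apply: prodr_ge0 => i _; case/andP: (g01 i). Qed.

Lemma weight_cons p l :
  weight (p :: l) = if p.1 \in [seq q.1 | q <- l] then weight l else g p.1 * weight l.
Proof.
rewrite /weight /=; case: ifP => h.
  by apply: eq_bigl => i; rewrite inE; case: eqP => [->|].
rewrite (bigD1 p.1) /= ?mem_head //; congr (_ * _); apply: eq_bigl => i.
by rewrite inE; case: eqP => [->|] /=; rewrite ?h ?andbT.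
Qed.

Lemma weight_cons_ge p l : g p.1 * weight l <= weight (p :: l).
Proof.
rewrite weight_cons; case: ifP => // _; have /andP[g0 g1] := g01 p.1.
by rewrite ler_piMl // weight_ge0.
Qed.

(** The terms of the expansion of the product of the centred blocks, with their
    coefficients. *)
Fixpoint expand l : seq (R[i] * seq block) :=
  if l is p :: l' then
    [seq (cm.1, p :: cm.2) | cm <- expand l'] ++
    [seq (- ws_tr (y p.1 ^+ p.2) * cm.1, cm.2) | cm <- expand l']
  else [:: (1, [::])].

Lemma expandE l : \prod_(p <- l) centre (y p.1 ^+ p.2) =
  \sum_(cm <- expand l) cm.1 *: block_prod cm.2.
Proof.
elim: l => [|p l IH] /=; first by rewrite big_seq1 /block_prod !big_nil scale1r.
rewrite big_cons IH big_cat !big_map /= /centre mulrBl -scalerAl mul1r; congr (_ + _).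
  rewrite mulr_sumr; apply: eq_bigr => cm _.
  by rewrite /block_prod big_cons -scalerAr.
rewrite -scaleNr scaler_sumr; apply: eq_bigr => cm _.
by rewrite scalerA.
Qed.

Lemma expand_head l : exists2 s, expand l = (1, l) :: s &
  forall cm, cm \in s -> (size cm.2 < size l)%N.
Proof.
elim: l => [|p l [s es hs]] /=; first by exists [::].
rewrite es /=; eexists; first reflexivity.
move=> cm; rewrite mem_cat inE => /orP[/mapP[dm /hs h ->] //|/orP[/eqP -> //|]].
by case/mapP => dm /hs h ->; rewrite /= ltnS ltnW.
Qed.

Definition positive l := all (fun p : block => (0 < p.2)%N) l.

Lemma expand_bound l : positive l -> (degree l <= E)%N ->
  forall cm, cm \in expand l -> [/\ cabs cm.1 * weight cm.2 <= weight l,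
    {subset [seq p.1 | p <- cm.2] <= [seq p.1 | p <- l]},
    positive cm.2 & (degree cm.2 <= degree l)%N].
Proof.
elim: l => [|p l IH] /=.
  by move=> _ _ cm; rewrite inE => /eqP -> /=; rewrite cabs1 mul1r.
move=> /andP[p0 pl]; rewrite /degree big_cons -/(degree l) => hE.
have dl : (degree l <= E)%N by apply: leq_trans hE; rewrite leq_addl.
move=> cm; rewrite mem_cat => /orP[] /mapP[dm hdm -> /=].
  have [h1 h2 h3 h4] := IH pl dl dm hdm; split => //=.
  - rewrite !weight_cons; case: ifP => hm.
      by rewrite (h2 _ hm).
    have /andP[g0 g1] := g01 p.1.
    have h : cabs dm.1 * (g p.1 * weight dm.2) <= g p.1 * weight l.
      by rewrite mulrCA ler_wpM2l.
    case: ifP => _ //; apply: le_trans h _.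
    by rewrite ler_piMl // weight_ge0.
  - move=> i; rewrite !inE => /orP[->//|/h2 ->]; by rewrite orbT.
  - by rewrite p0.
  - by rewrite big_cons leq_add2l.
have [h1 h2 h3 h4] := IH pl dl dm hdm; split => //=.
- apply: le_trans (weight_cons_ge p l); rewrite cabsM cabsN -mulrA ler_pM ?cabs_ge0 //.
    by rewrite mulr_ge0 ?cabs_ge0 ?weight_ge0.
  by apply: hg; rewrite p0 (leq_trans _ hE) // leq_addr.
- by move=> i /h2 hi; rewrite inE hi orbT.
- exact: leq_trans h4 (leq_addl _ _).
Qed.

Lemma size_expand l : size (expand l) = (2 ^ size l)%N.
Proof. by elim: l => //= p l IH; rewrite size_cat !size_map IH expnS mul2n addnn. Qed.

Definition no_repeat l := forall l1 l2 i e f, l <> l1 ++ (i, e) :: (i, f) :: l2.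

Lemma free_blocks l : l != [::] -> no_repeat l ->
  ws_tr (\prod_(p <- l) centre (y p.1 ^+ p.2)) = 0.
Proof.
case: l => // p0 l _ nr; rewrite (big_nth p0) big_mkord.
apply: (@hfree (size l).+1 (fun j => (nth p0 (p0 :: l) j).1)
  (fun j => centre (y (nth p0 (p0 :: l) j).1 ^+ (nth p0 (p0 :: l) j).2))) => //.
  move=> j _; split; last exact: tr_centre.
  apply: (sub_centre (@generated_subalgebra _ _ _)).
  by apply: (subX (@generated_subalgebra _ _ _)); apply: sub_generated.
move=> j hj; apply/negP => /eqP e.
have := nr (take j (p0 :: l)) (drop j.+2 (p0 :: l)) (nth p0 (p0 :: l) j).1
  (nth p0 (p0 :: l) j).2 (nth p0 (p0 :: l) j.+1).2; apply.
rewrite {2}e -!surjective_pairing -{1}(cat_take_drop j (p0 :: l)); congr (_ ++ _).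
by rewrite (@drop_nth _ p0 j (p0 :: l) (ltnW hj)) (@drop_nth _ p0 j.+1 (p0 :: l) hj).
Qed.

(** Adjacent blocks of the same letter are merged. When there are none, the
    product of the centred blocks has trace [0], which expresses the trace of
    the word through shorter words, whose coefficients supply the bounds of
    the letters that disappear. *)
Lemma free_block_bound l : positive l -> (degree l <= E)%N ->
  cabs (ws_tr (block_prod l)) <= (2 ^+ (size l ^ 2)) * weight l.
Proof.
have [n] := ubnP (size l); elim: n l => // n IH l ln hp hE.
have [->|l0] := eqVneq l [::].
  by rewrite /block_prod big_nil ws_tr1 cabs1 expr0 mul1r /weight big_pred0.
have [[l1 [l2 [i [e [f le]]]]]|nr] :=
    pselect (exists l1 l2 i e f, l = l1 ++ (i, e) :: (i, f) :: l2).
  pose l' := l1 ++ (i, e + f)%N :: l2.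
  have -> : block_prod l = block_prod l'.
    by rewrite le /block_prod !big_cat !big_cons /= exprD !mulrA.
  have -> : weight l = weight l'.
    apply: eq_bigl => j; rewrite le /l' !map_cat !mem_cat /= !inE.
    by case: (j == i).
  have sl : (size l').+1 = size l by rewrite le /l' !size_cat /= !addnS.
  apply: le_trans (IH l' _ _ _) _.
  - by rewrite -ltnS (leq_trans _ ln) // ltnS sl.
  - by move: hp; rewrite le /positive !all_cat /= addn_gt0 => /and4P[-> -> _ ->].
  - suff -> : degree l' = degree l by [].
    by rewrite le /degree !big_cat !big_cons /= -[(e + f + _)%N]addnA.
  rewrite ler_wpM2r ?weight_ge0 // ler_eXn2l ?ltr1n // -sl.
  by rewrite leq_exp2r.
have := free_blocks l0; rewrite expandE.
have [s es hs] := expand_head l; have hb := expand_bound hp hE.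
rewrite es big_cons scale1r trD => /(_ _)/eqP.
rewrite addr_eq0 => /(_ _)/eqP -> //; last first.
  by move=> l1 l2 i e f le; apply: nr; exists l1, l2, i, e, f.
rewrite cabsN tr_sum (le_trans (cabs_sum _ _ _)) //.
have step cm : cm \in s ->
    cabs (ws_tr (cm.1 *: block_prod cm.2)) <= 2 ^+ ((size l).-1 ^ 2) * weight l.
  move=> hcm; have [h1 h2 h3 h4] := hb cm ltac:(by rewrite es inE hcm orbT).
  have hs' := hs cm hcm.
  rewrite trZ cabsM; apply: le_trans (ler_wpM2l (cabs_ge0 _) (IH cm.2 _ h3 (leq_trans h4 hE))) _.
    by rewrite -ltnS (leq_trans _ ln).
  rewrite mulrCA ler_pM ?exprn_ge0 ?mulr_ge0 ?cabs_ge0 ?weight_ge0 //.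
  rewrite ler_eXn2l ?ltr1n // leq_exp2r // -ltnS prednK //.
  by rewrite lt0n size_eq0.
rewrite big_seq; apply: le_trans (ler_sum _ step) _; rewrite -big_seq big_const_seq count_predT iter_addr_0.
have := size_expand l; rewrite es /= => hsz.
have k0 : (0 < size l)%N by rewrite lt0n size_eq0.
rewrite -[leLHS]mulr_natl mulrA ler_wpM2r ?weight_ge0 //.
apply: (@le_trans _ _ ((2 ^ size l)%:R * 2 ^+ ((size l).-1 ^ 2))).
  by rewrite ler_wpM2r ?exprn_ge0 // ler_nat -hsz.
rewrite natrX -exprD ler_eXn2l ?ltr1n //.
by rewrite -{1 3}(prednK k0); case: (size l).-1 => [//|k]; rewrite !expnS !expn0; lia.
Qed.

(** Two different letters already give a bound of second order. *)
Lemma free_word_bound (h : R) (w : seq I) i j : (size w <= E)%N ->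
  i \in w -> j \in w -> i != j -> (forall i, g i <= h) ->
  cabs (ws_tr (\prod_(a <- w) y a)) <= 2 ^+ (size w ^ 2) * (g i * h).
Proof.
move=> wE iw jw ij gh; pose l := [seq (a, 1%N) | a <- w].
have -> : \prod_(a <- w) y a = block_prod l.
  by rewrite /block_prod big_map; apply: eq_bigr => a _; rewrite expr1.
have dl : degree l = size w by rewrite /degree big_map sum1_size.
have pl : positive l by rewrite /positive all_map; apply/allP.
have lw : [seq p.1 | p <- l] = w by rewrite -map_comp map_id.
have := free_block_bound pl; rewrite dl size_map => /(_ wE) /le_trans; apply.
rewrite ler_wpM2l ?exprn_ge0 // /weight lw (bigD1 i) //= (bigD1 j) /=; last first.
  by rewrite jw eq_sym.
have /andP[gi0 gi1] := g01 i; have /andP[gj0 gj1] := g01 j.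
rewrite ler_wpM2l //; apply: le_trans (gh j); rewrite ler_piMr //.
by apply: prodr_ile1 => a _; apply: g01.
Qed.

End FreeWords.

Section Powers.
Context {R : realType} {A : tracial_vN R} (I : finType) (y : I -> A).

Lemma power_words (s : seq I) k : (\sum_(i <- s) y i) ^+ k =
  \sum_(w <- choices (nseq k s)) \prod_(i <- w) y i.
Proof.
elim: k => [|k IH] /=; first by rewrite expr0 big_seq1 big_nil.
rewrite exprS IH big_allpairs_dep mulr_suml; apply: eq_bigr => i _.
by rewrite mulr_sumr; apply: eq_bigr => w _; rewrite big_cons.
Qed.

Lemma choices_filter (V : nmodType) (P : pred I) (s : seq I) k (F : seq I -> V) :
  \sum_(w <- choices (nseq k s) | all P w) F w =
  \sum_(w <- choices (nseq k [seq i <- s | P i])) F w.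
Proof.
elim: k F => [|k IH] F /=; first by rewrite big_mkcond /= !big_seq1.
rewrite big_mkcond !big_allpairs_dep big_filter [RHS]big_mkcond; apply: eq_bigr => i _.
case Pi : (P i); last by rewrite big1 // => w _; rewrite /= Pi.
rewrite -(IH (fun w => F (i :: w))) [RHS]big_mkcond.
by apply: eq_bigr => w _; rewrite /= Pi.
Qed.

Lemma size_choice (s : seq I) k w : w \in choices (nseq k s) -> size w = k.
Proof.
elim: k w => [|k IH] w /=; first by rewrite inE => /eqP ->.
by case/allpairsP => -[a q] [/= _ /IH hq ->] /=; rewrite hq.
Qed.

Hypothesis hfree : Defs.free (fun i => [set y i]).
Variables (g : I -> R) (k : nat).
Hypothesis g01 : forall i, 0 <= g i <= 1.
Hypothesis hg : forall i e, (0 < e <= k + k)%N -> cabs (ws_tr (y i ^+ e)) <= g i.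

(** Splitting off one element from two sums of free elements: the words that mix
    it with the others are of second order. *)
Lemma mixed_moment (h : R) (s s' : seq I) (i0 : I) : (0 < k)%N ->
  (forall i, g i <= h) ->
  cabs (ws_tr ((\sum_(i <- s) y i) ^+ k * (\sum_(i <- s') y i) ^+ k)
    - ws_tr ((\sum_(i <- s | i != i0) y i) ^+ k * (\sum_(i <- s' | i != i0) y i) ^+ k)
    - ws_tr ((\sum_(i <- s | i == i0) y i) ^+ k * (\sum_(i <- s' | i == i0) y i) ^+ k)) <=
  ((size (choices (nseq k s)) * size (choices (nseq k s')))%:R * 2 ^+ ((k + k) ^ 2))
    * (g i0 * h).
Proof.
move=> k0 gh.
pose tw w w' := ws_tr (\prod_(a <- w ++ w') y a).
have E (t t' : seq I) : ws_tr ((\sum_(i <- t) y i) ^+ k * (\sum_(i <- t') y i) ^+ k) =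
    \sum_(w <- choices (nseq k t)) \sum_(w' <- choices (nseq k t')) tw w w'.
  rewrite !power_words mulr_suml tr_sum; apply: eq_bigr => w _.
  by rewrite mulr_sumr tr_sum; apply: eq_bigr => w' _; rewrite /tw big_cat.
have E' P : ws_tr ((\sum_(i <- s | P i) y i) ^+ k * (\sum_(i <- s' | P i) y i) ^+ k) =
    \sum_(w <- choices (nseq k s)) \sum_(w' <- choices (nseq k s'))
      (if all P (w ++ w') then tw w w' else 0).
  rewrite -[in LHS]big_filter -[X in _ * X ^+ _]big_filter E -choices_filter big_mkcond.
  apply: eq_bigr => w _; case Pw : (all P w); last first.
    by rewrite big1 // => w' _; rewrite all_cat Pw.
  rewrite -choices_filter big_mkcond; apply: eq_bigr => w' _.
  by rewrite all_cat Pw.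
rewrite E !E' -!sumrB.
under eq_bigr do rewrite -!sumrB.
apply: le_trans (cabs_sum _ _ _) _.
have g0 : 0 <= g i0 * h.
  have /andP[g0 _] := g01 i0; rewrite mulr_ge0 //; exact: le_trans (gh i0).
have term w w' : w \in choices (nseq k s) -> w' \in choices (nseq k s') ->
    cabs (tw w w' - (if all (fun i => i != i0) (w ++ w') then tw w w' else 0)
      - (if all (fun i => i == i0) (w ++ w') then tw w w' else 0)) <=
    2 ^+ ((k + k) ^ 2) * (g i0 * h).
  move=> /size_choice sw /size_choice sw'.
  have sww : size (w ++ w') = (k + k)%N by rewrite size_cat sw sw'.
  have rhs0 : 0 <= 2 ^+ ((k + k) ^ 2) * (g i0 * h) by rewrite mulr_ge0 // exprn_ge0.
  case h1 : (all (fun i => i != i0) _); case h2 : (all (fun i => i == i0) _).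
  - move: sww h1 h2; case: (w ++ w') => [|a v] /=.
      by move=> /esym/eqP; rewrite addn_eq0; case: (k) k0.
    by move=> _ /andP[/negbTE ->].
  - by rewrite subrr subr0 cabs0.
  - by rewrite subr0 subrr cabs0.
  rewrite !subr0 -sww; move/negbT: h1 => /allPn[a aw]; rewrite negbK => /eqP a0.
  move/negbT: h2 => /allPn[b bw bi0].
  rewrite /tw; apply: (free_word_bound hfree g01 hg) bw _ gh; rewrite ?sww //.
    by rewrite -a0.
  by rewrite eq_sym.
rewrite mulrAC -mulrA natrM -!mulrA.
apply: (@le_trans _ _ (\sum_(w <- choices (nseq k s))
   \sum_(w' <- choices (nseq k s')) 2 ^+ ((k + k) ^ 2) * (g i0 * h))).
  rewrite big_seq [leRHS]big_seq; apply: ler_sum => w hw.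
  apply: le_trans (cabs_sum _ _ _) _.
  rewrite big_seq [leRHS]big_seq; apply: ler_sum => w' hw'.
  exact: term.
rewrite !big_const_seq !count_predT !iter_addr_0 -mulrnA -[leLHS]mulr_natr mulnC natrM.
by rewrite le_eqVlt; apply/orP; left; apply/eqP; ring.
Qed.

End Powers.

(** * Correlations of powers of increments *)

Section Overlap.
Context {R : realType}.
Implicit Types (a b c d x : R).

Definition clamp a b x := Num.min b (Num.max a x).
(** The length of the intersection of [a, b) and [c, d). *)
Definition overlap a b c d := clamp a b d - clamp a b c.

Lemma clamp_left a b x : a <= b -> x <= a -> clamp a b x = a.
Proof. by move=> ab xa; rewrite /clamp max_l // min_r. Qed.

Lemma clamp_mid a b x : a <= x -> x <= b -> clamp a b x = x.
Proof. by move=> ax xb; rewrite /clamp max_r // min_r. Qed.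

Lemma clamp_right a b x : a <= b -> b <= x -> clamp a b x = b.
Proof. by move=> ab bx; rewrite /clamp min_l // le_max bx orbT. Qed.

Lemma overlap_ge0 a b c d : c <= d -> 0 <= overlap a b c d.
Proof.
rewrite /overlap /clamp subr_ge0 => cd.
by rewrite le_min ge_min lexx /= !(ge_min, ge_max, le_max) lexx cd !orbT.
Qed.

Lemma overlap_case a b c d : a <= b -> c <= d ->
  [\/ (b <= c \/ d <= a) /\ overlap a b c d = 0,
      [/\ a <= c <= b, b <= d & overlap a b c d = b - c] \/
      [/\ c <= a <= d, d <= b & overlap a b c d = d - a],
      [/\ a <= c, d <= b & overlap a b c d = d - c] |
      [/\ c <= a, b <= d & overlap a b c d = b - a]].
Proof.
rewrite /overlap => ab cd; have ac_total := le_total a c; have bd_total := le_total b d.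
have [bc|/ltW cb] := leP b c.
  have bd' := le_trans bc cd.
  by constructor 1; split; [left|rewrite !clamp_right ?subrr].
have [da|/ltW ad] := leP d a.
  have ca := le_trans cd da.
  by constructor 1; split; [right|rewrite !clamp_left ?subrr].
case/orP: ac_total => ac; case/orP: bd_total => bd.
- by constructor 2; left; split; rewrite ?ac ?cb //; rewrite clamp_right // clamp_mid.
- by constructor 3; split=> //; rewrite !clamp_mid.
- by constructor 4; split=> //; rewrite clamp_right // clamp_left.
- by constructor 2; right; split; rewrite ?ac ?ad //; rewrite clamp_mid // clamp_left.
Qed.

Lemma overlapC a b c d : a <= b -> c <= d -> overlap a b c d = overlap c d a b.
Proof.
rewrite /overlap => ab cd; have ac_total := le_total a c; have bd_total := le_total b d.
have [bc|/ltW cb] := leP b c.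
  have bd' := le_trans bc cd; have ac := le_trans ab bc.
  by rewrite ![clamp a b _]clamp_right // ![clamp c d _]clamp_left // !subrr.
have [da|/ltW ad] := leP d a.
  have ca := le_trans cd da; have db := le_trans da ab.
  by rewrite ![clamp a b _]clamp_left // ![clamp c d _]clamp_right // !subrr.
case/orP: ac_total => ac; case/orP: bd_total => bd.
- by rewrite (clamp_right ab) // [clamp a b c]clamp_mid // clamp_mid // clamp_left.
- by rewrite ![clamp a b _]clamp_mid // clamp_right // clamp_left.
- by rewrite (clamp_right ab) // (clamp_left ab) // !clamp_mid.
- by rewrite [clamp a b d]clamp_mid // (clamp_left ab) // clamp_right // clamp_mid.
Qed.

Lemma overlap_sum a b (t : nat -> R) N :
  \sum_(j < N) overlap a b (t j) (t j.+1) = overlap a b (t 0%N) (t N).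
Proof.
by rewrite -(big_mkord xpredT (fun j => overlap a b (t j) (t j.+1))) telescope_sumr.
Qed.

End Overlap.

Section Covariance.
Context {R : realType} {A : tracial_vN R} (At : R -> set A) (r : nat -> R)
  (mut : R -> probability (measurableTypeR R) R) (X : R -> R -> A).
Hypotheses (hAt : vN_filtration At) (hmut : free_convolution_semigroup r mut)
  (hX : free_stochastic_measure At mut X).

Lemma poly_lipschitz (p : {poly R}) (T : R) : 0 <= T ->
  exists2 C, 0 <= C & forall x y, 0 <= x <= T -> 0 <= y <= T ->
    `|p.[x] - p.[y]| <= C * `|x - y|.
Proof.
move=> T0; elim/poly_ind: p => [|p c [C C0 hC]].
  by exists 0 => // x y _ _; rewrite !horner0 subrr normr0 mul0r.
have [D D0 hD] := poly_bounded p T.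
exists (C * T + D); first by rewrite addr_ge0 ?mulr_ge0.
move=> x y hx hy; rewrite !hornerMXaddC.
have -> : p.[x] * x + c - (p.[y] * y + c) = (p.[x] - p.[y]) * x + p.[y] * (x - y) by ring.
apply: le_trans (ler_normD _ _) _; rewrite !normrM mulrDl lerD //.
  rewrite mulrAC ler_pM // ?hC //; have /andP[x0 xT] := hx; by rewrite ger0_norm.
by rewrite ler_wpM2r // hD.
Qed.

Lemma moment_lipschitz k : (0 < k)%N -> exists2 C, 0 <= C &
  forall x y, 0 <= x <= 2 -> 0 <= y <= 2 ->
    `|moment (mut x) k - moment (mut y) k| <= C * `|x - y|.
Proof.
move=> k0; have [p hp] := moment_poly hmut k0.
have [C C0 hC] := poly_lipschitz (r k *: 'X + 'X ^+ 2 * p) (ler0n R 2).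
exists C => // x y hx hy; have := hC x y hx hy.
have /andP[x0 _] := hx; have /andP[y0 _] := hy.
by rewrite !hp // !hornerE ![r k * _]mulrC.
Qed.

Lemma moments_bound E : exists2 kappa, 1 <= kappa &
  forall e, (0 < e <= E)%N -> forall a b, 0 <= a -> a <= b -> b - a <= 1 ->
    `|moment (mut (b - a)) e| <= kappa * (b - a).
Proof.
have /choice[f hf] : forall e, exists c, (0 < e)%N -> 0 <= c /\
    forall a b, 0 <= a -> a <= b -> b - a <= 1 ->
      `|moment (mut (b - a)) e| <= c * (b - a).
  case=> [|e]; first by exists 0.
  by have [C C0 hC] := tr_Xn_bound hmut 1 (ltn0Sn e); exists C.
exists (1 + \sum_(e < E.+1) `|f e|); first by rewrite lerDl sumr_ge0.
move=> e /andP[e0 eE] a b a0 ab ba1; have [_ /(_ a b a0 ab ba1)] := hf e e0.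
move/le_trans; apply; rewrite ler_wpM2r ?subr_ge0 // (le_trans (ler_norm _)) //.
rewrite (bigD1 (Ordinal (_ : e < E.+1)%N)) //= addrCA lerDl.
by rewrite addr_ge0 // sumr_ge0.
Qed.

(** The three letters are the increments over consecutive intervals. *)
Section ThreeIntervals.
Variables (p : nat -> R).
Hypotheses (p0 : 0 <= p 0%N) (pm : forall i, p i <= p i.+1).
Let y (i : 'I_3) := X (p i) (p i.+1).

Let p_mono i j : (i <= j)%N -> p i <= p j.
Proof. by move=> /subnKC <-; elim: (j - i)%N => [|m]; rewrite ?addn0 // addnS => /le_trans; apply. Qed.

Let p_ge0 i : 0 <= p i. Proof. exact: le_trans (p_mono (leq0n i)). Qed.

Lemma three_free : Defs.free (fun i : 'I_3 => [set y i]).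
Proof.
apply: (fsm_free hX (n := 3) (a := fun i => p i) (b := fun i => p i.+1)).
  by move=> i; rewrite p_ge0 pm.
move=> i j ij; rewrite -subset0 => x [] /=; rewrite !in_itv /=.
move=> /andP[ix xi] /andP[jx xj].
move: ij; rewrite -(inj_eq val_inj) /= neq_ltn => /orP[ij|ij].
  by have := lt_le_trans xi (le_trans (p_mono ij) jx); rewrite ltxx.
by have := lt_le_trans xj (le_trans (p_mono ij) ix); rewrite ltxx.
Qed.

Lemma three_mixed_moment k kappa h (s s' : seq 'I_3) (i0 : 'I_3) : (0 < k)%N -> 1 <= kappa ->
  (forall e, (0 < e <= k + k)%N -> forall a b, 0 <= a -> a <= b -> b - a <= 1 ->
    `|moment (mut (b - a)) e| <= kappa * (b - a)) ->
  (forall i : 'I_3, p i.+1 - p i <= h) -> kappa * h <= 1 ->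
  cabs (ws_tr ((\sum_(i <- s) y i) ^+ k * (\sum_(i <- s') y i) ^+ k)
    - ws_tr ((\sum_(i <- s | i != i0) y i) ^+ k * (\sum_(i <- s' | i != i0) y i) ^+ k)
    - ws_tr ((\sum_(i <- s | i == i0) y i) ^+ k * (\sum_(i <- s' | i == i0) y i) ^+ k)) <=
  ((size (choices (nseq k s)) * size (choices (nseq k s')))%:R * 2 ^+ ((k + k) ^ 2))
    * (kappa ^+ 2) * (p i0.+1 - p i0) * h.
Proof.
move=> k0 k1 hk hh kh.
have kp : 0 < kappa by apply: lt_le_trans k1.
have d0 i : 0 <= p i.+1 - p i by rewrite subr_ge0.
have h1 : h <= 1.
  have h0 : 0 <= h by apply: le_trans (d0 0%N) (hh ord0).
  by apply: le_trans kh; rewrite ler_peMl.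
pose g (i : 'I_3) := kappa * (p i.+1 - p i).
have gh i : g i <= kappa * h by rewrite /g ler_wpM2l ?(ltW kp).
apply: le_trans (@mixed_moment _ _ _ y three_free g k _ _ (kappa * h) s s' i0 k0 gh) _.
- by move=> i; rewrite mulr_ge0 ?(ltW kp) //= (le_trans (gh i)).
- move=> i e he; rewrite /y (tr_Xn hX) // cabs_real; apply: hk => //.
  by apply: le_trans (hh i) h1.
by rewrite /g le_eqVlt; apply/orP; left; apply/eqP; ring.
Qed.

End ThreeIntervals.

Let m k x := moment (mut x) k.

(** The end points cut the union of the intervals into three; the middle piece is
    the common part. Splitting it off leaves powers of two free increments and
    of one increment, the latter with moment [r (k + k)] times its length, up
    to second order. *)
Lemma covariance_staggered k : (0 < k)%N -> exists C h0, [/\ 0 <= C, 0 < h0 &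
  forall a c b d h, 0 <= a -> a <= c -> c <= b -> b <= d -> b - a <= h -> d - c <= h ->
    h <= h0 ->
    cabs (ws_tr (X a b ^+ k * X c d ^+ k) -
      (m k (b - a) * m k (d - c) + r (k + k)%N * (b - c))%:c) <= C * h * (b - c)].
Proof.
move=> k0; have kk0 : (0 < k + k)%N by rewrite addn_gt0 k0.
have [kappa k1 hk] := moments_bound (k + k).
have kp : 0 < kappa by apply: lt_le_trans k1.
have [C2 C20 hC2] := tr_Xn_expand hmut 1 kk0.
have [C3 C30 hC3] := moment_lipschitz k0.
pose o0 := @Ordinal 3 0 isT; pose o1 := @Ordinal 3 1 isT; pose o2 := @Ordinal 3 2 isT.
pose C1 := ((size (choices (nseq k [:: o0; o1])) * size (choices (nseq k [:: o1; o2])))%:R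
   * 2 ^+ ((k + k) ^ 2)) * (kappa ^+ 2).
have C10 : 0 <= C1 by rewrite mulr_ge0 ?exprn_ge0 ?(ltW kp) // mulr_ge0 ?exprn_ge0.
exists (C1 + C2 + 2 * C3 * kappa), kappa^-1; split.
- by rewrite !addr_ge0 // !mulr_ge0 // ltW.
- by rewrite invr_gt0.
move=> a c b d h a0 ac cb bd bah dch hh.
have h0 : 0 <= h by apply: le_trans dch; rewrite subr_ge0 (le_trans cb).
have kh : kappa * h <= 1 by rewrite mulrC -ler_pdivlMr // mul1r.
have h1 : h <= 1 by apply: le_trans kh; rewrite ler_peMl.
pose p i := nth d [:: a; c; b] i.
have pm i : p i <= p i.+1 by case: i => [|[|[|i]]] //=; rewrite /p /= nth_nil.
have hp (i : 'I_3) : p i.+1 - p i <= h.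
  by case: i => [[|[|[|//]]]] /= _; rewrite /p /=; lra.
have := @three_mixed_moment p a0 pm k kappa h [:: o0; o1] [:: o1; o2] o1 k0 k1 hk hp kh.
rewrite !big_cons !big_nil /= !addr0 /p /= -/C1.
have c0 : 0 <= c by apply: le_trans ac.
have b0 : 0 <= b by apply: le_trans cb.
rewrite !(X_add hX) // -exprD (tr_Xn hX) //.
have trLR : ws_tr (X a c ^+ k * X b d ^+ k) = (m k (c - a) * m k (d - b))%:c.
  rewrite (free_tr_mul (At_sub hAt b0) (GX_sub X b d) (X_free hX b0 bd)) ?(tr_Xn hX) ?realcM //.
    by apply: (subX (At_sub hAt b0)); apply: (X_adapted hX).
  exact: GX_Xn.
rewrite trLR => hmix.
have e1 := hC2 c b c0 cb ltac:(lra).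
have e2 : `|m k (c - a) * m k (d - b) - m k (b - a) * m k (d - c)| <=
    2 * C3 * kappa * h * (b - c).
  have -> : m k (c - a) * m k (d - b) - m k (b - a) * m k (d - c) =
    (m k (c - a) - m k (b - a)) * m k (d - b) + m k (b - a) * (m k (d - b) - m k (d - c)).
    by ring.
  apply: le_trans (ler_normD _ _) _; rewrite !normrM.
  have f1 : `|m k (c - a) - m k (b - a)| <= C3 * (b - c).
    apply: le_trans (hC3 _ _ _ _) _; [by apply/andP; split; lra..|].
    have -> : (c - a) - (b - a) = - (b - c) by ring.
    by rewrite normrN ger0_norm ?subr_ge0.
  have f2 : `|m k (d - b) - m k (d - c)| <= C3 * (b - c).
    apply: le_trans (hC3 _ _ _ _) _; [by apply/andP; split; lra..|].
    have -> : (d - b) - (d - c) = - (b - c) by ring.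
    by rewrite normrN ger0_norm ?subr_ge0.
  have g1 : `|m k (d - b)| <= kappa * h.
    apply: le_trans (hk k _ b d b0 bd _) _; [by rewrite k0 leq_addr|lra|].
    by rewrite ler_wpM2l ?(ltW kp) //; lra.
  have g2 : `|m k (b - a)| <= kappa * h.
    apply: le_trans (hk k _ a b a0 _ _) _; [by rewrite k0 leq_addr|lra|lra|].
    by rewrite ler_wpM2l ?(ltW kp).
  have := ler_pM (normr_ge0 _) (normr_ge0 _) f1 g1.
  have := ler_pM (normr_ge0 _) (normr_ge0 _) g2 f2.
  by lra.
set T := ws_tr _ in hmix *.
have -> : T - (m k (b - a) * m k (d - c) + r (k + k)%N * (b - c))%:c =
  (T - (m k (c - a) * m k (d - b))%:c - (moment (mut (b - c)) (k + k))%:c) +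
  (m k (c - a) * m k (d - b) - m k (b - a) * m k (d - c))%:c +
  (moment (mut (b - c)) (k + k) - (b - c) * r (k + k)%N)%:c.
  by rewrite !rmorphB !rmorphD !rmorphM /=; ring.
apply: le_trans (cabs_add _ _) _; rewrite cabs_real.
have := cabs_add (T - (m k (c - a) * m k (d - b))%:c - (moment (mut (b - c)) (k + k))%:c)
  (m k (c - a) * m k (d - b) - m k (b - a) * m k (d - c))%:c.
rewrite cabs_real.
have : C2 * (b - c) ^+ 2 <= C2 * h * (b - c).
  by rewrite expr2 mulrA ler_wpM2r ?subr_ge0 // ler_wpM2l //; lra.
by lra.
Qed.

(** As in the staggered case, the inner interval being the middle piece. *)
Lemma covariance_nested k : (0 < k)%N -> exists C h0, [/\ 0 <= C, 0 < h0 &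
  forall a c d b h, 0 <= a -> a <= c -> c <= d -> d <= b -> b - a <= h -> h <= h0 ->
    cabs (ws_tr (X a b ^+ k * X c d ^+ k) -
      (m k (b - a) * m k (d - c) + r (k + k)%N * (d - c))%:c) <= C * h * (d - c)].
Proof.
move=> k0; have kk0 : (0 < k + k)%N by rewrite addn_gt0 k0.
have [kappa k1 hk] := moments_bound (k + k).
have kp : 0 < kappa by apply: lt_le_trans k1.
have [C2 C20 hC2] := tr_Xn_expand hmut 1 kk0.
pose o0 := @Ordinal 3 0 isT; pose o1 := @Ordinal 3 1 isT; pose o2 := @Ordinal 3 2 isT.
pose C1 := ((size (choices (nseq k [:: o0; o1; o2])) * size (choices (nseq k [:: o1])))%:R
   * 2 ^+ ((k + k) ^ 2)) * (kappa ^+ 2).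
have C10 : 0 <= C1 by rewrite mulr_ge0 ?exprn_ge0 ?(ltW kp) // mulr_ge0 ?exprn_ge0.
exists (C1 + C2 + kappa * kappa), kappa^-1; split.
- by rewrite !addr_ge0 // !mulr_ge0 // ltW.
- by rewrite invr_gt0.
move=> a c d b h a0 ac cd db bah hh.
have h0 : 0 <= h by apply: le_trans bah; rewrite subr_ge0 (le_trans ac) // (le_trans cd).
have kh : kappa * h <= 1 by rewrite mulrC -ler_pdivlMr // mul1r.
have h1 : h <= 1 by apply: le_trans kh; rewrite ler_peMl.
pose p i := nth b [:: a; c; d] i.
have pm i : p i <= p i.+1 by case: i => [|[|[|i]]] //=; rewrite /p /= nth_nil.
have hp (i : 'I_3) : p i.+1 - p i <= h.
  by case: i => [[|[|[|//]]]] /= _; rewrite /p /=; lra.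
have := @three_mixed_moment p a0 pm k kappa h [:: o0; o1; o2] [:: o1] o1 k0 k1 hk hp kh.
rewrite !big_cons !big_nil /= !addr0 /p /= -/C1.
have c0 : 0 <= c by apply: le_trans ac.
have d0 : 0 <= d by apply: le_trans cd.
have cb : c <= b by apply: le_trans db.
rewrite !(X_add hX) // -exprD (tr_Xn hX) // [0 ^+ k]expr0n gtn_eqF // mulr0 tr0 subr0 => hmix.
have e1 := hC2 c d c0 cd ltac:(lra).
have e2 : `|m k (b - a) * m k (d - c)| <= kappa * kappa * h * (d - c).
  have g1 : `|m k (d - c)| <= kappa * (d - c).
    by apply: hk => //; [by rewrite k0 leq_addr|lra].
  have g2 : `|m k (b - a)| <= kappa * h.
    apply: le_trans (hk k _ a b a0 _ _) _; [by rewrite k0 leq_addr|lra|lra|].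
    by rewrite ler_wpM2l ?(ltW kp).
  rewrite normrM; have := ler_pM (normr_ge0 _) (normr_ge0 _) g2 g1.
  by lra.
set T := ws_tr _ in hmix *.
have -> : T - (m k (b - a) * m k (d - c) + r (k + k)%N * (d - c))%:c =
  (T - (moment (mut (d - c)) (k + k))%:c) - (m k (b - a) * m k (d - c))%:c +
  (moment (mut (d - c)) (k + k) - (d - c) * r (k + k)%N)%:c.
  by rewrite !rmorphB !rmorphD !rmorphM /=; ring.
apply: le_trans (cabs_add _ _) _; rewrite cabs_real.
have := cabs_add (T - (moment (mut (d - c)) (k + k))%:c) (- (m k (b - a) * m k (d - c))%:c).
rewrite cabsN cabs_real.
have : C2 * (d - c) ^+ 2 <= C2 * h * (d - c).
  by rewrite expr2 mulrA ler_wpM2r ?subr_ge0 // ler_wpM2l //; lra.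
by lra.
Qed.

(** Two intervals are disjoint, and then the increments are free, or staggered,
    or nested ([overlap_case]). *)
Lemma covariance k : (0 < k)%N -> exists C h0, [/\ 0 <= C, 0 < h0 &
  forall a b c d h, 0 <= a -> a <= b -> 0 <= c -> c <= d -> b - a <= h -> d - c <= h ->
    h <= h0 ->
    cabs (ws_tr (X a b ^+ k * X c d ^+ k) -
      (m k (b - a) * m k (d - c) + r (k + k)%N * overlap a b c d)%:c) <=
    C * h * overlap a b c d].
Proof.
move=> k0; have [C1 [h1 [C10 h10 H1]]] := covariance_staggered k0.
have [C2 [h2 [C20 h20 H2]]] := covariance_nested k0.
exists (C1 + C2), (Num.min h1 h2); split; [by rewrite addr_ge0|by rewrite lt_min h10|].
move=> a b c d h a0 ab c0 cd bah dch; rewrite le_min => /andP[hh1 hh2].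
have h0 : 0 <= h by apply: le_trans bah; rewrite subr_ge0.
have ov0 := overlap_ge0 a b cd.
have Ch1 : C1 * h * overlap a b c d <= (C1 + C2) * h * overlap a b c d.
  by rewrite -!mulrA ler_wpM2r ?mulr_ge0 // lerDl.
have Ch2 : C2 * h * overlap a b c d <= (C1 + C2) * h * overlap a b c d.
  by rewrite -!mulrA ler_wpM2r ?mulr_ge0 // lerDr.
case: (overlap_case ab cd) => [[dis ov]|[[/andP[ac cb] bd ov]|[/andP[ca ad] db ov]]|[ac db ov]|[ca bd ov]].
- rewrite ov !mulr0 addr0; case: dis => dis.
    rewrite (free_tr_mul (At_sub hAt c0) (GX_sub X c d) (X_free hX c0 cd)) ?(tr_Xn hX) //.
    + by rewrite -realcM subrr cabs0.
    + by apply: (subX (At_sub hAt c0)); apply: (X_adapted hX).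
    + exact: GX_Xn.
  rewrite ws_trC (free_tr_mul (At_sub hAt a0) (GX_sub X a b) (X_free hX a0 ab)) ?(tr_Xn hX) //.
  + by rewrite -realcM mulrC subrr cabs0.
  + by apply: (subX (At_sub hAt a0)); apply: (X_adapted hX).
  + exact: GX_Xn.
- by apply: le_trans Ch1; rewrite ov; apply: H1.
- by apply: le_trans Ch1; rewrite ov ws_trC mulrC [X in (X + _)%:c]mulrC mulrC; apply: H1.
- by apply: le_trans Ch2; rewrite ov; apply: H2.
- by apply: le_trans Ch2; rewrite ov ws_trC [X in (X + _)%:c]mulrC; apply: H2.
Qed.

End Covariance.

(** * Diagonal measures *)

Section Vanishing.
Context {R : realType}.
Implicit Types (u v : nat -> R).

Definition vanishing u := u n @[n --> \oo] --> (0 : R).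

Lemma vanishing_ext u v : (forall n, u n = v n) -> vanishing u -> vanishing v.
Proof. by move=> /funext ->. Qed.

Lemma vanishingD u v : vanishing u -> vanishing v -> vanishing (fun n => u n + v n).
Proof. by move=> hu hv; rewrite /vanishing -[0]addr0; apply: cvgD. Qed.

Lemma vanishingM c u : vanishing u -> vanishing (fun n => c * u n).
Proof. by move=> hu; rewrite /vanishing -[0](mulr0 c); apply: cvgM hu; apply: cvg_cst. Qed.

Lemma vanishing0 : vanishing (fun=> 0).
Proof. exact: cvg_cst. Qed.

Lemma vanishing_sum (I : Type) (s : seq I) (f : I -> nat -> R) :
  (forall i, vanishing (f i)) -> vanishing (fun n => \sum_(i <- s) f i n).
Proof.
move=> h; elim: s => [|i s IH].
  by apply: vanishing_ext vanishing0 => n; rewrite big_nil.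
by apply: vanishing_ext (vanishingD (h i) IH) => n; rewrite big_cons.
Qed.

Lemma vanishingMM u v : vanishing u -> vanishing v -> vanishing (fun n => u n * v n).
Proof. by move=> hu hv; rewrite /vanishing -[0](mulr0 0); apply: cvgM. Qed.

Lemma vanishing_le u v : (forall n, `|v n| <= u n) -> vanishing u -> vanishing v.
Proof.
move=> h /cvgrPdist_le hu; apply/cvgrPdist_le => e /hu; apply: filterS => n.
rewrite !sub0r !normrN; apply: le_trans; apply: le_trans (h n) _; exact: ler_norm.
Qed.

Lemma vanishing_le0 u a : (forall n, a <= u n) -> vanishing u -> a <= 0.
Proof.
move=> h hu; apply: (@cvgr_to_ge _ _ _ _ _ _ _ hu).
by exists 0%N => // n _ /=.
Qed.

Lemma vanishing_eps u : vanishing u -> forall e, 0 < e ->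
  exists N, forall n, (N <= n)%N -> `|u n| <= e.
Proof.
move=> /cvgrPdist_le hu e /hu[N _ hN]; exists N => n Nn.
by have := hN n Nn; rewrite /= sub0r normrN.
Qed.

Lemma eps_vanishing u : (forall e, 0 < e ->
  exists N, forall n, (N <= n)%N -> `|u n| <= e) -> vanishing u.
Proof.
move=> h; apply/cvgrPdist_le => e /h[N hN]; exists N => // n Nn.
by rewrite sub0r normrN; apply: hN.
Qed.

Lemma vanishing_inv : vanishing (fun n => n.+1%:R^-1).
Proof. exact: cvg_harmonic. Qed.

Lemma vanishing_sqrt u : (forall n, 0 <= u n) -> vanishing u ->
  vanishing (fun n => Num.sqrt (u n)).
Proof.
move=> u0 hu; apply: eps_vanishing => e e0.
have [N hN] := vanishing_eps hu (exprn_gt0 2 e0); exists N => n /hN.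
rewrite !ger0_norm ?sqrtr_ge0 // => h.
by rewrite -(ger0_norm (ltW e0)) -sqrtr_sqr ler_wsqrtr.
Qed.

End Vanishing.

Section Refinement.
Context {R : realType}.
Implicit Types (t : nat -> R) (N Q : nat).

(** Each cell of the grid [t] is cut into [N] equal pieces, numbered
    consecutively. *)
Definition refine t N j : R :=
  t (j %/ N)%N + (j %% N)%:R / N%:R * (t (j %/ N).+1 - t (j %/ N)%N).

Lemma refineE t N q i : (i < N)%N ->
  refine t N (q * N + i) = t q + i%:R / N%:R * (t q.+1 - t q).
Proof.
move=> iN; have N0 : (0 < N)%N by apply: leq_ltn_trans iN.
by rewrite /refine divnMDl // modnMDl modn_small // divn_small // addn0.
Qed.

Lemma refineES t N q i : (i < N)%N ->
  refine t N (q * N + i).+1 = t q + i.+1%:R / N%:R * (t q.+1 - t q).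
Proof.
move=> iN; have N0 : (0 < N)%N by apply: leq_ltn_trans iN.
have [iN'|] := ltnP i.+1 N; first by rewrite -addnS refineE.
move=> Ni; have -> : i.+1 = N by apply/eqP; rewrite eqn_leq iN.
rewrite -addnS (_ : i.+1 = N) ?divff ?pnatr_eq0 -?lt0n ?mul1r; last first.
- by apply/eqP; rewrite eqn_leq iN.
- by [].
have -> : (q * N + N = q.+1 * N + 0)%N by rewrite addn0 mulSn addnC.
by rewrite refineE // mul0r mul0r addr0 addrC subrK.
Qed.

Lemma refineM t N q : (0 < N)%N -> refine t N (q * N) = t q.
Proof. by move=> N0; rewrite -[(q * N)%N]addn0 refineE // !mul0r addr0. Qed.

Lemma refine_step t N q i : (i < N)%N ->
  refine t N (q * N + i).+1 - refine t N (q * N + i) = (t q.+1 - t q) / N%:R.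
Proof. by move=> iN; rewrite refineES // refineE // -natr1; lra. Qed.

Lemma refine_split N j : (0 < N)%N -> exists q i, (i < N)%N /\ j = (q * N + i)%N.
Proof. by move=> N0; exists (j %/ N)%N, (j %% N)%N; rewrite ltn_mod -divn_eq. Qed.

Lemma refine_mono t N : (0 < N)%N -> (forall q, t q <= t q.+1) ->
  forall j, refine t N j <= refine t N j.+1.
Proof.
move=> N0 tm j; have [q [i [iN ->]]] := refine_split j N0.
by rewrite -subr_ge0 refine_step // divr_ge0 // subr_ge0.
Qed.

Lemma sum_refine (V : nmodType) N Q (F : nat -> V) :
  \sum_(j < Q * N) F j = \sum_(q < Q) \sum_(i < N) F (q * N + i)%N.
Proof.
elim: Q => [|Q IH]; first by rewrite mul0n !big_ord0.
rewrite mulSn addnC big_split_ord /= IH big_ord_recr /=; congr (_ + _).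
Qed.

End Refinement.

Section DiagonalMeasures.
Context {R : realType} {A : tracial_vN R} (At : R -> set A) (r : nat -> R)
  (mut : R -> probability (measurableTypeR R) R) (X : R -> R -> A)
  (Delta : nat -> R -> R -> A).
Hypotheses (hAt : vN_filtration At) (hmut : free_convolution_semigroup r mut)
  (hX : free_stochastic_measure At mut X)
  (hDelta : forall k, (0 < k)%N -> diagonal_measure X k (Delta k)).

Let m k x := moment (mut x) k.

Definition pt (a b : R) N i := a + i%:R / N.+1%:R * (b - a).

Lemma pt0 a b N : pt a b N 0 = a. Proof. by rewrite /pt !mul0r addr0. Qed.

Lemma ptN a b N : pt a b N N.+1 = b.
Proof. by rewrite /pt divff ?pnatr_eq0 // mul1r addrC subrK. Qed.

Lemma pt_step a b N i : pt a b N i.+1 - pt a b N i = (b - a) / N.+1%:R.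
Proof. by rewrite /pt -(natr1 i); set x := (N.+1%:R)^-1; lra. Qed.

Lemma pt_mono a b N i : a <= b -> pt a b N i <= pt a b N i.+1.
Proof. by move=> ab; rewrite -subr_ge0 pt_step divr_ge0 // subr_ge0. Qed.

Lemma pt_ge a b N i : a <= b -> a <= pt a b N i.
Proof. by move=> ab; rewrite lerDl mulr_ge0 ?divr_ge0 // subr_ge0. Qed.

Definition power_sum k a b N := \sum_(i < N.+1) X (pt a b N i) (pt a b N i.+1) ^+ k.

Lemma power_sum_star k a b N : 0 <= a -> a <= b ->
  ws_star (power_sum k a b N) = power_sum k a b N.
Proof.
move=> a0 ab; rewrite star_sum; apply: eq_bigr => i _.
by rewrite starX (X_star hX) // ?pt_mono // (le_trans a0) // pt_ge.
Qed.

Lemma power_sum_Delta k a b : (0 < k)%N -> 0 <= a -> a <= b ->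
  vanishing (fun N => n2 (power_sum k a b N - Delta k a b)).
Proof.
move=> k0 a0 ab; have := hDelta k0 a0 ab; rewrite -cvg_shiftS => h.
apply: (@vanishing_le _ (fun N => 2 * opnorm (power_sum k a b N - Delta k a b))).
  by move=> N; rewrite ger0_norm ?n2_ge0 // n2_opnorm.
exact: vanishingM h.
Qed.

(** The term of second order of the moments adds up to a multiple of
    [1 / N]. *)
Lemma moment_sum k x : (0 < k)%N -> 0 <= x ->
  vanishing (fun N => N.+1%:R * m k (x / N.+1%:R) - x * r k).
Proof.
move=> k0 x0; have [C C0 hC] := tr_Xn_expand hmut x k0.
apply: (@vanishing_le _ (fun N => C * x ^+ 2 * N.+1%:R^-1)); last first.
  exact/vanishingM/vanishing_inv.
move=> N; have N1 : 0 < N.+1%:R :> R by rewrite ltr0n.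
have h0 : 0 <= x / N.+1%:R by rewrite divr_ge0.
have hx : x / N.+1%:R <= x by rewrite ler_pdivrMr // ler_peMr // ler1n.
have := hC 0 (x / N.+1%:R) (lexx 0) h0; rewrite subr0 => /(_ hx).
have -> : N.+1%:R * m k (x / N.+1%:R) - x * r k =
   N.+1%:R * (m k (x / N.+1%:R) - x / N.+1%:R * r k).
  by field; rewrite gt_eqF.
rewrite normrM gtr0_norm // => /(ler_wpM2l (ltW N1)) /le_trans; apply.
by rewrite le_eqVlt; apply/orP; left; apply/eqP; field; rewrite gt_eqF.
Qed.

(** The inner products of sums of powers are sums of correlations, where the
    terms of first order add up to the overlap of the intervals. *)
Lemma Delta_inner k a b c d : (0 < k)%N -> 0 <= a -> a <= b -> 0 <= c -> c <= d ->
  ws_tr (ws_star (Delta k a b) * Delta k c d) =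
    (r k ^+ 2 * (b - a) * (d - c) + r (k + k)%N * overlap a b c d)%:c.
Proof.
move=> k0 a0 ab c0 cd.
set v := (X in X%:c); set D1 := Delta k a b; set D2 := Delta k c d.
apply/eqP; rewrite -subr_eq0; apply/eqP.
suff h : cabs (ws_tr (ws_star D1 * D2) - v%:c) <= 0.
  apply/normr0_eq0; rewrite cabsE; congr (_%:c).
  by apply/le_anti; rewrite h cabs_ge0.
have [C [h0 [C0 h0p hcov]]] := covariance hAt hmut hX k0.
have ba0 : 0 <= b - a by rewrite subr_ge0.
have dc0 : 0 <= d - c by rewrite subr_ge0.
have ov0 := overlap_ge0 a b cd.
pose e1 N := n2 (power_sum k a b N - D1); pose e2 N := n2 (power_sum k c d N - D2).
have e1v : vanishing e1 by apply: power_sum_Delta.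
have e2v : vanishing e2 by apply: power_sum_Delta.
pose h N := (b - a + (d - c)) / N.+1%:R.
have hv : vanishing h by apply/vanishingM/vanishing_inv.
have [N0 hN0] := vanishing_eps hv h0p.
pose w1 N := N.+1%:R * m k ((b - a) / N.+1%:R); pose w2 N := N.+1%:R * m k ((d - c) / N.+1%:R).
have w1v : vanishing (fun N => w1 N - (b - a) * r k) by apply: moment_sum.
have w2v : vanishing (fun N => w2 N - (d - c) * r k) by apply: moment_sum.
pose err N := (e1 N * n2 D2 + (n2 D1 + e1 N) * e2 N) +
  (C * h N * overlap a b c d + `|w1 N * w2 N - r k ^+ 2 * (b - a) * (d - c)|).
have err_v : vanishing err.
  apply: vanishingD.
    apply: vanishingD.
      by apply: vanishing_ext (vanishingM (n2 D2) e1v) => N; rewrite mulrC.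
    apply: vanishing_ext (vanishingD (vanishingM (n2 D1) e2v) (vanishingMM e1v e2v)) => N.
    by rewrite mulrDl.
  apply: vanishingD.
    by apply: vanishing_ext (vanishingM (C * overlap a b c d) hv) => N; rewrite mulrAC.
  apply: (@vanishing_le _ (fun N => `|(w1 N - (b - a) * r k) * (w2 N - (d - c) * r k) +
      ((d - c) * r k * (w1 N - (b - a) * r k) + (b - a) * r k * (w2 N - (d - c) * r k))|)).
    by move=> N; rewrite normr_id le_eqVlt; apply/orP; left; apply/eqP; congr `|_|; ring.
  have vabs u : vanishing u -> vanishing (fun N => `|u N|).
    move=> hu; apply: eps_vanishing => e /(vanishing_eps hu)[N hN]; exists N => n /hN.
    by rewrite normr_id.
  by apply: vabs; apply: vanishingD; [exact: vanishingMM|apply: vanishingD; apply: vanishingM].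
apply: (@vanishing_le0 _ (fun N => err (N0 + N)%N)); last first.
  apply: eps_vanishing => e /(vanishing_eps err_v)[N hN]; exists N => n Nn.
  by apply: hN; rewrite (leq_trans Nn) // leq_addl.
move=> N'; set N := (N0 + N')%N.
have Nh0 : h N <= h0.
  by apply: le_trans (ler_norm _) (hN0 N _); rewrite leq_addr.
have N1 : 0 < N.+1%:R :> R by rewrite ltr0n.
set S1 := power_sum k a b N; set S2 := power_sum k c d N.
have -> : ws_tr (ws_star D1 * D2) - v%:c =
  (ws_tr (ws_star (D1 - S1) * D2) + ws_tr (ws_star S1 * (D2 - S2))) +
  (ws_tr (ws_star S1 * S2) - v%:c).
  by rewrite starB mulrBl mulrBr !trB; ring.
apply: le_trans (cabs_add _ _) _; apply: lerD.
  apply: le_trans (cabs_add _ _) _; apply: lerD.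
    apply: le_trans (tr_CS _ _) _; rewrite n2_star ler_wpM2r ?n2_ge0 //.
    by rewrite -n2N opprB.
  apply: le_trans (tr_CS _ _) _; rewrite n2_star ler_pM ?n2_ge0 //.
    by rewrite -[S1](subrK D1) addrC; apply: n2_add.
  by rewrite -n2N opprB.
rewrite power_sum_star //.
pose cov i j := ws_tr (X (pt a b N i) (pt a b N i.+1) ^+ k * X (pt c d N j) (pt c d N j.+1) ^+ k).
have -> : ws_tr (S1 * S2) = \sum_(i < N.+1) \sum_(j < N.+1) cov i j.
  by rewrite mulr_suml tr_sum; apply: eq_bigr => i _; rewrite mulr_sumr tr_sum.
pose ov i j := overlap (pt a b N i) (pt a b N i.+1) (pt c d N j) (pt c d N j.+1).
have ovS : \sum_(i < N.+1) \sum_(j < N.+1) ov i j = overlap a b c d.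
  under eq_bigr do rewrite overlap_sum pt0 ptN overlapC ?pt_mono //.
  by rewrite overlap_sum pt0 ptN overlapC.
have -> : \sum_(i < N.+1) \sum_(j < N.+1) cov i j - v%:c =
  \sum_(i < N.+1) \sum_(j < N.+1) (cov i j -
     (m k ((b - a) / N.+1%:R) * m k ((d - c) / N.+1%:R) + r (k + k)%N * ov i j)%:c) +
  (w1 N * w2 N - r k ^+ 2 * (b - a) * (d - c))%:c.
  under [in RHS]eq_bigr do rewrite sumrB.
  rewrite sumrB -addrA; congr (_ + _).
  have -> : \sum_(i < N.+1) \sum_(j < N.+1)
      (m k ((b - a) / N.+1%:R) * m k ((d - c) / N.+1%:R) + r (k + k)%N * ov i j)%:c =
      (w1 N * w2 N + r (k + k)%N * overlap a b c d)%:c.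
    rewrite -ovS mulr_sumr /w1 /w2.
    under eq_bigr do rewrite -rmorph_sum big_split /= sumr_const card_ord -mulr_sumr.
    rewrite -rmorph_sum big_split /= sumr_const card_ord; congr (_ + _)%:c.
    by rewrite -(mulr_natr (_ *+ _)) -(mulr_natr (m k _ * _)); ring.
  by rewrite /v !rmorphB !rmorphD /=; ring.
apply: le_trans (cabs_add _ _) _; rewrite cabs_real lerD2r.
apply: le_trans (cabs_sum _ _ _) _.
rewrite -ovS mulr_sumr; apply: ler_sum => i _.
apply: le_trans (cabs_sum _ _ _) _; rewrite mulr_sumr; apply: ler_sum => j _.
have := hcov (pt a b N i) (pt a b N i.+1) (pt c d N j) (pt c d N j.+1) (h N).
rewrite !pt_step; apply => //.
- by rewrite (le_trans a0) // pt_ge.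
- exact: pt_mono.
- by rewrite (le_trans c0) // pt_ge.
- exact: pt_mono.
- by rewrite ler_wpM2r ?invr_ge0 ?(ltW N1) // lerDl.
- by rewrite ler_wpM2r ?invr_ge0 ?(ltW N1) // lerDr.
Qed.

(** The definition of the diagonal measure of the union of two intervals uses
    other partitions than those of the intervals; but the inner products
    determine the norm of the defect of additivity, which is [0]. *)
Lemma Delta_add k a b c : (0 < k)%N -> 0 <= a -> a <= b -> b <= c ->
  Delta k a b + Delta k b c = Delta k a c.
Proof.
move=> k0 a0 ab bc; have b0 : 0 <= b by apply: le_trans ab.
have ac : a <= c by apply: le_trans bc.
apply/eqP; rewrite -subr_eq0; apply/eqP/(@ws_tr_faithful R A).
rewrite starB starD !(mulrBl, mulrDl) !(mulrBr, mulrDr) !(trB, trD) !Delta_inner //.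
rewrite -!(rmorphB, rmorphD) /=.
have ovE : [/\ overlap a b a b = b - a, overlap a b b c = 0, overlap b c a b = 0,
   overlap b c b c = c - b & overlap a c a c = c - a] /\
  [/\ overlap a b a c = b - a, overlap a c a b = b - a, overlap b c a c = c - b &
   overlap a c b c = c - b].
  have [[e1 e2 e3 e4] [e5 e6 e7 e8 e9]] :
      [/\ clamp a b a = a, clamp a b b = b, clamp a b c = b & clamp b c a = b] /\
      [/\ clamp b c b = b, clamp b c c = c, clamp a c a = a, clamp a c b = b & clamp a c c = c].
    by split; split; first [exact: clamp_left|exact: clamp_right|exact: clamp_mid].
  by rewrite /overlap e1 e2 e3 e4 e5 e6 e7 e8 e9 !subrr.
by case: ovE => -[-> -> -> -> ->] [-> -> -> ->]; transitivity (0 : R)%:c => //; congr (_%:c); ring.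
Qed.

Lemma Delta_diff k a b : (0 < k)%N -> 0 <= a -> a <= b ->
  Delta k 0 b - Delta k 0 a = Delta k a b.
Proof. by move=> k0 a0 ab; rewrite -(@Delta_add k 0 a b) // addrC addKr. Qed.

Lemma sharp_bounded (u : tens A 2) : exists2 C, 0 <= C &
  forall d, n2 (sharp u d) <= C * n2 d.
Proof.
have [s ->] := tsum_ex u; elim: s => [|p s [C C0 hC]].
  exists 0 => // d; by rewrite sharp_tsum big_nil n2_0 mul0r.
have [C1 C10 b1] := l2bounded_ex p.1; have [C2 C20 b2] := l2bounded_ex p.2.
exists (C1 * C2 + C); first by rewrite addr_ge0 ?mulr_ge0.
move=> d; rewrite sharp_tsum big_cons -sharp_tsum mulrDl.
apply: le_trans (n2_add _ _) _; rewrite lerD //.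
exact: (n2_le3 d C10 C20 b1 b2).
Qed.

Section Grid.
Variables (t : nat -> R) (Q k : nat) (u : nat -> tens A 2).
Hypotheses (t0 : 0 <= t 0%N) (tm : forall q, t q <= t q.+1) (k0 : (0 < k)%N).

Let t_ge0 q : 0 <= t q.
Proof. by elim: q => [//|q /le_trans]; apply. Qed.

Lemma refine_pt N q i : (i < N.+1)%N ->
  (refine t N.+1 (q * N.+1 + i) = pt (t q) (t q.+1) N i) /\
  (refine t N.+1 (q * N.+1 + i).+1 = pt (t q) (t q.+1) N i.+1).
Proof. by move=> iN; rewrite refineES // refineE. Qed.

Lemma divn_cell N q i : (i < N.+1)%N -> ((q * N.+1 + i) %/ N.+1 = q)%N.
Proof. by move=> iN; rewrite divnMDl // divn_small // addn0. Qed.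

(** The pieces of a cell give the sums of powers that define the diagonal
    measure of the cell. *)
Lemma sum_powers_Delta :
  vanishing (fun N => n2 (\sum_(j < Q * N.+1)
      sharp (u (j %/ N.+1)%N) (X (refine t N.+1 j) (refine t N.+1 j.+1) ^+ k) -
    \sum_(q < Q) sharp (u q) (Delta k (t q) (t q.+1)))).
Proof.
have /choice[C hC] : forall q, exists C, 0 <= C /\ forall d, n2 (sharp (u q) d) <= C * n2 d.
  by move=> q; have [C C0 h] := sharp_bounded (u q); exists C.
apply: (@vanishing_le _ (fun N => \sum_(q < Q) C q *
   n2 (power_sum k (t q) (t q.+1) N - Delta k (t q) (t q.+1)))); last first.
  by apply: vanishing_sum => q; apply: vanishingM; apply: power_sum_Delta.
move=> N; rewrite ger0_norm ?n2_ge0 //.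
rewrite (sum_refine _ _ (fun j => sharp (u (j %/ N.+1)%N)
  (X (refine t N.+1 j) (refine t N.+1 j.+1) ^+ k))) -sumrB.
apply: le_trans (n2_sum _ _) _; apply: ler_sum => q _.
have -> : \sum_(i < N.+1) sharp (u ((q * N.+1 + i) %/ N.+1)%N)
   (X (refine t N.+1 (q * N.+1 + i)) (refine t N.+1 (q * N.+1 + i).+1) ^+ k) =
   sharp (u q) (power_sum k (t q) (t q.+1) N).
  rewrite sharp_sumr; apply: eq_bigr => i _.
  by have [-> ->] := refine_pt q (ltn_ord i); rewrite divn_cell.
by rewrite -sharpBr; have [_] := hC q; apply.
Qed.

(** Limit of the isometry for powers of increments along refinements of the
    grid. *)
Lemma isometry_Delta : (forall q, (q < Q)%N -> adapted_tens (At (t q)) (u q)) ->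
  n2 (\sum_(q < Q) sharp (u q) (Delta k (t q) (t q.+1))) <=
    Num.sqrt (\sum_(q < Q) (t q.+1 - t q) * `|r (k + k)%N| * tnorm2 (u q) ^+ 2) +
    `|r k| * n2 (\sum_(q < Q) (t q.+1 - t q)%:c *: tmul (u q)).
Proof.
move=> hu; rewrite -subr_le0.
set D := \sum_(q < Q) sharp _ _; set a2 := \sum_(q < Q) _ * _; set T := \sum_(q < Q) _ *: _.
have kk0 : (0 < k + k)%N by rewrite addn_gt0 k0.
have d0 q : 0 <= t q.+1 - t q by rewrite subr_ge0.
pose e2 N q := N.+1%:R * m (k + k) ((t q.+1 - t q) / N.+1%:R) - (t q.+1 - t q) * r (k + k)%N.
pose e1 N q := N.+1%:R * m k ((t q.+1 - t q) / N.+1%:R) - (t q.+1 - t q) * r k.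
pose E2 N := \sum_(q < Q) `|e2 N q| * tnorm2 (u q) ^+ 2.
pose E1 N := \sum_(q < Q) `|e1 N q| * n2 (tmul (u q)).
have vabs (v : nat -> R) : vanishing v -> vanishing (fun N => `|v N|).
  move=> hv; apply: eps_vanishing => e /(vanishing_eps hv)[N hN]; exists N => n /hN.
  by rewrite normr_id.
have E2v : vanishing E2.
  apply: vanishing_sum => q; apply: vanishing_ext (vanishingM (tnorm2 (u q) ^+ 2)
    (vabs _ (moment_sum kk0 (d0 q)))) => N.
  by rewrite mulrC.
have E1v : vanishing E1.
  apply: vanishing_sum => q; apply: vanishing_ext (vanishingM (n2 (tmul (u q)))
    (vabs _ (moment_sum k0 (d0 q)))) => N.
  by rewrite mulrC.
have E2_0 N : 0 <= E2 N by apply: sumr_ge0 => q _; rewrite mulr_ge0 ?sqr_ge0.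
pose S N := \sum_(j < Q * N.+1)
      sharp (u (j %/ N.+1)%N) (X (refine t N.+1 j) (refine t N.+1 j.+1) ^+ k).
apply: (@vanishing_le0 _ (fun N => n2 (S N - D) + (Num.sqrt (E2 N) + E1 N))); last first.
  apply: vanishingD; first exact: sum_powers_Delta.
  by apply: vanishingD => //; apply: vanishing_sqrt.
move=> N; rewrite lerBlDr.
have N0 : (0 < N.+1)%N by [].
have rt0 : 0 <= refine t N.+1 0 by rewrite -[0%N](mul0n N.+1) refineM.
have rm := refine_mono N0 tm.
have hu' j : (j < Q * N.+1)%N -> adapted_tens (At (refine t N.+1 j)) (u (j %/ N.+1)%N).
  move=> jQ; apply: (@adapted_tensW _ _ (At (t (j %/ N.+1)%N))); last first.
    by apply: hu; rewrite ltn_divLR.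
  apply: (At_mono hAt) => //.
  by rewrite /refine lerDl mulr_ge0 // divr_ge0.
have := isometry_X hAt hX k rt0 rm hu'.
rewrite -/(S N).
have n2D : n2 D <= n2 (S N - D) + n2 (S N).
  have e : D = - (S N - D) + S N by rewrite opprB subrK.
  by rewrite {1}e; apply: le_trans (n2_add _ _) _; rewrite n2N.
move=> iso; apply: le_trans n2D _; rewrite -!addrA lerD2l; apply: le_trans iso _.
rewrite (sum_refine _ _ (fun j => moment (mut (refine t N.+1 j.+1 - refine t N.+1 j)) (k + k)
  * tnorm2 (u (j %/ N.+1)%N) ^+ 2)).
rewrite (sum_refine _ _ (fun j => (moment (mut (refine t N.+1 j.+1 - refine t N.+1 j)) k)%:c
  *: tmul (u (j %/ N.+1)%N))).
have -> : \sum_(q < Q) \sum_(i < N.+1)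
   (moment (mut (refine t N.+1 (q * N.+1 + i).+1 - refine t N.+1 (q * N.+1 + i))) k)%:c
    *: tmul (u ((q * N.+1 + i) %/ N.+1)%N) =
   (r k)%:c *: T + \sum_(q < Q) (e1 N q)%:c *: tmul (u q).
  rewrite scaler_sumr -big_split /=; apply: eq_bigr => q _.
  under eq_bigr => i _ do rewrite refine_step // divn_cell //.
  rewrite sumr_const card_ord -scaler_nat scalerA scalerA -scalerDl; congr (_ *: _).
  rewrite -realcM -realcD /e1 -(rmorph_nat (real_complex R)) -realcM; congr (_%:c).
  by rewrite /m; ring.
have -> : \sum_(q < Q) \sum_(i < N.+1)
   moment (mut (refine t N.+1 (q * N.+1 + i).+1 - refine t N.+1 (q * N.+1 + i))) (k + k)
    * tnorm2 (u ((q * N.+1 + i) %/ N.+1)%N) ^+ 2 =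
   \sum_(q < Q) ((t q.+1 - t q) * r (k + k)%N + e2 N q) * tnorm2 (u q) ^+ 2.
  apply: eq_bigr => q _.
  under eq_bigr => i _ do rewrite refine_step // divn_cell //.
  by rewrite sumr_const card_ord -(mulr_natl (_ * _)) /e2 /m; ring.
have h1 : n2 ((r k)%:c *: T + \sum_(q < Q) (e1 N q)%:c *: tmul (u q)) <=
    `|r k| * n2 T + E1 N.
  apply: le_trans (n2_add _ _) _; rewrite n2Z cabs_real lerD2l.
  apply: le_trans (n2_sum _ _) _; apply: ler_sum => q _.
  by rewrite n2Z cabs_real.
have a20 : 0 <= a2.
  by apply: sumr_ge0 => q _; rewrite mulr_ge0 ?sqr_ge0 // mulr_ge0.
have h2 : Num.sqrt (\sum_(q < Q) ((t q.+1 - t q) * r (k + k)%N + e2 N q) * tnorm2 (u q) ^+ 2)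
    <= Num.sqrt a2 + Num.sqrt (E2 N).
  apply: (@le_trans _ _ (Num.sqrt (a2 + E2 N))).
    rewrite ler_wsqrtr // /a2 /E2 -big_split /=; apply: ler_sum => q _.
    rewrite -mulrDl ler_wpM2r ?sqr_ge0 // lerD ?ler_norm //.
    by rewrite ler_wpM2l // ler_norm.
  rewrite -ler_sqr ?nnegrE ?addr_ge0 ?sqrtr_ge0 // sqr_sqrtr ?addr_ge0 //.
  rewrite sqrrD !sqr_sqrtr // addrAC lerDl mulrn_wge0 // mulr_ge0 // sqrtr_ge0.
by apply: le_trans (lerD h2 h1) _; lra.
Qed.

End Grid.

End DiagonalMeasures.

(** * Grids and integrals of simple biprocesses *)

Section Grids.
Context {R : realType} {A : tracial_vN R} (At : R -> set A).
Hypothesis hAt : vN_filtration At.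

Local Notation elementary := (A * A * R * R)%type.
Implicit Types (e : elementary) (s : seq elementary) (t : nat -> R) (Q : nat).

Definition left_end e : R := e.1.2.
Definition right_end e : R := e.2.
Definition left_factor e : A := e.1.1.1.
Definition right_factor e : A := e.1.1.2.

(** No cell of the grid is cut by an end point of the interval of [e]. *)
Definition compatible t Q e := right_end e <= t Q /\
  forall q, (q < Q)%N -> [\/ left_end e <= t q /\ t q.+1 <= right_end e,
    t q.+1 <= left_end e | right_end e <= t q].

Definition grid t := t 0%N = 0 /\ forall q, t q <= t q.+1.

Lemma grid_mono t : grid t -> forall p q, (p <= q)%N -> t p <= t q.
Proof.
move=> [_ tm] p q /subnKC <-; elim: (q - p)%N => [|m]; rewrite ?addn0 // addnS.
by move=> /le_trans; apply.
Qed.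

Lemma grid_ge0 t : grid t -> forall q, 0 <= t q.
Proof. by move=> ht q; have [<- _] := ht; apply: grid_mono. Qed.

Lemma adapted_bounds e : elementary_adapted At e ->
  [/\ 0 <= left_end e, left_end e <= right_end e, At (left_end e) (left_factor e) &
    At (left_end e) (right_factor e)].
Proof. by case: e => [[[x y] a] b]. Qed.

(** The grid consists of the sorted end points; past the last one it is
    constant. *)
Lemma compatible_grid s : (forall e, e \in s -> elementary_adapted At e) ->
  exists t Q, grid t /\ forall e, e \in s -> compatible t Q e.
Proof.
move=> hs.
pose l0 := 0 :: [seq left_end e | e <- s] ++ [seq right_end e | e <- s].
pose l : seq R := sort <=%R l0.
have l_sorted : sorted <=%R l by apply: sort_le_sorted.
have l_ge0 x : x \in l -> 0 <= x.
  rewrite mem_sort inE mem_cat => /orP[/eqP -> //|/orP[]] /mapP[e /hs /adapted_bounds[h1 h2 _ _] ->] //.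
  exact: le_trans h2.
have sl : (0 < size l)%N by rewrite size_sort.
pose t q := nth 0 l (minn q (size l).-1).
have mn q : (minn q (size l).-1 < size l)%N.
  by rewrite -(prednK sl) ltnS geq_minr.
have t_mono p q : (p <= q)%N -> t p <= t q.
  move=> pq; apply: (sorted_leq_nth le_trans lexx 0 l_sorted); rewrite ?inE ?mn //.
  by rewrite leq_min geq_minr andbT (leq_trans (geq_minl _ _)).
have tE i : (i < size l)%N -> t i = nth 0 l i.
  by move=> il; rewrite /t (minn_idPl _) // -ltnS prednK.
have t0 : t 0%N = 0.
  have l0_in : 0 \in l by rewrite mem_sort mem_head.
  apply/le_anti/andP; split; last by apply: l_ge0; apply: mem_nth.
  have il : (seq.index 0%R l < size l)%N by rewrite index_mem.
  by rewrite -[leRHS](nth_index (0 : R) l0_in) -tE // t_mono.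
exists t, (size l); split; first by split=> // q; apply: t_mono.
move=> e es.
have inl x : x \in l -> exists2 i, (i < size l)%N & x = t i.
  by move=> xl; exists (seq.index x l); rewrite ?index_mem // tE ?index_mem // nth_index.
have [i il ai] : exists2 i, (i < size l)%N & left_end e = t i.
  by apply: inl; rewrite mem_sort inE mem_cat map_f ?orbT.
have [j jl bj] : exists2 j, (j < size l)%N & right_end e = t j.
  by apply: inl; rewrite mem_sort inE mem_cat orbC (map_f right_end es) orbT.
split; first by rewrite bj t_mono // ltnW.
move=> q _; rewrite ai bj; have [jq|qj] := leqP j q; first by constructor 3; apply: t_mono.
have [iq|qi] := leqP i q; last by constructor 2; apply: t_mono.
by constructor 1; split; apply: t_mono.
Qed.

Lemma compatible_refine t Q N e : (0 < N)%N -> grid t -> compatible t Q e ->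
  compatible (refine t N) (Q * N) e.
Proof.
move=> N0 ht [h1 h2]; split; first by rewrite refineM.
have [_ tm] := ht.
move=> j jQ; have [q [i [iN je]]] := refine_split j N0.
have qQ : (q < Q)%N.
  by rewrite -(ltn_pmul2r N0) (leq_ltn_trans _ jQ) // je leq_addr.
have lo : t q <= refine t N j.
  by rewrite je refineE // lerDl mulr_ge0 ?divr_ge0 // subr_ge0.
have hi : refine t N j.+1 <= t q.+1.
  rewrite je refineES // -lerBrDl ler_piMl ?subr_ge0 // ler_pdivrMr ?ltr0n // mul1r.
  by rewrite ler_nat.
case: (h2 q qQ) => [[ha hb]|ha|hb].
- by constructor 1; split; [apply: le_trans ha _|apply: le_trans hb].
- by constructor 2; apply: le_trans ha.
- by constructor 3; apply: le_trans lo.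
Qed.

Lemma refine_grid t N : (0 < N)%N -> grid t -> grid (refine t N).
Proof.
move=> N0 [t0 tm]; split; last exact: refine_mono.
by rewrite -[0%N](mul0n N) refineM.
Qed.

Lemma elementary_funE e (u : R) : elementary_fun e u =
  if left_end e <= u < right_end e then tensor2 (left_factor e) (right_factor e) else 0.
Proof. by case: e => [[[x y] a] b]. Qed.

Lemma elementary_fun_cell t Q e q (u : R) : compatible t Q e -> (q < Q)%N ->
  t q <= u < t q.+1 -> elementary_fun e u = elementary_fun e (t q).
Proof.
move=> [_ h] qQ /andP[tu ut]; rewrite !elementary_funE.
have tt : t q < t q.+1 by apply: le_lt_trans ut.
case: (h q qQ) => [[ha hb]|ha|hb].
- by rewrite ha (le_trans ha tu) (lt_le_trans ut hb) (lt_le_trans tt hb).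
- by rewrite !leNgt (lt_le_trans ut ha) (lt_le_trans tt ha).
- by rewrite !ltNge hb (le_trans hb tu) !andbF.
Qed.

Lemma elementary_fun_out t Q e (u : R) : compatible t Q e -> t Q <= u ->
  elementary_fun e u = 0.
Proof.
by move=> [h _] tu; rewrite elementary_funE ltNge (le_trans h tu) andbF.
Qed.

(** Written with [clamp], increments over cells inside and outside the interval
    have the same form, which telescopes. *)
Lemma elementary_increment t Q e q (D : R -> A) : grid t -> left_end e <= right_end e ->
  compatible t Q e -> (q < Q)%N ->
  sharp (elementary_fun e (t q)) (D (t q.+1) - D (t q)) =
  left_factor e * (D (clamp (left_end e) (right_end e) (t q.+1)) -
    D (clamp (left_end e) (right_end e) (t q))) * right_factor e.
Proof.
move=> [_ tm] ab [_ h] qQ; rewrite elementary_funE.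
have [tt|tt] := eqVneq (t q) (t q.+1).
  by rewrite -tt !subrr sharp0r mulr0 mul0r.
have {}tt : t q < t q.+1 by rewrite lt_neqAle tt tm.
have ttl := ltW tt.
case: (h q qQ) => [[ha hb]|ha|hb].
- rewrite ha (lt_le_trans tt hb) /= sharp_tensor2 /clamp.
  by rewrite !(max_r, min_r) // ?(le_trans ha) // (le_trans ttl).
- rewrite leNgt (lt_le_trans tt ha) /= sharp0 /clamp.
  by rewrite !(max_l, min_r) // ?subrr ?mulr0 ?mul0r // (le_trans ttl).
- rewrite ltNge hb andbF sharp0 /clamp.
  have cl u : right_end e <= u -> Num.min (right_end e) (Num.max (left_end e) u) = right_end e.
    by move=> hu; rewrite min_l // le_max hu orbT.
  by rewrite !cl ?subrr ?mulr0 ?mul0r // (le_trans hb).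
Qed.

Definition expr_integral (D : R -> A) s : A :=
  \sum_(e <- s) left_factor e * (D (right_end e) - D (left_end e)) * right_factor e.

Lemma grid_integral t Q s (D : R -> A) U : grid t -> simple_expr At U s ->
  (forall e, e \in s -> compatible t Q e) ->
  expr_integral D s = \sum_(q < Q) sharp (U (t q)) (D (t q.+1) - D (t q)).
Proof.
move=> ht [hs ->] hc.
under [RHS]eq_bigr do rewrite sharp_sum.
rewrite exchange_big /expr_integral /= big_seq [RHS]big_seq; apply: eq_bigr => e es.
have [a0 ab _ _] := adapted_bounds (hs e es).
under [RHS]eq_bigr => q _ do rewrite (elementary_increment D ht ab (hc e es) (ltn_ord q)).
rewrite -mulr_suml -mulr_sumr.
rewrite -(big_mkord xpredT (fun q => D (clamp (left_end e) (right_end e) (t q.+1)) -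
    D (clamp (left_end e) (right_end e) (t q)))) telescope_sumr //.
have [h1 _] := hc e es; have [t0 _] := ht.
congr (_ * (D _ - D _) * _); rewrite /clamp.
  by rewrite min_l // le_max h1 orbT.
by rewrite max_l ?t0 // min_r.
Qed.

(** A common grid of two expressions computes the integral from the biprocess
    alone. *)
Lemma simple_integralE D U s : simple_expr At U s ->
  simple_integral At D U = expr_integral D s.
Proof.
move=> hs; rewrite /simple_integral.
have := @xgetPex _ [::] (simple_expr At U) (ex_intro _ s hs).
set s0 := xget _ _ => hs0.
have -> : \sum_(e <- s0) (let: (x, y, a, b) := e in x * (D b - D a) * y) = expr_integral D s0.
  by apply: eq_bigr => -[[[x y] a] b] _.
have [t [Q [ht hc]]] : exists t Q, grid t /\ forall e, e \in s0 ++ s -> compatible t Q e.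
  apply: compatible_grid => e; rewrite mem_cat => /orP[].
    by case: hs0 => h _ /h.
  by case: hs => h _ /h.
rewrite (grid_integral D ht hs0 (Q := Q)); last by move=> e es; apply: hc; rewrite mem_cat es.
rewrite (grid_integral D ht hs (Q := Q)) // => e es.
by apply: hc; rewrite mem_cat es orbT.
Qed.

End Grids.

(** * Paths of simple integrals *)

Section Paths.
Context {R : realType} {A : tracial_vN R} (At : R -> set A) (r : nat -> R)
  (mut : R -> probability (measurableTypeR R) R) (X : R -> R -> A).
Hypotheses (hAt : vN_filtration At) (hmut : free_convolution_semigroup r mut)
  (hX : free_stochastic_measure At mut X).

Local Notation elementary := (A * A * R * R)%type.
Implicit Types (e : elementary) (s : seq elementary) (t : nat -> R) (Q : nat).

Lemma clamp_bounds (a b u : R) : a <= b -> a <= clamp a b u <= b.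
Proof. by move=> ab; rewrite /clamp le_min ab le_max lexx ge_min lexx. Qed.

Lemma clamp_mono (a b u v : R) : u <= v -> clamp a b u <= clamp a b v.
Proof. by move=> uv; have := overlap_ge0 a b uv; rewrite subr_ge0. Qed.

Lemma clamp_contract (a b u v : R) : a <= b -> u <= v ->
  clamp a b v - clamp a b u <= v - u.
Proof.
move=> ab uv; have [bu|/ltW ub] := leP b u.
  have bv := le_trans bu uv.
  by rewrite ![clamp a b _]clamp_right // subrr subr_ge0.
have [va|/ltW av] := leP v a.
  have ua := le_trans uv va.
  by rewrite ![clamp a b _]clamp_left // subrr subr_ge0.
apply: lerB; first by rewrite /clamp ge_min ge_max av lexx orbT.
by rewrite /clamp le_min ub le_max lexx orbT.
Qed.

(** The integral up to time [u]; clamping [u] avoids distinguishing the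
    intervals that contain it. *)
Definition path s u : A := \sum_(e <- s) left_factor e *
  (X 0 (clamp (left_end e) (right_end e) u) - X 0 (left_end e)) * right_factor e.

Lemma path_restrict V s u : simple_expr At V s -> 0 <= u ->
  simple_integral At (X 0) (restrict_biprocess 0 u V) = path s u.
Proof.
move=> [hs VE] u0.
pose cut e : elementary := (left_factor e, right_factor e, left_end e, Num.min (right_end e) u).
pose s' := [seq cut e | e <- s & left_end e < u].
rewrite (@simple_integralE _ _ _ _ _ s'); last first.
  split=> [e' /mapP[e]|].
    rewrite mem_filter => /andP[au /hs /adapted_bounds[a0 ab Ax Ay]] ->.
    by split => //; rewrite le_min ab ltW.
  apply/funext => v; rewrite /restrict_biprocess VE big_map big_filter.
  case: ifP => [/andP[v0 vu]|/negbT vu].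
    rewrite [RHS]big_mkcond; apply: eq_bigr => e _; rewrite !elementary_funE /= lt_min vu andbT.
    by case: (ltP (left_end e) u) => // ua; rewrite leNgt (lt_le_trans vu ua).
  rewrite big_seq_cond big1 // => e /andP[es au]; rewrite elementary_funE /= lt_min.
  case: ifP => // /and3P[av _ uv]; move: vu; rewrite uv andbT.
  by have [a0 _ _ _] := adapted_bounds (hs e es); rewrite (le_trans a0 av).
rewrite /expr_integral big_map big_filter big_mkcond /path big_seq [RHS]big_seq.
apply: eq_bigr => e es /=; have [a0 ab _ _] := adapted_bounds (hs e es).
rewrite /left_factor /right_factor /left_end /right_end /cut /= /clamp.
case: ifP => [au|/negbT]; first by rewrite [Num.max _ u]max_r // ltW.
by rewrite -leNgt => ua; rewrite max_l // min_r // subrr mulr0 mul0r.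
Qed.

Variable s : seq elementary.
Hypothesis hs : forall e, e \in s -> elementary_adapted At e.

Lemma path_adapted u : 0 <= u -> At u (path s u).
Proof.
move=> u0; have Au := At_sub hAt u0.
rewrite /path big_seq; apply: (big_ind (At u)) => [|x y|e es].
- exact: sub0.
- exact: subD.
have [a0 ab Ax Ay] := adapted_bounds (hs es).
have [au|ua] := leP (left_end e) u; last first.
  rewrite /clamp max_l ?ltW // min_r // subrr mulr0 mul0r; exact: sub0.
have /andP[ac cb] := clamp_bounds u ab.
rewrite (X_diff hX) //.
apply: (subM Au); last exact: (At_mono hAt a0 au).
apply: (subM Au); first exact: (At_mono hAt a0 au).
apply: (X_adapted hX) => //; rewrite /clamp max_r // ge_min lexx orbT //.
Qed.

Lemma path_increment t Q V q : grid t -> simple_expr At V s ->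
  (forall e, e \in s -> compatible t Q e) -> (q < Q)%N ->
  path s (t q.+1) = path s (t q) + sharp (V (t q)) (X (t q) (t q.+1)).
Proof.
move=> ht [_ ->] hc qQ; apply/eqP; rewrite addrC -subr_eq; apply/eqP.
rewrite /path -sumrB sharp_sum big_seq [RHS]big_seq; apply: eq_bigr => e es.
have [a0 ab _ _] := adapted_bounds (hs es).
have [_ tm] := ht.
rewrite -(X_diff hX (grid_ge0 ht q) (tm q)) (elementary_increment _ ht ab (hc e es) qQ).
rewrite -mulrBl -mulrBr; congr (_ * _ * _).
by rewrite opprB addrA subrK.
Qed.

Lemma path0 : path s 0 = 0.
Proof.
rewrite /path big_seq big1 // => e es; have [a0 ab _ _] := adapted_bounds (hs es).
by rewrite /clamp max_l // min_r // subrr mulr0 mul0r.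
Qed.

Lemma path_end t Q V : simple_expr At V s -> (forall e, e \in s -> compatible t Q e) ->
  path s (t Q) = simple_integral At (X 0) V.
Proof.
move=> hV hc; rewrite (simple_integralE _ hV) /path /expr_integral.
apply: eq_big_seq => e es; have [h _] := hc e es.
by rewrite /clamp min_l // le_max h orbT.
Qed.

Lemma path_bounded : exists2 C, 0 <= C & forall u, 0 <= u -> l2bounded C (path s u).
Proof.
rewrite /path; elim: s hs => [|e l IH] hl.
  by exists 0 => // u _; rewrite big_nil; apply: l2bounded0.
have [|C C0 hC] := IH; first by move=> e' e'l; apply: hl; rewrite in_cons e'l orbT.
have [a0 ab _ _] := adapted_bounds (hl e (mem_head _ _)).
have [K K0 hK] := X_bounded hAt hmut hX (le_trans a0 ab).
have [C1 C10 h1] := l2bounded_ex (left_factor e).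
have [C2 C20 h2] := l2bounded_ex (right_factor e).
exists (C1 * K * C2 + C); first by rewrite addr_ge0 // !mulr_ge0 // ltW.
move=> u u0; rewrite big_cons; apply: l2boundedD; last exact: hC.
have /andP[ac cb] := clamp_bounds u ab.
apply: l2boundedM => //; first by rewrite mulr_ge0 // ltW.
apply: l2boundedM => //; first exact: ltW.
by rewrite (X_diff hX) //; apply: hK.
Qed.

(** Increments of the process have L2 norm of the order of the square root of
    the length of the interval. *)
Lemma path_holder : exists2 C, 0 <= C & forall u v, 0 <= u -> 0 <= v ->
  n2 (path s u - path s v) <= C * Num.sqrt `|u - v|.
Proof.
suff [C C0 hC] : exists2 C, 0 <= C & forall u v, 0 <= u -> u <= v ->
    n2 (path s v - path s u) <= C * Num.sqrt (v - u).
  exists C => // u v u0 v0; have [uv|/ltW vu] := leP u v.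
    by rewrite -n2N opprB distrC ger0_norm ?subr_ge0 // hC.
  by rewrite ger0_norm ?subr_ge0 // hC.
rewrite /path; elim: s hs => [|e l IH] hl.
  by exists 0 => // u v _ _; rewrite !big_nil subrr n2_0 mul0r.
have [|C C0 hC] := IH; first by move=> e' e'l; apply: hl; rewrite in_cons e'l orbT.
have [a0 ab _ _] := adapted_bounds (hl e (mem_head _ _)).
have [K K0 hK] := n2_Xn_bound hmut hX (right_end e - left_end e) (ltn0Sn 0).
have [C1 C10 h1] := l2bounded_ex (left_factor e).
have [C2 C20 h2] := l2bounded_ex (right_factor e).
exists (C1 * C2 * K + C); first by rewrite addr_ge0 // !mulr_ge0.
move=> u v u0 uv; rewrite !big_cons opprD addrACA mulrDl.
apply: le_trans (n2_add _ _) _; apply: lerD; last exact: hC.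
rewrite -mulrBl -mulrBr opprB addrA subrK.
have /andP[ac cb] := clamp_bounds u ab; have /andP[ac' cb'] := clamp_bounds v ab.
have cc := clamp_mono (left_end e) (right_end e) uv.
rewrite (X_diff hX) //; last exact: le_trans ac.
apply: le_trans (n2_le3 _ C10 C20 h1 h2) _; rewrite -[leRHS]mulrA ler_wpM2l ?mulr_ge0 //.
rewrite -[X _ _]expr1.
apply: le_trans (hK _ _ (le_trans a0 ac) cc _) _.
  by rewrite lerB.
by rewrite ler_wpM2l // ler_wsqrtr // clamp_contract.
Qed.

End Paths.

Section Tame.
Context {R : realType} {A : tracial_vN R} (At : R -> set A).
Hypothesis hAt : vN_filtration At.
Variables (t : nat -> R) (Q : nat).

(** The properties shared by the factors that occur in the integrands, which
    are stable under products. *)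
Definition tame (f : R -> A) := (forall u, 0 <= u -> At u (f u)) /\
  exists C, [/\ 0 <= C, forall u, 0 <= u -> l2bounded C (f u) &
    forall q, (q < Q)%N -> forall u v, 0 <= t q -> t q <= u < t q.+1 -> t q <= v < t q.+1 ->
      n2 (f u - f v) <= C * Num.sqrt `|u - v|].

Lemma tame_const (x : A) : (forall u, 0 <= u -> At u x) -> tame (fun=> x).
Proof.
move=> Ax; split=> //; have [C C0 hC] := l2bounded_ex x; exists C; split=> //.
by move=> q _ u v _ _ _; rewrite subrr n2_0 mulr_ge0 // sqrtr_ge0.
Qed.

Lemma tame1 : tame (fun=> 1).
Proof. by apply: tame_const => u u0; apply: sub1; apply: At_sub. Qed.

Lemma tameM f g : tame f -> tame g -> tame (fun u => f u * g u).
Proof.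
move=> [Af [C [C0 bf hf]]] [Ag [D [D0 bg hg]]]; split.
  by move=> u u0; apply: (subM (At_sub hAt u0)); [apply: Af|apply: Ag].
exists (C * D + 2 * C * D); split; first by rewrite addr_ge0 ?mulr_ge0.
  move=> u u0; apply: (@l2boundedW _ _ (C * D)); first by rewrite lerDl !mulr_ge0.
  by apply: l2boundedM => //; [apply: bf|apply: bg].
move=> q qQ u v tq hu hv.
have u0 : 0 <= u by case/andP: hu => /(le_trans tq).
have v0 : 0 <= v by case/andP: hv => /(le_trans tq).
have -> : f u * g u - f v * g v = f u * (g u - g v) + (f u - f v) * g v.
  by rewrite mulrBr mulrBl addrA subrK.
have [h1 _] := bf u u0; have [_ h2] := bg v v0.
have := h1 (g u - g v); have := h2 (f u - f v).
have := ler_wpM2l C0 (hg q qQ u v tq hu hv); have := ler_wpM2l D0 (hf q qQ u v tq hu hv).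
have := n2_add (f u * (g u - g v)) ((f u - f v) * g v).
have : 0 <= C * D * Num.sqrt `|u - v| by rewrite !mulr_ge0 ?sqrtr_ge0.
by lra.
Qed.

Lemma tame_prod (I : Type) (l : seq I) (P : pred I) (f : I -> R -> A) :
  (forall i, P i -> tame (f i)) -> tame (fun u => \prod_(i <- l | P i) f i u).
Proof.
move=> h; elim: l => [|i l IH].
  by rewrite (_ : (fun u => _) = fun=> 1); [exact: tame1|apply/funext => u; rewrite big_nil].
case Pi : (P i).
  rewrite (_ : (fun u => _) = fun u => f i u * \prod_(j <- l | P j) f j u).
    by apply: tameM => //; apply: h.
  by apply/funext => u; rewrite big_cons Pi.
rewrite (_ : (fun u => _) = fun u => \prod_(j <- l | P j) f j u) //.
by apply/funext => u; rewrite big_cons Pi.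
Qed.

Lemma tame_tr f : tame f -> tame (fun u => ws_tr (f u) *: 1).
Proof.
move=> [Af [C [C0 bf hf]]]; split.
  move=> u u0; have Au := At_sub hAt u0; apply: (subZ Au); exact: (sub1 Au).
exists C; split=> //.
  move=> u u0; apply: (@l2boundedW _ _ (cabs (ws_tr (f u)) * 1)).
    rewrite mulr1; apply: le_trans (tr_n2 _) _; exact: n2_l2bounded (bf u u0).
  by apply: l2boundedZ; apply: l2bounded1.
move=> q qQ u v tq hu hv; rewrite -scalerBl -trB n2Z n2_1 mulr1.
by apply: le_trans (tr_n2 _) _; apply: hf hu hv.
Qed.

Lemma tame_ext f g : (forall u, f u = g u) -> tame f -> tame g.
Proof. by move=> /funext ->. Qed.

(** Membership is [List.In] since functions have no decidable equality. *)
Definition tame_tensor (W : R -> tens A 2) := exists s : seq ((R -> A) * (R -> A)),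
  (forall p, List.In p s -> tame p.1 /\ tame p.2) /\
  forall u, 0 <= u -> W u = \sum_(p <- s) tensor2 (p.1 u) (p.2 u).

Lemma tame_tensor_adapted W u : 0 <= u -> tame_tensor W -> adapted_tens (At u) (W u).
Proof.
move=> u0 [s [hs ->]] //; elim: s hs => [|p s IH] hs.
  by rewrite big_nil; exists [::] => //; rewrite /tsum big_nil.
rewrite big_cons; apply: adapted_tensD; last by apply: IH => p' h; apply: hs; right.
have [[A1 _] [A2 _]] := hs p (or_introl erefl).
by apply: adapted_tensor2; [apply: A1|apply: A2].
Qed.

Lemma tensor2B (x y x' y' : A) :
  tensor2 x y - tensor2 x' y' = tensor2 (x - x') y + tensor2 x' (y - y').
Proof.
have h1 : tensor2 (x - x') y = tensor2 x y - tensor2 x' y.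
  by rewrite addrC -scaleN1r tensor2Ll scaleN1r addrC.
have h2 : tensor2 x' (y - y') = tensor2 x' y - tensor2 x' y'.
  by rewrite addrC -scaleN1r tensor2Lr scaleN1r addrC.
by rewrite h1 h2 addrA subrK.
Qed.

Lemma tame_tensor_holder W : grid t -> tame_tensor W -> exists2 C, 0 <= C &
  forall q, (q < Q)%N -> forall u v, t q <= u < t q.+1 -> t q <= v < t q.+1 ->
    tnorm2 (W u - W v) <= C * Num.sqrt `|u - v| /\
    n2 (tmul (W u) - tmul (W v)) <= C * Num.sqrt `|u - v|.
Proof.
move=> ht [s [hs WE]].
suff [C C0 hC] : exists2 C, 0 <= C &
  forall q, (q < Q)%N -> forall u v, t q <= u < t q.+1 -> t q <= v < t q.+1 ->
    tnorm2 (\sum_(p <- s) tensor2 (p.1 u) (p.2 u) - \sum_(p <- s) tensor2 (p.1 v) (p.2 v))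
      <= C * Num.sqrt `|u - v| /\
    n2 (tmul (\sum_(p <- s) tensor2 (p.1 u) (p.2 u)) -
        tmul (\sum_(p <- s) tensor2 (p.1 v) (p.2 v))) <= C * Num.sqrt `|u - v|.
  exists C => // q qQ u v hu hv; have tq := grid_ge0 ht q.
  rewrite !WE; [exact: hC hu hv| |].
    by case/andP: hv => /(le_trans tq).
  by case/andP: hu => /(le_trans tq).
elim: s hs {W WE} => [|p s IH] hs.
  exists 0 => // q _ u v _ _; rewrite !big_nil !subrr.
  by rewrite tnorm2_0 n2_0 mul0r.
have [|C C0 hC] := IH; first by move=> p' h; apply: hs; right.
have [[A1 t1] [A2 t2]] := hs p (or_introl erefl).
have := tameM (conj A1 t1) (conj A2 t2) => -[_ [D [D0 _ hD]]].
have [C1 [C10 b1 h1]] := t1; have [C2 [C20 b2 h2]] := t2.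
exists (C + (D + 2 * C1 * C2)); first by rewrite !addr_ge0 // !mulr_ge0.
move=> q qQ u v hu hv; have tq := grid_ge0 ht q.
have u0 : 0 <= u by case/andP: hu => /(le_trans tq).
have v0 : 0 <= v by case/andP: hv => /(le_trans tq).
have sq0 : 0 <= Num.sqrt `|u - v| by rewrite sqrtr_ge0.
have [H1 H2] := hC q qQ u v hu hv.
have C12 : 0 <= C1 * C2 * Num.sqrt `|u - v| by rewrite !mulr_ge0.
have DD : 0 <= D * Num.sqrt `|u - v| by rewrite mulr_ge0.
split.
  rewrite !big_cons opprD addrACA tensor2B.
  set a := tensor2 (_ - _) _; set b := tensor2 _ (_ - _); set c := _ - _.
  have ha : tnorm2 a <= C1 * Num.sqrt `|u - v| * C2.
    rewrite tnorm2_tensor2 ler_pM ?n2_ge0 //; first exact: h1 hu hv.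
    exact: n2_l2bounded (b2 u u0).
  have hb : tnorm2 b <= C1 * (C2 * Num.sqrt `|u - v|).
    rewrite tnorm2_tensor2 ler_pM ?n2_ge0 //; last exact: h2 hu hv.
    exact: n2_l2bounded (b1 v v0).
  have := tnorm2_add (a + b) c; have := tnorm2_add a b; move: H1; rewrite -/c.
  by lra.
rewrite !big_cons !tmulD opprD addrACA !tmul_tensor2.
have hD' := hD q qQ u v tq hu hv.
by apply: le_trans (n2_add _ _) _; apply: le_trans (lerD hD' H2) _; lra.
Qed.

End Tame.

(** * The increment of a product *)

Lemma sorted_enum_val m (P : {pred 'I_m}) : sorted ltn [seq val l | l <- enum P].
Proof.
rewrite sorted_map /enum_mem -enumT; apply: sorted_filter.
  by move=> a b c /=; apply: ltn_trans.
by rewrite -sorted_map val_enum_ord iota_ltn_sorted.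
Qed.

Definition supp n (f : {ffun 'I_n -> bool}) : pred 'I_n := [pred l | f l].

Section Increasing.
Variables (n k : nat).
Implicit Types (i : {ffun 'I_k -> 'I_n}) (f : {ffun 'I_n -> bool}).

Definition range_indicator i : {ffun 'I_n -> bool} := [ffun l => l \in codom i].

Lemma increasing_lt i : increasing i -> forall p q : 'I_k, (p < q)%N -> (i p < i q)%N.
Proof. by move=> /forallP h p q pq; have /forallP/(_ q)/implyP := h p; apply. Qed.

Lemma increasing_sorted i : increasing i -> sorted ltn [seq val (i j) | j <- enum 'I_k].
Proof.
move=> hi; have : sorted ltn [seq val j | j <- enum 'I_k] by apply: sorted_enum_val.
rewrite !sorted_map; apply: sub_sorted => p q /=; exact: increasing_lt.
Qed.

(** Increasing maps correspond to their ranges. *)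
Lemma sum_increasing (V : nmodType) (G : {ffun 'I_n -> bool} -> V) :
  \sum_(f : {ffun 'I_n -> bool} | #|supp f| == k) G f =
  \sum_(i : {ffun 'I_k -> 'I_n} | increasing i) G (range_indicator i).
Proof.
have [n0|n0] := posnP n.
  have [k0|k0] := posnP k.
    have ff (f f' : {ffun 'I_n -> bool}) : f = f'.
      by apply/ffunP => -[l hl]; exfalso; rewrite n0 in hl.
    have ii (i i' : {ffun 'I_k -> 'I_n}) : i = i'.
      by apply/ffunP => -[l hl]; exfalso; rewrite k0 in hl.
    have i0 : {ffun 'I_k -> 'I_n} by apply: finfun => -[l hl]; exfalso; rewrite k0 in hl.
    rewrite (big_pred1 (range_indicator i0)) => [|f]; last first.
      rewrite (ff f (range_indicator i0)) /= eqxx; apply/eqP; rewrite k0.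
      by apply: eq_card0 => -[l hl]; exfalso; rewrite n0 in hl.
    rewrite (big_pred1 i0) // => i; rewrite (ii i i0) /= eqxx.
    by apply/forallP => -[l hl]; exfalso; rewrite k0 in hl.
  rewrite big_pred0 => [|f]; last first.
    apply/negP => /eqP fk; have := max_card (supp f); rewrite fk card_ord n0 leqn0.
    by rewrite gtn_eqF.
  rewrite big_pred0 // => i; exfalso.
  by case: (i (Ordinal k0)) => l; rewrite n0.
have x0 : 'I_n := Ordinal n0.
pose pos (f : {ffun 'I_n -> bool}) : {ffun 'I_k -> 'I_n} := [ffun j : 'I_k => nth x0 (enum (supp f)) j].
have mem_f (f : {ffun 'I_n -> bool}) l : (l \in enum (supp f)) = f l by rewrite mem_enum inE.
rewrite (reindex_onto range_indicator pos) => [|f /eqP fk]; last first.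
  apply/ffunP => l; rewrite ffunE -mem_f; apply/codomP/idP => [[j ->]|hl].
    by rewrite ffunE mem_nth // -cardE fk.
  have hi : (index l (enum (supp f)) < k)%N by rewrite -fk cardE index_mem.
  by exists (Ordinal hi); rewrite ffunE /= nth_index.
apply: eq_bigl => i; apply/idP/idP => [/andP[/eqP ck /eqP e]|hi].
  apply/forallP => p; apply/forallP => q; apply/implyP => pq.
  rewrite -e !ffunE.
  have hs := sorted_enum_val (supp (range_indicator i)).
  have sz : size (enum (supp (range_indicator i))) = k by rewrite -cardE.
  have := @sorted_ltn_nth _ _ ltn_trans 0%N _ hs p q.
  by rewrite !inE !size_map sz !(nth_map x0) ?sz //; apply.
have e : [seq val l | l <- enum (supp (range_indicator i))] = [seq val (i j) | j <- enum 'I_k].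
  apply: (irr_sorted_eq ltn_trans ltnn); [exact: sorted_enum_val|exact: increasing_sorted|].
  move=> a; apply/mapP/mapP => [[l]|[j _ ->]].
    by rewrite mem_f ffunE => /codomP[j ->] ->; exists j; rewrite ?mem_enum.
  by exists (i j) => //; rewrite mem_f ffunE codom_f.
have sz : size (enum (supp (range_indicator i))) = k.
  by rewrite -(size_map val) e size_map size_enum_ord.
apply/andP; split; first by rewrite cardE sz.
apply/eqP/ffunP => j; rewrite ffunE; apply: val_inj.
rewrite -(nth_map x0 0%N) ?sz // e (nth_map j) ?size_enum_ord //.
by rewrite nth_ord_enum.
Qed.

End Increasing.

Section ProductExpansion.
Context {R : realType} {A : tracial_vN R}.

Lemma prod_expand n (M d : 'I_n -> A) : \prod_(l < n) (M l + d l) =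
  \prod_(l < n) M l + \sum_(k < n) \sum_(i : {ffun 'I_k.+1 -> 'I_n} | increasing i)
    \prod_(l < n) (if l \in codom i then d l else M l).
Proof.
pose F (f : {ffun 'I_n -> bool}) := \prod_(l < n) (if f l then d l else M l).
transitivity (\sum_f F f).
  rewrite -(bigA_distr_bigA (fun l (b : bool) => if b then d l else M l)).
  by apply: eq_bigr => l _; rewrite big_bool addrC.
have hc (f : {ffun 'I_n -> bool}) : (#|supp f| < n.+1)%N by rewrite ltnS -[leqRHS]card_ord max_card.
rewrite (partition_big (fun f : {ffun 'I_n -> bool} => Ordinal (hc f)) predT) //=.
rewrite big_ord_recl /=; congr (_ + _).
  rewrite (big_pred1 [ffun=> false]) => [|f].
    by apply: eq_bigr => l _; rewrite ffunE.
  rewrite -(inj_eq val_inj) /=; apply/idP/eqP => [/eqP/card0_eq h|->].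
    by apply/ffunP => l; rewrite ffunE; have := h l.
  by apply/eqP; apply: eq_card0 => l; rewrite inE ffunE.
apply: eq_bigr => k _.
transitivity (\sum_(f : {ffun 'I_n -> bool} | #|supp f| == k.+1) F f).
  by apply: eq_bigl => f; rewrite -(inj_eq val_inj).
rewrite sum_increasing; apply: eq_bigr => i _; apply: eq_bigr => l _.
by rewrite ffunE.
Qed.

Variables (n : nat) (M d : nat -> A).

(** The product in which the factors with indices in [s] are the [d], written
    as a recursion on [s] so that the [d] can be expanded one by one. *)
Fixpoint interleave lo (s : seq nat) : A :=
  if s is a :: s' then (\prod_(lo <= l < a) M l) * (d a * interleave a.+1 s')
  else \prod_(lo <= l < n) M l.

Lemma interleaveE lo s : (lo <= n)%N -> sorted ltn s ->
  (forall a, a \in s -> (lo <= a < n)%N) ->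
  \prod_(lo <= l < n) (if l \in s then d l else M l) = interleave lo s.
Proof.
elim: s lo => [|a s IH] lo ln hs hb /=.
  by apply: eq_bigr => l _.
have /andP[la an] := hb a (mem_head _ _).
have sa : forall b, b \in s -> (a < b)%N.
  by apply/allP; apply: order_path_min hs; apply: ltn_trans.
rewrite (big_cat_nat la (ltnW an)) /= [X in _ * X]big_ltn // mem_head; congr (_ * (_ * _)).
  apply: eq_big_nat => l /andP[_ l_a]; rewrite inE ltn_eqF //=.
  by case: ifP => // /sa; rewrite ltnNge ltnW.
rewrite -IH //.
- apply: eq_big_nat => l /andP[al _]; rewrite inE gtn_eqF //.
- exact: path_sorted hs.
- by move=> b bs; rewrite sa //=; have /andP[] := hb b ltac:(by rewrite inE bs orbT).
Qed.

Variables (S : nat -> seq (A * A)) (x : A).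
Hypothesis dE : forall a, d a = \sum_(p <- S a) p.1 * x * p.2.

(** The factors between the successive [x], starting with a given left factor. *)
Fixpoint between lo y (s : seq nat) (q : seq (A * A)) : seq A :=
  match s, q with
  | a :: s', p :: q' => (y * (\prod_(lo <= l < a) M l) * p.1) :: between a.+1 p.2 s' q'
  | _, _ => [:: y * \prod_(lo <= l < n) M l]
  end.

Definition word_of (b : seq A) : A := if b is b0 :: b' then b0 * xtail x b' else 1.

Lemma between_cons lo y s q : between lo y s q <> [::].
Proof. by case: s q => [|a s] [|p q]. Qed.

Lemma interleave_words lo y s :
  y * interleave lo s = \sum_(q <- choices [seq S a | a <- s]) word_of (between lo y s q).
Proof.
elim: s lo y => [|a s IH] lo y /=.
  by rewrite big_seq1 /= /xtail big_nil mulr1.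
rewrite big_allpairs_dep dE mulrA mulrA mulr_sumr mulr_suml; apply: eq_bigr => p _.
have -> : y * \prod_(lo <= l < a) M l * (p.1 * x * p.2) * interleave a.+1 s =
  y * (\prod_(lo <= l < a) M l) * p.1 * x * (p.2 * interleave a.+1 s) by rewrite !mulrA.
rewrite IH mulr_sumr; apply: eq_bigr => q _ /=.
have := @between_cons a.+1 p.2 s q; case: (between _ _ _ _) => [//|b b'] _ /=.
by rewrite /xtail big_cons !mulrA.
Qed.

Lemma size_between lo y s q : size q = size s -> size (between lo y s q) = (size s).+1.
Proof. by elim: s lo y q => [|a s IH] lo y [|p q] //= [hq]; rewrite IH. Qed.

Lemma nth_between lo y s q j : size q = size s -> (j <= size s)%N ->
  nth 0 (between lo y s q) j = (nth (1, 1) ((1, y) :: q) j).2 *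
    (\prod_(nth 0%N (lo :: map succn s) j <= l < nth n s j) M l) * (nth (1, 1) q j).1.
Proof.
elim: s lo y q j => [|a s IH] lo y [|p q] [|j] //= => [_ _|[hq] hj].
  by rewrite mulr1.
rewrite IH //; case: j hj => [//|j] hj; congr (_.2 * _ * _).
Qed.

End ProductExpansion.

Section ProductIncrement.
Context {R : realType} {A : tracial_vN R}.

(** The product is multiplied out; the words found between the occurrences of
    [x] are the slots of the tensors [gaps] acted upon by the factors of the
    [U l]. *)
Lemma product_increment n (M : 'I_n -> A) (U : 'I_n -> tens A 2) (S : 'I_n -> seq (A * A)) x :
  (forall l, U l = tsum (S l)) ->
  \prod_(l < n) (M l + sharp (U l) x) = \prod_(l < n) M l +
    \sum_(k < n) \sum_(i : {ffun 'I_k.+1 -> 'I_n} | increasing i)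
      \sum_(q <- choices [seq S (i j) | j <- enum 'I_k.+1])
        let b := slots (gaps M i) q in
        b ord0 * xtail x [seq b (lift ord0 j) | j <- enum 'I_k.+1].
Proof.
move=> hU; rewrite prod_expand; congr (_ + _); apply: eq_bigr => k _; apply: eq_bigr => i hi.
pose ext (T : Type) (def : T) (f : 'I_n -> T) (l : nat) : T :=
  if insub l is Some l' then f l' else def.
have extE T (def : T) f (l : 'I_n) : ext T def f l = f l by rewrite /ext valK.
pose Mn := ext _ 1 M; pose Sn := ext _ [::] S.
pose dn a := \sum_(p <- Sn a) p.1 * x * p.2.
pose s := [seq val (i j) | j <- enum 'I_k.+1].
have smem (l : 'I_n) : (l \in codom i) = (val l \in s).
  apply/codomP/mapP => [[j ->]|[j _ /val_inj ->]]; last by exists j.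
  by exists j; rewrite ?mem_enum.
have s_lt a : a \in s -> (a < n)%N by move=> /mapP[j _ ->]; apply: ltn_ord.
have ssize : size s = k.+1 by rewrite size_map size_enum_ord.
have -> : \prod_(l < n) (if l \in codom i then sharp (U l) x else M l) =
    \prod_(0 <= l < n) (if l \in s then dn l else Mn l).
  rewrite big_mkord; apply: eq_bigr => l _; rewrite smem /Mn extE; case: ifP => // _.
  by rewrite /dn /Sn extE hU sharp_tsum.
rewrite (@interleaveE _ _ n Mn dn) //; last exact: increasing_sorted.
rewrite -[LHS]mul1r (@interleave_words _ _ n Mn dn Sn x) //.
have -> : [seq Sn a | a <- s] = [seq S (i j) | j <- enum 'I_k.+1].
  by rewrite -map_comp; apply: eq_map => j /=; rewrite /Sn extE.
rewrite big_seq [RHS]big_seq; apply: eq_bigr => q hq /=.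
have qsize : size q = k.+1.
  have size_choices (T : eqType) (tt : seq (seq T)) p : p \in choices tt -> size p = size tt.
    elim: tt p => [|t tt IHt] p /=; first by rewrite inE => /eqP ->.
    by case/allpairsP => -[z w] [/= _ /IHt hw ->] /=; rewrite hw.
  by rewrite (size_choices _ _ _ hq) size_map size_enum_ord.
set b := slots (gaps M i) q.
suff -> : between n Mn 0 1 s q = [seq b j | j <- enum 'I_k.+2].
  by rewrite enum_ordSl /= -map_comp.
apply: (@eq_from_nth _ 0); first by rewrite size_between ?qsize ?ssize // size_map size_enum_ord.
move=> j; rewrite size_between ?qsize ?ssize // => jk.
rewrite nth_between ?qsize ?ssize // (nth_map (Ordinal jk)) ?size_enum_ord //.
have -> : nth (Ordinal jk) (enum 'I_k.+2) j = Ordinal jk.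
  by apply: val_inj; rewrite /= nth_enum_ord.
rewrite !ffunE /=; congr (_ * _ * _).
have nle : (nth n s j <= n)%N.
  have [js|js] := ltnP j (size s); last by rewrite nth_default.
  by apply/ltnW/s_lt/mem_nth.
rewrite -/s (big_nat_widen _ _ n) // (big_nat_widenl _ 0) // big_mkord.
by apply: eq_big => [l|l _]; rewrite ?/Mn ?extE // andbC.
Qed.

End ProductIncrement.

(** * The product formula for powers of increments *)

(** Collects error bounds whose constants depend on the summation index. *)
Lemma uniform_sum {R : realType} (I : eqType) (l : seq I) (P : pred I) (T : Type)
    (ok : T -> Prop) (F : I -> T -> R) (g : T -> R) :
  (forall i, i \in l -> exists2 C, 0 <= C & forall x, ok x -> F i x <= C * g x) ->
  exists2 C, 0 <= C & forall x, ok x -> \sum_(i <- l | P i) F i x <= C * g x.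
Proof.
elim: l => [|i l IH] h.
  by exists 0 => // x _; rewrite big_nil mul0r.
have [C C0 hC] := IH (fun j jl => h j ltac:(by rewrite inE jl orbT)).
case Pi : (P i); last by exists C => // x /hC; rewrite big_cons Pi.
have [D D0 hD] := h i (mem_head _ _); exists (D + C); first by rewrite addr_ge0.
by move=> x okx; rewrite big_cons Pi mulrDl lerD // ?hD // hC.
Qed.

Section Integrands.
Context {R : realType} {A : tracial_vN R} (At : R -> set A) (r : nat -> R)
  (mut : R -> probability (measurableTypeR R) R) (X : R -> R -> A)
  (Delta : nat -> R -> R -> A).
Hypotheses (hAt : vN_filtration At) (hmut : free_convolution_semigroup r mut)
  (hX : free_stochastic_measure At mut X)
  (hDelta : forall k, (0 < k)%N -> diagonal_measure X k (Delta k)).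

Local Notation elementary := (A * A * R * R)%type.
Variables (n : nat) (s : 'I_n -> seq elementary) (V : 'I_n -> R -> tens A 2).
Hypothesis hV : forall i, simple_expr At (V i) (s i).

Let Mt (i : 'I_n) (u : R) : A := simple_integral At (X 0) (restrict_biprocess 0 u (V i)).
Local Notation W k := (product_integrand k Mt V).

Lemma Mt_path i u : 0 <= u -> Mt i u = path X (s i) u.
Proof. exact: path_restrict. Qed.

(** Outside of its interval, an elementary biprocess contributes a pair of
    zeros, so that the words are indexed independently of time. *)
Definition factors (u : R) (e : elementary) : A * A :=
  if left_end e <= u < right_end e then (left_factor e, right_factor e) else (0, 0).

Lemma V_factors i u : V i u = tsum [seq factors u e | e <- s i].
Proof.
have [_ ->] := hV i; rewrite /tsum big_map; apply: eq_bigr => e _.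
by rewrite elementary_funE /factors; case: ifP => // _; rewrite tensor20l.
Qed.

(** The factors of the words of the expansion, as functions of time. *)
Definition slot_path k (i : {ffun 'I_k -> 'I_n}) (th : seq elementary) (j : 'I_k.+1) (u : R) : A :=
  slots (gaps (fun l => path X (s l) u) i) [seq factors u e | e <- th] j.

Definition index_words k (i : {ffun 'I_k -> 'I_n}) := choices [seq s (i j) | j <- enum 'I_k].

Lemma integrandE k u : 0 <= u -> W k u =
  \sum_(i : {ffun 'I_k.+1 -> 'I_n} | increasing i) \sum_(th <- index_words i)
    (\prod_(j < k.+2 | (0 < j < k.+1)%N) ws_tr (slot_path i th j u)) *:
      tensor2 (slot_path i th ord0 u) (slot_path i th ord_max u).
Proof.
move=> u0; rewrite (@product_integrandE _ _ _ _ _ _ _ _ (fun i => V_factors i u)).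
apply: eq_bigr => i _.
have -> : [seq [seq factors u e | e <- s (i j)] | j <- enum 'I_k.+1] =
    [seq [seq factors u e | e <- l] | l <- [seq s (i j) | j <- enum 'I_k.+1]].
  by rewrite -map_comp.
rewrite choices_map big_map; apply: eq_bigr => th _ /=.
rewrite /slot_path.
have -> : (fun l => Mt l u) = (fun l => path X (s l) u) by apply/funext => l; apply: Mt_path.
by [].
Qed.

Variables (t : nat -> R) (Q : nat).
Hypotheses (ht : grid t) (hc : forall i e, e \in s i -> compatible t Q e).

Lemma integrand_out k u : t Q <= u -> W k u = 0.
Proof.
move=> tu; rewrite (@product_integrandE _ _ _ _ _ _ _ (fun=> [::])) => [|i].
  rewrite big1 // => i _.
  by rewrite enum_ordSl /= big_nil.
rewrite /tsum big_nil; have [_ ->] := hV i.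
by rewrite big_seq big1 // => e es; rewrite (elementary_fun_out (hc es) tu).
Qed.

Local Notation tame := (tame At t Q).

Lemma tame_factor1 i e : e \in s i -> tame (fun u => (factors u e).1).
Proof.
move=> es; have [hs _] := hV i.
have [a0 ab Ax Ay] := adapted_bounds (hs e es).
rewrite /factors; split=> [u u0|].
  case: ifP => [/andP[au _]|_] /=; last exact: (sub0 (At_sub hAt u0)).
  exact: (At_mono hAt a0 au).
have [C C0 hC] := l2bounded_ex (left_factor e); exists C; split => //.
  move=> u _; case: ifP => _ //=; apply: l2boundedW l2bounded0 => //.
move=> q qQ u v tq hu hv.
have [_ h] := hc es.
suff -> : (left_end e <= u < right_end e) = (left_end e <= v < right_end e).
  by rewrite subrr n2_0 mulr_ge0 ?sqrtr_ge0.
move/andP: hu => [u1 u2]; move/andP: hv => [v1 v2].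
case: (h q qQ) => [[ha hb]|ha|hb].
- by rewrite (le_trans ha u1) (le_trans ha v1) (lt_le_trans u2 hb) (lt_le_trans v2 hb).
- by rewrite !leNgt (lt_le_trans u2 ha) (lt_le_trans v2 ha).
- by rewrite !ltNge (le_trans hb u1) (le_trans hb v1) !andbF.
Qed.

Lemma tame_factor2 i e : e \in s i -> tame (fun u => (factors u e).2).
Proof.
move=> es; have [hs _] := hV i.
have [a0 ab Ax Ay] := adapted_bounds (hs e es).
rewrite /factors; split=> [u u0|].
  case: ifP => [/andP[au _]|_] /=; last exact: (sub0 (At_sub hAt u0)).
  exact: (At_mono hAt a0 au).
have [C C0 hC] := l2bounded_ex (right_factor e); exists C; split => //.
  move=> u _; case: ifP => _ //=; apply: l2boundedW l2bounded0 => //.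
move=> q qQ u v tq hu hv.
have [_ h] := hc es.
suff -> : (left_end e <= u < right_end e) = (left_end e <= v < right_end e).
  by rewrite subrr n2_0 mulr_ge0 ?sqrtr_ge0.
move/andP: hu => [u1 u2]; move/andP: hv => [v1 v2].
case: (h q qQ) => [[ha hb]|ha|hb].
- by rewrite (le_trans ha u1) (le_trans ha v1) (lt_le_trans u2 hb) (lt_le_trans v2 hb).
- by rewrite !leNgt (lt_le_trans u2 ha) (lt_le_trans v2 ha).
- by rewrite !ltNge (le_trans hb u1) (le_trans hb v1) !andbF.
Qed.

Lemma tame_path i : tame (path X (s i)).
Proof.
have [hs _] := hV i; split=> [u u0|]; first exact: (path_adapted hAt hX hs).
have [C C0 hC] := path_bounded hAt hmut hX hs.
have [D D0 hD] := path_holder hmut hX hs.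
exists (C + D); split; first by rewrite addr_ge0.
  by move=> u u0; apply: l2boundedW (hC u u0); rewrite lerDl.
move=> q _ u v tq /andP[u1 _] /andP[v1 _].
apply: le_trans (hD u v (le_trans tq u1) (le_trans tq v1)) _.
by rewrite ler_wpM2r ?sqrtr_ge0 // lerDr.
Qed.

Lemma index_words_mem k (i : {ffun 'I_k -> 'I_n}) th : th \in index_words i ->
  size th = k /\ forall e, e \in th -> exists l, e \in s l.
Proof.
rewrite /index_words.
have h (js : seq 'I_k) w : w \in choices [seq s (i j) | j <- js] ->
    size w = size js /\ forall e, e \in w -> exists l, e \in s l.
  elim: js w => [|j js IH] w /=; first by rewrite inE => /eqP ->.
  case/allpairsP => -[e w'] [/= es /IH[<- hw'] ->]; split=> // e'.
  by rewrite inE => /orP[/eqP ->|/hw' //]; exists (i j).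
by move=> /h; rewrite size_enum_ord.
Qed.

Lemma tame_slot k (i : {ffun 'I_k -> 'I_n}) th j : th \in index_words i ->
  tame (slot_path i th j).
Proof.
move=> /index_words_mem[_ hth].
have nth_factors (l : seq elementary) m u : nth (1, 1) [seq factors u e | e <- l] m =
    if (m < size l)%N then factors u (nth (1, 1, 0, 0) l m) else (1, 1).
  case: ltnP => hm; first by rewrite (nth_map (1, 1, 0, 0)).
  by rewrite nth_default // size_map.
apply: (@tame_ext _ _ _ _ _ (fun u =>
  (nth (1, 1) ((1, 1) :: [seq factors u e | e <- th]) j).2 *
  gaps (fun l => path X (s l) u) i j * (nth (1, 1) [seq factors u e | e <- th] j).1)).
  by move=> u; rewrite /slot_path [RHS]ffunE.
apply: tameM => //; first apply: tameM => //.
- case: j => -[|j] hj /=; first exact: tame1.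
  apply: (@tame_ext _ _ _ _ _ (fun u =>
    (if (j < size th)%N then factors u (nth (1, 1, 0, 0) th j) else (1, 1)).2)).
    by move=> u; rewrite nth_factors.
  case: ltnP => jth; last exact: tame1.
  by have [l hl] := hth _ (mem_nth (1, 1, 0, 0) jth); apply: tame_factor2 hl.
- apply: (@tame_ext _ _ _ _ _ (fun u => \prod_(l < n |
      (nth 0 (0 :: map succn [seq val (i j') | j' <- enum 'I_k]) j <= l <
       nth n [seq val (i j') | j' <- enum 'I_k] j)%N) path X (s l) u)).
    by move=> u; rewrite ffunE.
  by apply: tame_prod => // l _; apply: tame_path.
- apply: (@tame_ext _ _ _ _ _ (fun u =>
    (if (j < size th)%N then factors u (nth (1, 1, 0, 0) th j) else (1, 1)).1)).
    by move=> u; rewrite nth_factors.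
  case: ltnP => jth; last exact: tame1.
  by have [l hl] := hth _ (mem_nth (1, 1, 0, 0) jth); apply: tame_factor1 hl.
Qed.

Lemma tame_tensorD (U U' : R -> tens A 2) : tame_tensor At t Q U -> tame_tensor At t Q U' ->
  tame_tensor At t Q (fun u => U u + U' u).
Proof.
move=> [l [hl UE]] [l' [hl' UE']]; exists (l ++ l'); split.
  by move=> p /(List.in_app_or _ _ _) [/hl|/hl'].
by move=> u u0; rewrite big_cat UE // UE'.
Qed.

Lemma tame_tensor_sum (I : eqType) (l : seq I) (P : pred I) (f : I -> R -> tens A 2) :
  (forall i, i \in l -> tame_tensor At t Q (f i)) ->
  tame_tensor At t Q (fun u => \sum_(i <- l | P i) f i u).
Proof.
elim: l => [|i l IH] h.
  by exists [::]; split=> // u _; rewrite !big_nil.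
have IH' : tame_tensor At t Q (fun u => \sum_(i <- l | P i) f i u).
  by apply: IH => j jl; apply: h; rewrite inE jl orbT.
case Pi : (P i).
  rewrite (_ : (fun u => _) = fun u => f i u + \sum_(j <- l | P j) f j u).
    by apply: tame_tensorD => //; apply: h; rewrite mem_head.
  by apply/funext => u; rewrite big_cons Pi.
rewrite (_ : (fun u => _) = fun u => \sum_(j <- l | P j) f j u) //.
by apply/funext => u; rewrite big_cons Pi.
Qed.

Lemma tame_integrand k : tame_tensor At t Q (W k).
Proof.
have [l [hl E]] : tame_tensor At t Q (fun u =>
  \sum_(i : {ffun 'I_k.+1 -> 'I_n} | increasing i) \sum_(th <- index_words i)
    (\prod_(j < k.+2 | (0 < j < k.+1)%N) ws_tr (slot_path i th j u)) *:
      tensor2 (slot_path i th ord0 u) (slot_path i th ord_max u)).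
  apply: tame_tensor_sum => i _; apply: tame_tensor_sum => th hth.
  exists [:: (fun u => (\prod_(j < k.+2 | (0 < j < k.+1)%N) (ws_tr (slot_path i th j u))%:A)
      * slot_path i th ord0 u, slot_path i th ord_max)]; split.
    move=> p [<- /=|//]; split; last exact: tame_slot.
    apply: tameM => //; last exact: tame_slot.
    by apply: tame_prod => // j _; apply: tame_tr => //; apply: tame_slot.
  move=> u u0; rewrite big_seq1 /=.
  rewrite -(rmorph_prod (in_alg A)) /= -scalerAl mul1r tensor2Zl.
  by [].
by exists l; split=> // u u0; rewrite integrandE // E.
Qed.

(** ** The discrete Ito formula *)

(** A grid that follows the jumps of the biprocesses, with a bound of the
    lengths of its cells. The components are packed into one variable so that
    constants are uniform in all of them. *)
Definition fine_grid (g : (nat -> R) * nat * R) := let: (tau, P, h) := g in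
  [/\ grid tau, forall i e, e \in s i -> compatible tau P e, tau P <= t Q,
    forall q, (q < P)%N -> tau q.+1 - tau q <= h & 0 <= h <= 1].

Definition rate (g : (nat -> R) * nat * R) : R :=
  Num.sqrt (g.2 * t Q) + Num.sqrt g.2 * t Q.

Definition word_expansion k (i : {ffun 'I_k.+1 -> 'I_n}) th u (x : A) : A :=
  slot_path i th ord0 u * xtail x [seq slot_path i th (lift ord0 j) u | j <- enum 'I_k.+1].

Definition word_condensed k (i : {ffun 'I_k.+1 -> 'I_n}) th u (x : A) : A :=
  sharp ((\prod_(j < k.+2 | (0 < j < k.+1)%N) ws_tr (slot_path i th j u)) *:
    tensor2 (slot_path i th ord0 u) (slot_path i th ord_max u)) (x ^+ k.+1).

Lemma word_condensedE k (i : {ffun 'I_k.+1 -> 'I_n}) th u x :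
  let b j := slot_path i th (lift ord0 j) u in
  word_condensed i th u x = slot_path i th ord0 u *
    condense x 1 (b ord0) [seq b (lift ord0 j) | j <- enum 'I_k].
Proof.
move=> b; rewrite condenseE size_map size_enum_ord /word_condensed sharpZ sharp_tensor2.
have bE : b ord0 :: [seq b (lift ord0 j) | j <- enum 'I_k] = [seq b j | j <- enum 'I_k.+1].
  by rewrite enum_ordSl /= -map_comp.
have : rcons (belast (b ord0) [seq b (lift ord0 j) | j <- enum 'I_k])
    (last (b ord0) [seq b (lift ord0 j) | j <- enum 'I_k]) =
    rcons [seq b (widen_ord (leqnSn k) j) | j <- enum 'I_k] (b ord_max).
  by rewrite -lastI bE enum_ordSr map_rcons -map_comp.
move=> /rcons_inj[-> ->].
rewrite -scalerAr mulrA add1n; congr (_ *: (_ * slot_path i th _ u)); last first.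
  exact: val_inj.
rewrite big_map big_enum /= big_mkcond big_ord_recl /= mul1r big_ord_recr /=.
rewrite ltnn mulr1; apply: eq_bigr => j _.
by rewrite /bump /= !add1n ltnS ltn_ord /b; congr (ws_tr (slot_path i th _ u)); apply: val_inj.
Qed.

(** Constants for condensing a word are uniform over the cells, and the errors
    are summed with [negligible_sum]. *)
Lemma word_error k (i : {ffun 'I_k.+1 -> 'I_n}) th : th \in index_words i ->
  exists2 C, 0 <= C & forall g, fine_grid g -> n2 (\sum_(q < g.1.2)
    (word_expansion i th (g.1.1 q) (X (g.1.1 q) (g.1.1 q.+1)) -
     word_condensed i th (g.1.1 q) (X (g.1.1 q) (g.1.1 q.+1)))) <= C * rate g.
Proof.
move=> hth.
have T0 : 0 <= t Q by apply: grid_ge0.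
have [kappa k1 hcell] := X_free_cell hAt hmut hX k.+1 T0.
have /choice[c hc'] : forall j, exists C, 0 <= C /\
    forall u, 0 <= u -> l2bounded C (slot_path i th j u).
  by move=> j; have [_ [C [C0 hC _]]] := tame_slot j hth; exists C.
pose c0 := 1 + \sum_j 2 * c j.
have cj j : c j <= c0 / 2.
  rewrite ler_pdivlMr // mulrC /c0 (bigD1 j) //= addrCA lerDl addr_ge0 //.
  by apply: sumr_ge0 => j' _; rewrite mulr_ge0 //; case: (hc' j').
have c01 : 1 <= c0.
  by rewrite lerDl sumr_ge0 // => j _; rewrite mulr_ge0 //; case: (hc' j).
have [C C0 hC] := @condense_negligible R A kappa c0 k.+1 k1 c01 k.
exists C => // -[[tau P] h] [htau hcomp hP hh /andP[h0 h1]] /=.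
have [tau0 taum] := htau.
have tge0 q := grid_ge0 htau q.
apply: (@negligible_sum _ _ At hAt tau P
  (fun q => word_expansion i th (tau q) (X (tau q) (tau q.+1)) -
    word_condensed i th (tau q) (X (tau q) (tau q.+1))) C h (t Q)) => //.
- by rewrite tau0 subr0.
move=> q qP.
rewrite word_condensedE /word_expansion enum_ordSl /= -map_comp.
set b0 := slot_path i th ord0 _; set b1 := slot_path i th _ _; set l := map _ _.
have -> : xtail (X (tau q) (tau q.+1)) (b1 :: l) =
    X (tau q) (tau q.+1) ^+ 1 * b1 * xtail (X (tau q) (tau q.+1)) l.
  by rewrite /xtail big_cons expr1.
have slot_ok j : At (tau q) (slot_path i th j (tau q)) /\
    l2bounded (c0 / 2) (slot_path i th j (tau q)).
  have [Aj _] := tame_slot j hth; split; first exact: Aj.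
  by apply: l2boundedW (cj j) _; have [_] := hc' j; apply.
apply: (hC (At (tau q)) (GX X (tau q) (tau q.+1))) => //.
- apply: hcell => //; last by apply: le_trans (hh q qP) h1.
  by apply: le_trans hP; apply: (grid_mono htau).
- by rewrite size_map size_enum_ord.
- by have [] := slot_ok ord0.
- have [_] := slot_ok ord0; apply: l2boundedW.
  by rewrite ler_pdivrMr // ler_peMr ?ler1n // (le_trans _ c01).
- move=> y; rewrite inE => /orP[/eqP ->|/mapP[j _ ->]]; exact: slot_ok.
Qed.

(** The contraction in the integrand is what replaces the inner factors of a
    word with their traces. *)
Lemma integrand_condensed k u x : 0 <= u -> sharp (W k u) (x ^+ k.+1) =
  \sum_(i : {ffun 'I_k.+1 -> 'I_n} | increasing i) \sum_(th <- index_words i)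
    word_condensed i th u x.
Proof.
move=> u0; rewrite integrandE // sharp_sum; apply: eq_bigr => i _.
by rewrite sharp_sum.
Qed.

Let M i := simple_integral At (X 0) (V i).

(** The increments of the product over the cells are multiplied out, and every
    word is replaced with its condensed form; [k] factors [x] condense to the
    [k]-th power of the increment. *)
Lemma ito_error : (0 < n)%N -> exists2 C, 0 <= C & forall g, fine_grid g ->
  n2 (\prod_(i < n) M i - \sum_(k < n) \sum_(q < g.1.2)
    sharp (W k (g.1.1 q)) (X (g.1.1 q) (g.1.1 q.+1) ^+ k.+1)) <= C * rate g.
Proof.
move=> n0.
have [C C0 hC] : exists2 C, 0 <= C & forall g, fine_grid g ->
  \sum_(k <- enum 'I_n) \sum_(i <- enum {ffun 'I_k.+1 -> 'I_n} | increasing i)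
    \sum_(th <- index_words i) n2 (\sum_(q < g.1.2)
    (word_expansion i th (g.1.1 q) (X (g.1.1 q) (g.1.1 q.+1)) -
     word_condensed i th (g.1.1 q) (X (g.1.1 q) (g.1.1 q.+1)))) <= C * rate g.
  apply: uniform_sum => k _; apply: uniform_sum => i _; apply: uniform_sum => th.
  exact: word_error.
exists C => // g hg; apply: le_trans (hC g hg).
case: g hg {hC} => [[tau P] h] [htau hcomp hP hh _] /=.
have tge0 q := grid_ge0 htau q.
have step q : (q < P)%N -> \prod_(i < n) path X (s i) (tau q.+1) - \prod_(i < n) path X (s i) (tau q) =
    \sum_(k < n) \sum_(i : {ffun 'I_k.+1 -> 'I_n} | increasing i) \sum_(th <- index_words i)
      word_expansion i th (tau q) (X (tau q) (tau q.+1)).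
  move=> qP.
  have -> : \prod_(i < n) path X (s i) (tau q.+1) = \prod_(i < n) (path X (s i) (tau q) +
      sharp (V i (tau q)) (X (tau q) (tau q.+1))).
    apply: eq_bigr => i _; have [hs _] := hV i.
    exact: (path_increment hX hs htau (hV i) (hcomp i) qP).
  rewrite (@product_increment _ _ n (fun i => path X (s i) (tau q)) (fun i => V i (tau q)) _ _
    (fun i => V_factors i (tau q))) addrC addKr.
  apply: eq_bigr => k _; apply: eq_bigr => i _.
  have -> : [seq [seq factors (tau q) e | e <- s (i j)] | j <- enum 'I_k.+1] =
      [seq [seq factors (tau q) e | e <- l] | l <- [seq s (i j) | j <- enum 'I_k.+1]].
    by rewrite -map_comp.
  by rewrite choices_map big_map.
have -> : \prod_(i < n) M i = \sum_(q < P) (\prod_(i < n) path X (s i) (tau q.+1) -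
    \prod_(i < n) path X (s i) (tau q)).
  rewrite -(big_mkord xpredT (fun q => \prod_(i < n) path X (s i) (tau q.+1) -
    \prod_(i < n) path X (s i) (tau q))) telescope_sumr //.
  have [-> _] := htau.
  have -> : \prod_(i < n) path X (s i) 0 = 0.
    rewrite (eq_bigr (fun=> 0)) => [|i _].
      by rewrite -(prednK n0) big_ord_recl mul0r.
    by have [hs _] := hV i; rewrite (path0 X hs).
  rewrite subr0; apply: eq_bigr => i _.
  by rewrite (path_end X (hV i) (hcomp i)).
rewrite (eq_bigr _ (fun (q : 'I_P) _ => step q (ltn_ord q))).
rewrite exchange_big /= -sumrB big_enum /=.
apply: le_trans (n2_sum _ _) _; apply: ler_sum => k _.
rewrite -sumrB.
have E (q : 'I_P) : xpredT q ->
    (\sum_(i : {ffun 'I_k.+1 -> 'I_n} | increasing i) \sum_(th <- index_words i)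
      word_expansion i th (tau q) (X (tau q) (tau q.+1))) -
    sharp (W k (tau q)) (X (tau q) (tau q.+1) ^+ k.+1) =
    \sum_(i : {ffun 'I_k.+1 -> 'I_n} | increasing i) \sum_(th <- index_words i)
      (word_expansion i th (tau q) (X (tau q) (tau q.+1)) -
       word_condensed i th (tau q) (X (tau q) (tau q.+1))).
  move=> _; rewrite integrand_condensed // -sumrB.
  by apply: eq_bigr => i _; rewrite sumrB.
rewrite (eq_bigr _ E) exchange_big /= big_enum_cond /=.
have n2P (F : {ffun 'I_k.+1 -> 'I_n} -> A) :
    n2 (\sum_(i | increasing i) F i) <= \sum_(i | increasing i) n2 (F i).
  by rewrite -big_filter -[leRHS]big_filter; exact: n2_sum.
apply: le_trans (n2P _) _; apply: ler_sum => i _.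
by rewrite exchange_big /=; apply: n2_sum.
Qed.

End Integrands.

(** * Hoelder biprocesses and Riemann sums *)

Section HolderBiprocesses.
Context {R : realType} {A : tracial_vN R} (At : R -> set A).
Hypothesis hAt : vN_filtration At.

(** What is retained of the construction of the integrands: adapted
    biprocesses that vanish after the last point of a grid and are Hoelder
    continuous of exponent 1/2 on its cells, for both quantities that control an
    integral. *)
Record holder_biprocess (t : nat -> R) Q C (W : R -> tens A 2) : Prop := {
  hb_grid : grid t;
  hb_C : 0 <= C;
  hb_adapted : forall u, 0 <= u -> adapted_tens (At u) (W u);
  hb_out : forall u, t Q <= u -> W u = 0;
  hb_holder : forall q, (q < Q)%N -> forall u v,
    t q <= u < t q.+1 -> t q <= v < t q.+1 ->
    tnorm2 (W u - W v) <= C * Num.sqrt `|u - v| /\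
    n2 (tmul (W u) - tmul (W v)) <= C * Num.sqrt `|u - v|
}.

Definition mesh_le (t : nat -> R) Q h := forall q, (q < Q)%N -> t q.+1 - t q <= h.

Lemma refine_cell (t : nat -> R) N Q j : grid t -> (j < Q * N)%N ->
  [/\ (j %/ N < Q)%N, t (j %/ N)%N <= refine t N j, refine t N j.+1 <= t (j %/ N).+1,
    refine t N j.+1 - refine t N j <= (t (j %/ N).+1 - t (j %/ N)%N) / N%:R &
    t (j %/ N)%N < t (j %/ N).+1 -> refine t N j < t (j %/ N).+1].
Proof.
move=> ht jQ; have N0 : (0 < N)%N by case: N jQ; rewrite ?muln0.
have [q [i [iN je]]] := refine_split j N0.
have -> : (j %/ N = q)%N by rewrite je divnMDl // divn_small // addn0.
have qQ : (q < Q)%N.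
  by rewrite -(ltn_pmul2r N0); apply: leq_ltn_trans jQ; rewrite je leq_addr.
have [_ tm] := ht; have tq : 0 <= t q.+1 - t q by rewrite subr_ge0.
have NR : 0 < N%:R :> R by rewrite ltr0n.
rewrite je -(refine_step t q iN) refineE // refineES //.
split=> //.
- by rewrite lerDl mulr_ge0 // divr_ge0 // ltW.
- rewrite -lerBrDl -[leRHS]mul1r ler_wpM2r // ler_pdivrMr // mul1r ler_nat //.
- by move=> tt; rewrite -ltrBrDl -[ltRHS]mul1r ltr_pM2r ?subr_gt0 // ltr_pdivrMr // mul1r ltr_nat.
Qed.

Lemma refine_mesh (t : nat -> R) N Q h : grid t -> mesh_le t Q h ->
  mesh_le (refine t N) (Q * N) h.
Proof.
move=> ht hh j jQ; have [qQ h1 h2 _ _] := refine_cell ht jQ.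
by have := hh _ qQ; lra.
Qed.

Lemma refine_mesh_vanishing (t : nat -> R) N Q : grid t ->
  mesh_le (refine t N.+1) (Q * N.+1) (t Q / N.+1%:R).
Proof.
move=> ht j jQ; have [qQ _ _ h _] := refine_cell ht jQ.
apply: le_trans h _; rewrite ler_wpM2r ?invr_ge0 //.
have := grid_ge0 ht (j %/ N.+1)%N; have := grid_mono ht qQ; lra.
Qed.

Lemma holder_refine t Q C W N : (0 < N)%N -> holder_biprocess t Q C W ->
  holder_biprocess (refine t N) (Q * N) C W.
Proof.
move=> N0 [ht C0 ad out hol]; split=> //; first exact: refine_grid.
- by move=> u; rewrite refineM //; apply: out.
move=> j jQ u v /andP[u1 u2] /andP[v1 v2].
have [qQ h1 h2 _ _] := refine_cell ht jQ.
by apply: (hol _ qQ); lra.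
Qed.

Lemma holder_cell t Q C W h q u : holder_biprocess t Q C W -> mesh_le t Q h ->
  (q < Q)%N -> t q <= u < t q.+1 ->
  tnorm2 (W u - W (t q)) <= C * Num.sqrt h /\
  n2 (tmul (W u) - tmul (W (t q))) <= C * Num.sqrt h.
Proof.
move=> [ht C0 ad out hol] hh qQ hu; have := hh q qQ => hq.
have [|h1 h2] := hol q qQ u (t q) hu; first by move: hu; lra.
have sq : C * Num.sqrt `|u - t q| <= C * Num.sqrt h.
  by rewrite ler_wpM2l // ler_wsqrtr // ger0_norm; move: hu; lra.
by split; [apply: le_trans h1 sq | apply: le_trans h2 sq].
Qed.

(** A piece of a cell of positive length starts inside this cell; an empty cell
    causes no error. *)
Lemma holder_refine_point t Q C W h N j : holder_biprocess t Q C W -> mesh_le t Q h ->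
  (j < Q * N)%N ->
  tnorm2 (W (refine t N j) - W (t (j %/ N)%N)) <= C * Num.sqrt h /\
  n2 (tmul (W (refine t N j)) - tmul (W (t (j %/ N)%N))) <= C * Num.sqrt h.
Proof.
move=> hW hh jQ; have ht := hb_grid hW; have C0 := hb_C hW.
have [qQ h1 h2 h3 h4] := refine_cell ht jQ.
have [tm0 tm] := ht.
have := tm (j %/ N)%N; rewrite le_eqVlt => /orP[/eqP te|tt].
  have -> : refine t N j = t (j %/ N)%N.
    have N0 : (0 < N)%N by case: (N) jQ; rewrite ?muln0.
    by have := refine_mono N0 tm j; lra.
  by rewrite !subrr tnorm2_0 n2_0 mulr_ge0 // sqrtr_ge0.
by apply: (holder_cell hW hh qQ); rewrite h1 h4.
Qed.

End HolderBiprocesses.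

Section RiemannSums.
Context {R : realType} {A : tracial_vN R} (At : R -> set A) (r : nat -> R)
  (mut : R -> probability (measurableTypeR R) R) (X : R -> R -> A)
  (Delta : nat -> R -> R -> A).
Hypotheses (hAt : vN_filtration At) (hmut : free_convolution_semigroup r mut)
  (hX : free_stochastic_measure At mut X)
  (hDelta : forall k, (0 < k)%N -> diagonal_measure X k (Delta k)).

Definition riemann_sum (t : nat -> R) Q k (W : R -> tens A 2) :=
  \sum_(q < Q) sharp (W (t q)) (Delta k (t q) (t q.+1)).

Lemma sum_steps (t : nat -> R) Q : grid t -> \sum_(q < Q) (t q.+1 - t q) = t Q.
Proof.
move=> [t0 _]; rewrite -(big_mkord xpredT (fun q => t q.+1 - t q)).
by rewrite telescope_sumr // t0 subr0.
Qed.

(** Moving the evaluation points to those of a coarser grid costs a power of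
    the mesh of the latter, whatever the finer grid; so the finer grid may be
    sent to the limit first. *)
Lemma riemann_compare k : (0 < k)%N -> exists2 kappa, 0 <= kappa &
  forall t Q C W h N, holder_biprocess At t Q C W -> mesh_le t Q h -> h <= 1 ->
  n2 (\sum_(j < Q * N.+1) sharp (W (refine t N.+1 j) - W (t (j %/ N.+1)%N))
       (X (refine t N.+1 j) (refine t N.+1 j.+1) ^+ k)) <=
  kappa * C * (Num.sqrt (h * t Q) + Num.sqrt h * t Q).
Proof.
move=> k0; have [kap k1 hk] := moments_bound hmut (k + k).
have kp : 0 <= kap by lra.
exists kap => // t Q C W h N hW hh h1; have [ht C0 ad _ _] := hW.
have [Q0|Qp] := posnP Q.
  rewrite Q0 mul0n big_ord0 n2_0 mulr_ge0 ?(mulr_ge0 kp) //.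
  by rewrite addr_ge0 ?sqrtr_ge0 ?mulr_ge0 ?sqrtr_ge0 ?(grid_ge0 ht).
have h0 : 0 <= h by have := hh 0%N Qp; case: ht => _ /(_ 0%N); lra.
have hr : grid (refine t N.+1) by apply: refine_grid.
have [_ rm] := hr; have r0 := grid_ge0 hr; have t0 := grid_ge0 ht.
set rho := refine t N.+1 in hr rm r0 *.
have cell j : (j < Q * N.+1)%N -> `|moment (mut (rho j.+1 - rho j)) k| <= kap * (rho j.+1 - rho j)
    /\ `|moment (mut (rho j.+1 - rho j)) (k + k)| <= kap * (rho j.+1 - rho j).
  move=> jQ; have := refine_mesh ht hh jQ; rewrite -/rho => hj.
  by split; apply: hk => //; try lia; apply: le_trans hj h1.
have iso := @isometry_X R A At mut X hAt hX rho (Q * N.+1) k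
  (fun j => W (rho j) - W (t (j %/ N.+1)%N)) (r0 0%N) rm.
apply: le_trans (iso _) _.
  move=> j jQ; have [qQ g1 _ _ _] := refine_cell ht jQ.
  apply: adapted_tensB; [exact: At_sub|exact: ad|].
  by apply: adapted_tensW (ad _ (t0 _)); apply: At_mono.
rewrite mulrDr; apply: lerD.
  have -> : kap * C * Num.sqrt (h * t Q) = Num.sqrt (kap ^+ 2 * C ^+ 2 * (h * t Q)).
    rewrite -exprMn [RHS]sqrtrM ?sqr_ge0 // sqrtr_sqr ger0_norm //.
    exact: mulr_ge0.
  apply: ler_wsqrtr.
  apply: le_trans (_ : _ <= \sum_(j < Q * N.+1) kap * (rho j.+1 - rho j) * (C ^+ 2 * h)) _.
    apply: ler_sum => j _; have [c1 c2] := cell j (ltn_ord j).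
    have [g1 _] := holder_refine_point hW hh (ltn_ord j).
    apply: le_trans (_ : _ <= kap * (rho j.+1 - rho j) * tnorm2 (W (rho j) - W (t (j %/ N.+1)%N)) ^+ 2) _.
      by rewrite ler_wpM2r ?sqr_ge0 //; apply: le_trans (ler_norm _) c2.
    rewrite ler_wpM2l ?mulr_ge0 ?subr_ge0 // -[X in _ * X](sqr_sqrtr h0) -exprMn.
    by rewrite lerXn2r ?nnegrE ?tnorm2_ge0 ?mulr_ge0 ?sqrtr_ge0.
  rewrite -mulr_suml -mulr_sumr (sum_steps _ hr) /rho refineM //.
  have -> : kap ^+ 2 * C ^+ 2 * (h * t Q) = kap * (kap * t Q * (C ^+ 2 * h)) by ring.
  by rewrite ler_peMl // !mulr_ge0 ?sqr_ge0.
apply: le_trans (n2_sum _ _) _.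
apply: le_trans (_ : _ <= \sum_(j < Q * N.+1) kap * (rho j.+1 - rho j) * (C * Num.sqrt h)) _.
  apply: ler_sum => j _; have [c1 c2] := cell j (ltn_ord j).
  have [_ g1] := holder_refine_point hW hh (ltn_ord j).
  rewrite n2Z cabs_real tmulB; apply: ler_pM => //; exact: n2_ge0.
rewrite -mulr_suml -mulr_sumr (sum_steps _ hr) /rho refineM //.
by rewrite le_eqVlt; apply/orP; left; apply/eqP; ring.
Qed.

End RiemannSums.

(** * The product formula for Riemann sums *)

Section RiemannSumFormula.
Context {R : realType} {A : tracial_vN R} (At : R -> set A) (r : nat -> R)
  (mut : R -> probability (measurableTypeR R) R) (X : R -> R -> A)
  (Delta : nat -> R -> R -> A).
Hypotheses (hAt : vN_filtration At) (hmut : free_convolution_semigroup r mut)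
  (hX : free_stochastic_measure At mut X)
  (hDelta : forall k, (0 < k)%N -> diagonal_measure X k (Delta k)).
Local Notation elementary := (A * A * R * R)%type.
Variables (n : nat) (s : 'I_n -> seq elementary) (V : 'I_n -> R -> tens A 2).
Hypothesis hV : forall i, simple_expr At (V i) (s i).
Variables (t : nat -> R) (Q : nat).
Hypotheses (ht : grid t) (hc : forall i e, e \in s i -> compatible t Q e).

Let M i := simple_integral At (X 0) (V i).
Let Mt (i : 'I_n) (u : R) : A := simple_integral At (X 0) (restrict_biprocess 0 u (V i)).
Local Notation W k := (product_integrand k Mt V).

Lemma integrand_holder k : exists C, holder_biprocess At t Q C (W k).
Proof.
have tW := tame_integrand hAt hmut hX hV hc k.
have [C C0 hC] := tame_tensor_holder hAt ht tW.
exists C; split=> //; first by move=> u u0; apply: (tame_tensor_adapted u0 tW).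
by move=> u; apply: (integrand_out X hV hc).
Qed.

(** The discrete formula is applied to the refinements of the grid. Its
    integrands are moved to the points of the grid itself; then the powers of
    increments add up to diagonal measures in the limit. *)
Lemma riemann_sum_error (c : nat -> R) : (0 < n)%N -> (forall k, 0 <= c k) ->
  exists2 C, 0 <= C & forall tau P h, (forall i e, e \in s i -> compatible tau P e) -> tau P <= t Q ->
    (forall k, holder_biprocess At tau P (c k) (W k)) ->
    mesh_le tau P h -> 0 <= h <= 1 ->
  n2 (\prod_(i < n) M i - \sum_(k < n) riemann_sum Delta tau P k.+1 (W k)) <=
    C * (Num.sqrt (h * t Q) + Num.sqrt h * t Q).
Proof.
move=> n0 c0.
have [C C0 hC] := ito_error hAt hmut hX hV ht hc n0.
have /choice[kappa hkappa] : forall k, exists kappa, 0 <= kappa /\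
  forall t Q C W h N, holder_biprocess At t Q C W -> mesh_le t Q h -> h <= 1 ->
  n2 (\sum_(j < Q * N.+1) sharp (W (refine t N.+1 j) - W (t (j %/ N.+1)%N))
       (X (refine t N.+1 j) (refine t N.+1 j.+1) ^+ k.+1)) <=
  kappa * C * (Num.sqrt (h * t Q) + Num.sqrt h * t Q).
  by move=> k; have [ka k0 hk] := riemann_compare hAt hmut hX (ltn0Sn k); exists ka.
exists (C + \sum_(k < n) kappa k * c k).
  rewrite addr_ge0 // sumr_ge0 // => k _; rewrite mulr_ge0 //.
  by case: (hkappa k).
move=> tau P h hcomp hP hW hh /andP[h0 h1].
have htau := hb_grid (hW 0%N).
pose rho K := refine tau K.+1.
pose a K (k : nat) := \sum_(j < P * K.+1) sharp (W k (rho K j)) (X (rho K j) (rho K j.+1) ^+ k.+1).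
pose b K (k : nat) := \sum_(j < P * K.+1) sharp (W k (tau (j %/ K.+1)%N)) (X (rho K j) (rho K j.+1) ^+ k.+1).
have vb : vanishing (fun K => \sum_(k < n) n2 (b K k - riemann_sum Delta tau P k.+1 (W k))).
  apply: vanishing_sum => k.
  case: htau => tau0 taum; have tau0' : 0 <= tau 0%N by rewrite tau0.
  exact: (sum_powers_Delta hDelta P (fun q => W k (tau q)) tau0' taum (ltn0Sn k)).
rewrite -subr_le0; apply: vanishing_le0 vb => K.
rewrite lerBlDl.
have -> : \prod_(i < n) M i - \sum_(k < n) riemann_sum Delta tau P k.+1 (W k) =
  (\prod_(i < n) M i - \sum_(k < n) a K k) + (\sum_(k < n) (a K k - b K k) +
    \sum_(k < n) (b K k - riemann_sum Delta tau P k.+1 (W k))).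
  by rewrite !sumrB addrA !subrKA.
apply: le_trans (n2_add _ _) _; rewrite mulrDl -addrA; apply: lerD.
  have /hC : fine_grid s t Q (rho K, (P * K.+1)%N, h).
    split=> //=; last by rewrite h0.
    - exact: refine_grid.
    - by move=> i e /hcomp; apply: compatible_refine.
    - by rewrite /rho refineM.
    - exact: refine_mesh.
  by [].
apply: le_trans (n2_add _ _) _; apply: lerD; last exact: n2_sum.
apply: le_trans (n2_sum _ _) _; rewrite mulr_suml; apply: ler_sum => k _.
have [kp hk] := hkappa k.
have := hk _ _ _ _ h K (hW k) hh h1.
rewrite -/(rho K); under eq_bigr => j _ do rewrite sharpB.
rewrite sumrB -/(a K k) -/(b K k) => /le_trans; apply.
rewrite ler_wpM2l ?mulr_ge0 //; apply: lerD.
  by rewrite ler_wsqrtr // ler_wpM2l.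
by rewrite ler_wpM2l // sqrtr_ge0.
Qed.

Lemma riemann_sum_limit : (0 < n)%N ->
  vanishing (fun N => n2 (\prod_(i < n) M i -
    \sum_(k < n) riemann_sum Delta (refine t N.+1) (Q * N.+1) k.+1 (W k))).
Proof.
move=> n0; have /choice[c hWc] := integrand_holder.
have [C C0 hC] := riemann_sum_error n0 (fun k => hb_C (hWc k)).
have T0 : 0 <= t Q by apply: grid_ge0.
pose h N : R := t Q / N.+1%:R.
have h0 N : 0 <= h N by rewrite /h divr_ge0.
have vh : vanishing h by apply: vanishingM; exact: vanishing_inv.
have vr : vanishing (fun N => C * (Num.sqrt (h N * t Q) + Num.sqrt (h N) * t Q)).
  apply: vanishingM; apply: vanishingD.
    apply: vanishing_sqrt => [N|]; first by rewrite mulr_ge0.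
    by apply: (@vanishing_ext _ (fun N => t Q * h N)) => [N|]; [rewrite mulrC|apply: vanishingM].
  apply: (@vanishing_ext _ (fun N => t Q * Num.sqrt (h N))) => [N|]; first by rewrite mulrC.
  by apply: vanishingM; apply: vanishing_sqrt.
have [N1 hN1] := vanishing_eps vh ltr01.
apply: eps_vanishing => e e0; have [N2 hN2] := vanishing_eps vr e0.
exists (maxn N1 N2) => N; rewrite geq_max => /andP[/hN1 hN /hN2 hr].
rewrite ger0_norm ?n2_ge0 //.
apply: le_trans (le_trans (ler_norm _) hr).
apply: hC.
- by move=> i e2 /hc; apply: compatible_refine.
- by rewrite refineM.
- by move=> k; apply: holder_refine.
- exact: refine_mesh_vanishing.
- by rewrite h0 (le_trans (ler_norm _) hN).
Qed.

End RiemannSumFormula.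

(** * Lebesgue integrals of step functions and of Hoelder functions *)

Section StepFunctions.
Context {R : realType}.

Definition step (V : nmodType) (t : nat -> R) Q (phi : nat -> V) (u : R) : V :=
  \sum_(q < Q) (if t q <= u < t q.+1 then phi q else 0).

Lemma step_cell (V : nmodType) t Q (phi : nat -> V) u q : grid t -> (q < Q)%N ->
  t q <= u < t q.+1 -> step t Q phi u = phi q.
Proof.
move=> ht qQ /andP[u1 u2]; rewrite /step (bigD1 (Ordinal qQ)) //= u1 u2.
rewrite big1 ?addr0 // => p /eqP pq; case: ifP => // /andP[p1 p2].
have pq' : (p : nat) <> q by move=> e; apply: pq; apply: val_inj.
have [lt|lt|//] := ltngtP p q.
  by exfalso; have := grid_mono ht lt; lra.
by exfalso; have := grid_mono ht lt; lra.
Qed.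

Lemma step_out (V : nmodType) t Q (phi : nat -> V) u : grid t -> t Q <= u ->
  step t Q phi u = 0.
Proof.
move=> ht tu; rewrite /step big1 // => p _; case: ifP => // /andP[p1 p2].
by exfalso; have := grid_mono ht (ltn_ord p); lra.
Qed.

Lemma grid_cell (t : nat -> R) Q (u : R) : grid t -> 0 <= u -> u < t Q ->
  exists2 q, (q < Q)%N & t q <= u < t q.+1.
Proof.
move=> [t0 tm] u0; elim: Q => [|Q IH] uQ; first by move: uQ; rewrite t0; lra.
have [lt|le] := ltP u (t Q); last by exists Q => //; rewrite le.
by have [q qQ hq] := IH lt; exists q => //; apply: ltnW.
Qed.

End StepFunctions.

Section HalfLineIntegrals.
Context {R : realType}.
Local Notation mu := (@lebesgue_measure R).
Local Notation half := (`[0, +oo[%classic : set (measurableTypeR R)).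

Lemma half_measurable : measurable half.
Proof. exact: measurable_itv. Qed.

(** Integrability and the value of the integral in one statement, which keeps
    them together in computations. *)
Definition integral_is (f : R -> R) (c : R) :=
  mu.-integrable half (EFin \o f) /\ (\int[mu]_(s in half) f s)%R = c.

Lemma integral_is_ext f g c : (forall u, 0 <= u -> f u = g u) ->
  integral_is f c -> integral_is g c.
Proof.
move=> fg [fi fc].
have fg' : {in half, f =1 g}.
  by move=> u; rewrite inE /= in_itv /= andbT; apply: fg.
split; last by rewrite -fc; apply: eq_Rintegral => u hu; rewrite fg'.
by apply: eq_integrable fi => // u hu; rewrite /= fg'.
Qed.

Lemma integral_isD f g c d : integral_is f c -> integral_is g d ->
  integral_is (fun u => f u + g u) (c + d).
Proof.
move=> [fi <-] [gi <-]; split; last by rewrite -RintegralD.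
have := integrableD half_measurable fi gi.
by apply: eq_integrable => // u _; rewrite /= EFinD.
Qed.

Lemma integral_isZ a f c : integral_is f c -> integral_is (fun u => a * f u) (a * c).
Proof.
move=> [fi <-]; split; last by rewrite -RintegralZl.
have := integrableZl half_measurable a fi.
by apply: eq_integrable => // u _; rewrite /= EFinM.
Qed.

Lemma integral_is0 : integral_is (fun=> 0) 0.
Proof.
split; first exact: integrable0.
by rewrite Rintegral_cst //= mul0r.
Qed.

Lemma integral_isB f g c d : integral_is f c -> integral_is g d ->
  integral_is (fun u => f u - g u) (c - d).
Proof.
move=> hf hg; rewrite -[- d]mulN1r.
apply: integral_is_ext (integral_isD hf (integral_isZ (-1) hg)) => u _.
by rewrite mulN1r.
Qed.

Lemma integral_is_sum (I : Type) (s : seq I) (f : I -> R -> R) c :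
  (forall i, integral_is (f i) (c i)) ->
  integral_is (fun u => \sum_(i <- s) f i u) (\sum_(i <- s) c i).
Proof.
move=> h; elim: s => [|i s IH].
  rewrite big_nil; apply: integral_is_ext integral_is0 => u _; by rewrite big_nil.
rewrite big_cons; apply: integral_is_ext (integral_isD (h i) IH) => u _.
by rewrite big_cons.
Qed.

Lemma integral_is_le f g c d : (forall u, 0 <= u -> f u <= g u) ->
  integral_is f c -> integral_is g d -> c <= d.
Proof.
move=> fg [fi <-] [gi <-]; apply: le_Rintegral => // u.
by rewrite /= in_itv /= andbT; apply: fg.
Qed.

Lemma integral_is_cell a b : 0 <= a -> a <= b ->
  integral_is (fun u => if a <= u < b then 1 else 0) (b - a).
Proof.
move=> a0 ab.
have E : (fun u => if a <= u < b then 1 else 0 : R) = \1_(`[a, b[%classic : set R).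
  apply/funext => u; rewrite indicE mem_setE /= in_itv /=.
  by case: ifP.
have fi : mu.-integrable half (EFin \o (\1_(`[a, b[%classic : set R))).
  by apply: integrableS (integrable_indic_itv a b _ _).
split; rewrite E //.
rewrite /Rintegral integral_indic //.
rewrite (_ : (`[a, b[%classic : set R) `&` half = (`[a, b[%classic : set R)); last first.
  apply/seteqP; split => u; first by case.
  by rewrite /= !in_itv /= => /andP[h1 h2]; split; rewrite ?h1 //= andbT; lra.
transitivity (fine (if (a%:E < b%:E)%E then (b%:E - a%:E)%E else 0%E)).
  by congr fine; exact: (lebesgue_measure_itv `[a, b[).
by rewrite lte_fin; case: ltP => //= ba; lra.
Qed.

Lemma integral_is_step t Q (phi : nat -> R) : grid t ->
  integral_is (step t Q phi) (\sum_(q < Q) (t q.+1 - t q) * phi q).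
Proof.
move=> ht; have tm := ht.2; have t0 := grid_ge0 ht.
apply: (@integral_is_ext (fun u => \sum_(q < Q) phi q * (if t q <= u < t q.+1 then 1 else 0))).
  by move=> u _; apply: eq_bigr => q _; case: ifP; rewrite ?mulr1 ?mulr0.
apply: integral_is_sum => q; rewrite mulrC; apply: integral_isZ.
exact: integral_is_cell.
Qed.

Lemma integral_is_dominated (f g : R -> R) d : measurable_fun half f ->
  (forall u, 0 <= u -> `|f u| <= g u) -> integral_is g d -> exists c, integral_is f c.
Proof.
move=> mf fg [gi _]; eexists; split; last by [].
apply: le_integrable gi => //; first exact/(measurable_realfun.measurable_EFinP _ _).2.
move=> u; rewrite /= in_itv /= andbT => u0.
by rewrite lee_fin; apply: le_trans (fg u u0) (ler_norm _).
Qed.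

(** *** Riemann sums of functions that are Hoelder continuous on cells *)

Definition holder_fun t Q (c : R) (f : R -> R) := (forall u, t Q <= u -> f u = 0) /\
  forall q, (q < Q)%N -> forall u v, t q <= u < t q.+1 -> t q <= v < t q.+1 ->
    `|f u - f v| <= c * Num.sqrt `|u - v|.

Lemma holder_fun_step t Q c f h u : grid t -> holder_fun t Q c f -> 0 <= c ->
  mesh_le t Q h -> 0 <= u ->
  `|f u - step t Q (fun q => f (t q)) u| <= step t Q (fun=> c * Num.sqrt h) u.
Proof.
move=> ht [out hol] c0 hh u0; have [lt|le] := ltP u (t Q); last first.
  by rewrite !step_out // out // subrr normr0.
have [q qQ hq] := grid_cell ht u0 lt.
rewrite !(step_cell _ ht qQ hq).
have := hh q qQ => hq'; apply: le_trans (hol q qQ u (t q) hq _) _.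
  by move: hq; lra.
by rewrite ler_wpM2l // ler_wsqrtr // ger0_norm; move: hq; lra.
Qed.

Lemma holder_fun_refine t Q c f N : (0 < N)%N -> grid t -> holder_fun t Q c f ->
  holder_fun (refine t N) (Q * N) c f.
Proof.
move=> N0 ht [out hol]; split=> [u|]; first by rewrite refineM //; apply: out.
move=> j jQ u v /andP[u1 u2] /andP[v1 v2].
have [qQ h1 h2 _ _] := refine_cell ht jQ.
by apply: (hol _ qQ); lra.
Qed.

(** As the limit of step functions along refinements. *)
Lemma holder_fun_measurable t Q c (f : R -> R) : grid t -> holder_fun t Q c f -> 0 <= c ->
  measurable_fun half f.
Proof.
move=> ht hf c0.
pose F N := step (refine t N.+1) (Q * N.+1) (fun q => f (refine t N.+1 q)).
apply: (@measurable_realfun.measurable_fun_cvg _ _ _ _ F) => [N|u].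
  have [/integrableP[mF _] _] := integral_is_step (Q * N.+1) (fun q => f (refine t N.+1 q))
    (refine_grid (ltn0Sn N) ht).
  exact: ((measurable_realfun.measurable_EFinP _ _).1 mF).
rewrite /= in_itv /= andbT => u0.
have h0 N : 0 <= t Q / N.+1%:R by rewrite divr_ge0 // grid_ge0.
have v : vanishing (fun N => c * Num.sqrt (t Q / N.+1%:R)).
  by apply: vanishingM; apply: vanishing_sqrt => //; apply: vanishingM; exact: vanishing_inv.
apply/subr_cvg0; apply: vanishing_le v => N; rewrite distrC.
have hr := refine_grid (ltn0Sn N) ht.
have hs := holder_fun_step hr (holder_fun_refine (ltn0Sn N) ht hf) c0
  (refine_mesh_vanishing (N := N) (Q := Q) ht) u0.
apply: le_trans hs _.
have [lt|le] := ltP u (refine t N.+1 (Q * N.+1)); last first.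
  by rewrite step_out // mulr_ge0 // sqrtr_ge0.
by have [q qQ hq] := grid_cell hr u0 lt; rewrite (step_cell _ hr qQ hq).
Qed.

Lemma holder_fun_integral t Q c f : grid t -> holder_fun t Q c f -> 0 <= c ->
  exists I, integral_is f I.
Proof.
move=> ht hf c0.
apply: (@integral_is_dominated _ (fun u => step t Q (fun q => `|f (t q)|) u +
  step t Q (fun=> c * Num.sqrt (t Q)) u)); first exact: holder_fun_measurable hf c0.
  move=> u u0; have hh : mesh_le t Q (t Q).
    by move=> q qQ; have := grid_mono ht qQ; have := grid_ge0 ht q; lra.
  have := holder_fun_step ht hf c0 hh u0.
  have [lt|le] := ltP u (t Q); last by rewrite !step_out // hf.1 // normr0 addr0.
  have [q qQ hq] := grid_cell ht u0 lt; rewrite !(step_cell _ ht qQ hq).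
  by move=> h; have := ler_normD (f u - f (t q)) (f (t q)); rewrite subrK; lra.
by apply: integral_isD; apply: integral_is_step.
Qed.

Lemma holder_fun_riemann t Q c f h I : grid t -> holder_fun t Q c f -> 0 <= c ->
  mesh_le t Q h -> integral_is f I ->
  `|I - \sum_(q < Q) (t q.+1 - t q) * f (t q)| <= c * Num.sqrt h * t Q.
Proof.
move=> ht hf c0 hh hI.
have d := integral_isB hI (integral_is_step Q (fun q => f (t q)) ht).
have e := integral_is_step Q (fun=> c * Num.sqrt h) ht.
have -> : c * Num.sqrt h * t Q = \sum_(q < Q) (t q.+1 - t q) * (c * Num.sqrt h).
  by rewrite -mulr_suml sum_steps // mulrC.
rewrite ler_norml; apply/andP; split.
  rewrite -mulN1r; apply: integral_is_le (integral_isZ (-1) e) d => u u0.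
  have := holder_fun_step ht hf c0 hh u0; rewrite ler_norml => /andP[h1 _].
  by rewrite mulN1r.
apply: integral_is_le d e => u u0.
by have := holder_fun_step ht hf c0 hh u0; rewrite ler_norml => /andP[_ h1].
Qed.

End HalfLineIntegrals.

(** * Weak integrals in L2 *)

Section VectorIntegrals.
Context {R : realType} {A : tracial_vN R} (L2 : L2_completion A).
Implicit Types (f F : R -> A) (x y : A).
Local Notation inj := (L2_inj L2).
Local Notation ip := (@L2_ip R A L2).

Lemma L2_injB x y : inj (x - y) = inj x - inj y.
Proof. by rewrite addrC -scaleN1r L2_injL scaleN1r addrC. Qed.

Lemma L2_inj0 : inj 0 = 0.
Proof. by rewrite -(subrr (0 : A)) L2_injB subrr. Qed.

Lemma L2_injD x y : inj (x + y) = inj x + inj y.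
Proof. by rewrite -[x in inj (x + y)]scale1r L2_injL scale1r. Qed.

Lemma L2_inj_sum (I : Type) (s : seq I) (f : I -> A) :
  inj (\sum_(i <- s) f i) = \sum_(i <- s) inj (f i).
Proof. exact: (big_morph _ L2_injD L2_inj0). Qed.

Lemma vnorm_L2_inj x : vnorm (inj x) = n2 x.
Proof.
rewrite -(fnorm_ip (L2_ipP L2)) /n2 /fnorm /trip.
by rewrite L2_injE.
Qed.

Lemma half_line_integralP (f : R -> R[i]) c : half_line_integral f c <->
  integral_is (fun u => re (f u)) (re c) /\
  integral_is (fun u => complex.Im (f u)) (complex.Im c).
Proof.
split=> [[h1 h2 ->]|[[h1 e1] [h2 e2]]]; first by [].
by split=> //; rewrite e1 e2; case: (c).
Qed.

Lemma im_sub (z w : R[i]) : complex.Im (z - w) = complex.Im z - complex.Im w.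
Proof. by case: z; case: w. Qed.

Lemma re_sub (z w : R[i]) : re (z - w) = re z - re w.
Proof. by case: z; case: w. Qed.

Lemma vector_integralB f g (z w : L2) : vector_integral f z -> vector_integral g w ->
  vector_integral (fun u => f u - g u) (z - w).
Proof.
move=> hf hg y; have /half_line_integralP[f1 f2] := hf y.
have /half_line_integralP[g1 g2] := hg y.
have -> : ip (z - w) (inj y) = ip z (inj y) - ip w (inj y).
  have h := ipL (L2_ipP L2) (inj y) (-1) w z.
  by rewrite addrC -scaleN1r h mulN1r addrC.
apply/half_line_integralP; rewrite re_sub im_sub; split.
  apply: integral_is_ext (integral_isB f1 g1) => u _.
  by rewrite mulrBr trB re_sub.
apply: integral_is_ext (integral_isB f2 g2) => u _.
by rewrite mulrBr trB im_sub.
Qed.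

Lemma re_sumc (I : Type) (s : seq I) (h : I -> R[i]) :
  re (\sum_(i <- s) h i) = \sum_(i <- s) re (h i).
Proof. by apply: (big_morph (fun z : R[i] => re z)) => //; case=> a b [c d]. Qed.

Lemma im_sumc (I : Type) (s : seq I) (h : I -> R[i]) :
  complex.Im (\sum_(i <- s) h i) = \sum_(i <- s) complex.Im (h i).
Proof. by apply: (big_morph (fun z : R[i] => complex.Im z)) => //; case=> a b [c d]. Qed.

Lemma im_real_mul (a : R) (z : R[i]) : complex.Im (a%:c * z) = a * complex.Im z.
Proof. by case: z => b c /=; rewrite mul0r addr0. Qed.

Definition riemann (t : nat -> R) Q F : A := \sum_(q < Q) (t q.+1 - t q)%:c *: F (t q).

Lemma tr_riemann t Q F y : ws_tr (ws_star y * riemann t Q F) =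
  \sum_(q < Q) (t q.+1 - t q)%:c * ws_tr (ws_star y * F (t q)).
Proof.
rewrite /riemann mulr_sumr tr_sum; apply: eq_bigr => q _.
by rewrite -scalerAr trZ.
Qed.

(** Testing the weak integral of a step function against its own sum turns it
    into a bound of the norm of this sum. *)
Lemma vector_integral_step t Q (phi : nat -> A) (z : L2) : grid t ->
  vector_integral (step t Q phi) z ->
  n2 (\sum_(q < Q) (t q.+1 - t q)%:c *: phi q) <= vnorm z.
Proof.
move=> ht hz; set x := \sum_(q < Q) _.
have /half_line_integralP[[_ h1] _] := hz x.
have [_ h2] : integral_is (fun u => re (ws_tr (ws_star x * step t Q phi u)))
    (re (ws_tr (ws_star x * x))).
  have -> : re (ws_tr (ws_star x * x)) =
      \sum_(q < Q) (t q.+1 - t q) * re (ws_tr (ws_star x * phi q)).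
    rewrite {2}/x mulr_sumr tr_sum re_sumc; apply: eq_bigr => q _.
    by rewrite -scalerAr trZ re_real_mul.
  apply: integral_is_ext (integral_is_step Q (fun q => re (ws_tr (ws_star x * phi q))) ht) => u _.
  rewrite /step mulr_sumr tr_sum re_sumc; apply: eq_bigr => q _.
  by case: ifP => // _; rewrite mulr0 tr0.
have : n2 x ^+ 2 <= vnorm z * n2 x.
  rewrite -vnorm_L2_inj; apply: le_trans (ip_CS (L2_ipP L2) z (inj x)).
  apply: le_trans (cabs_re _); apply: le_trans (ler_norm _).
  by rewrite vnorm_L2_inj -h1 h2 n2_sq.
have := n2_ge0 x; rewrite le_eqVlt => /orP[/eqP <- _|x0]; first exact: vnorm_ge0.
by rewrite expr2 ler_pM2r.
Qed.

Lemma trace_holder t Q C F y : 0 <= C -> (forall u, t Q <= u -> F u = 0) ->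
  (forall q, (q < Q)%N -> forall u v, t q <= u < t q.+1 -> t q <= v < t q.+1 ->
    n2 (F u - F v) <= C * Num.sqrt `|u - v|) ->
  holder_fun t Q (n2 y * C) (fun u => re (ws_tr (ws_star y * F u))) /\
  holder_fun t Q (n2 y * C) (fun u => complex.Im (ws_tr (ws_star y * F u))).
Proof.
move=> C0 out hol.
have bound q : (q < Q)%N -> forall u v, t q <= u < t q.+1 -> t q <= v < t q.+1 ->
    cabs (ws_tr (ws_star y * F u) - ws_tr (ws_star y * F v)) <= n2 y * C * Num.sqrt `|u - v|.
  move=> qQ u v hu hv; rewrite -trB -mulrBr; apply: le_trans (tr_CS _ _) _.
  by rewrite n2_star -mulrA ler_wpM2l ?n2_ge0 //; apply: hol qQ _ _ hu hv.
split; split=> [u tu|q qQ u v hu hv]; try by rewrite out // mulr0 tr0.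
  by rewrite -re_sub; apply: le_trans (cabs_re _) (bound q qQ u v hu hv).
by rewrite -im_sub; apply: le_trans (cabs_im _) (bound q qQ u v hu hv).
Qed.

(** The Riemann sums converge weakly, at a rate that is uniform over test
    vectors of norm [1]; testing against the difference of two of them shows
    that they form a Cauchy sequence. *)
Lemma vector_integral_holder t Q C b F : grid t -> 0 <= C -> 0 <= b ->
  (forall u, t Q <= u -> F u = 0) ->
  (forall q, (q < Q)%N -> forall u v, t q <= u < t q.+1 -> t q <= v < t q.+1 ->
    n2 (F u - F v) <= C * Num.sqrt `|u - v|) ->
  (forall u, 0 <= u -> n2 (F u) <= b) ->
  exists2 z : L2, vector_integral F z & vnorm z <= b * t Q.
Proof.
move=> ht C0 b0 out hol Fb.
have T0 := grid_ge0 ht Q.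
pose rho K := refine t K.+1.
have hrho K : grid (rho K) by apply: refine_grid.
have rhoE K : rho K (Q * K.+1)%N = t Q by rewrite /rho refineM.
pose zeta K := riemann (rho K) (Q * K.+1) F.
pose err K := C * Num.sqrt (t Q / K.+1%:R) * t Q.
have err0 K : 0 <= err K by rewrite !mulr_ge0 ?sqrtr_ge0.
have verr : vanishing err.
  apply: (@vanishing_ext _ (fun K => t Q * (C * Num.sqrt (t Q / K.+1%:R)))).
    by move=> K; rewrite mulrC.
  do 2!apply: vanishingM; apply: vanishing_sqrt => [K|]; first by rewrite divr_ge0.
  by apply: vanishingM; exact: vanishing_inv.
have hre y : exists2 I, integral_is (fun u => re (ws_tr (ws_star y * F u))) I &
    forall K, `|I - re (ws_tr (ws_star y * zeta K))| <= n2 y * err K.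
  have [hf _] := trace_holder y C0 out hol.
  have c0 : 0 <= n2 y * C by rewrite mulr_ge0 ?n2_ge0.
  have [I hI] := holder_fun_integral ht hf c0; exists I => // K.
  have := holder_fun_riemann (hrho K) (holder_fun_refine (ltn0Sn K) ht hf) c0
    (refine_mesh_vanishing (N := K) (Q := Q) ht) hI.
  rewrite -/(rho K) rhoE /err !mulrA tr_riemann re_sumc.
  by under [X in _ -> `|_ - X| <= _]eq_bigr => q _ do rewrite re_real_mul.
have him y : exists2 I, integral_is (fun u => complex.Im (ws_tr (ws_star y * F u))) I &
    forall K, `|I - complex.Im (ws_tr (ws_star y * zeta K))| <= n2 y * err K.
  have [_ hf] := trace_holder y C0 out hol.
  have c0 : 0 <= n2 y * C by rewrite mulr_ge0 ?n2_ge0.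
  have [I hI] := holder_fun_integral ht hf c0; exists I => // K.
  have := holder_fun_riemann (hrho K) (holder_fun_refine (ltn0Sn K) ht hf) c0
    (refine_mesh_vanishing (N := K) (Q := Q) ht) hI.
  rewrite -/(rho K) rhoE /err !mulrA tr_riemann im_sumc.
  by under [X in _ -> `|_ - X| <= _]eq_bigr => q _ do rewrite im_real_mul.
have cau K L : n2 (zeta K - zeta L) <= err K + err L.
  set y := zeta K - zeta L; have [I _ hI] := hre y.
  have : n2 y * n2 y <= n2 y * (err K + err L).
    have <- : re (ws_tr (ws_star y * y)) = n2 y * n2 y by rewrite n2_sq /= expr2.
    rewrite {2}/y mulrBr trB re_sub mulrDr.
    have := hI K; have := hI L; rewrite !ler_norml; lra.
  have := n2_ge0 y; rewrite le_eqVlt => /orP[/eqP <- _|y0].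
    by rewrite addr_ge0.
  by rewrite ler_pM2l.
have [z hz] : exists z : L2, (inj \o zeta) @ \oo --> z.
  apply: vcauchy => e e0; have e20 : 0 < e / 2 by rewrite divr_gt0.
  have [N hN] := vanishing_eps verr e20.
  exists N => K L /hN hK /hN hL; rewrite /= -L2_injB vnorm_L2_inj.
  apply: le_trans (cau K L) _; move: hK hL; rewrite !ger0_norm //; lra.
have vz : vanishing (fun K => vnorm (inj (zeta K) - z)) by apply/vcvgP.
have hip y K : cabs (ip z (inj y) - ws_tr (ws_star y * zeta K)) <=
    vnorm (inj (zeta K) - z) * n2 y.
  rewrite -(L2_injE L2) vnormB -(vnorm_L2_inj y).
  apply: le_trans (ip_CS (L2_ipP L2) _ _).
  have h := ipL (L2_ipP L2) (inj y) (-1) (inj (zeta K)) z.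
  by rewrite [z - _]addrC -[- inj (zeta K)]scaleN1r h mulN1r addrC.
have lim_eq (y : A) (I J : R) (a : nat -> R) :
    (forall K, `|I - a K| <= n2 y * err K) ->
    (forall K, `|J - a K| <= vnorm (inj (zeta K) - z) * n2 y) -> I = J.
  move=> h1 h2; apply/eqP; rewrite -subr_eq0 -normr_le0.
  have v : vanishing (fun K => n2 y * err K + n2 y * vnorm (inj (zeta K) - z)).
    by apply: vanishingD; apply: vanishingM.
  apply: vanishing_le0 v => K; rewrite [n2 y * vnorm _]mulrC.
  apply: le_trans (lerD (h1 K) (h2 K)).
  by rewrite [`|J - _|]distrC; apply: le_trans (ler_normD _ _); rewrite addrA subrK.
exists z.
  move=> y; apply/half_line_integralP; split.
    have [I hI h] := hre y; suff <- : I = re (ip z (inj y)) by [].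
    apply: (lim_eq y I _ _ h) => K.
    by rewrite -re_sub; apply: le_trans (cabs_re _) (hip y K).
  have [I hI h] := him y; suff <- : I = complex.Im (ip z (inj y)) by [].
  apply: (lim_eq y I _ _ h) => K.
  by rewrite -im_sub; apply: le_trans (cabs_im _) (hip y K).
have zb K : n2 (zeta K) <= b * t Q.
  apply: le_trans (n2_sum _ _) _; rewrite -(rhoE K) -(sum_steps _ (hrho K)) mulr_sumr.
  apply: ler_sum => j _; have [_ rm] := hrho K.
  have d0 : 0 <= rho K j.+1 - rho K j by rewrite subr_ge0.
  rewrite n2Z cabs_real ger0_norm // mulrC ler_wpM2r //.
  by apply: Fb; apply: grid_ge0.
rewrite -subr_le0; apply: vanishing_le0 vz => K.
rewrite lerBlDr vnormB; apply: le_trans (lerD (lexx _) (zb K)).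
by rewrite -vnorm_L2_inj -{1}(subrK (inj (zeta K)) z) vnorm_add.
Qed.

End VectorIntegrals.

(** * Sampling at the points of a grid *)

Section SampledBiprocesses.
Context {R : realType} {A : tracial_vN R} (At : R -> set A).
Hypothesis hAt : vN_filtration At.

Definition sampled (t : nat -> R) Q (W : R -> tens A 2) := step t Q (fun q => W (t q)).

Lemma sampled_simple t Q C W : holder_biprocess At t Q C W ->
  exists2 s, simple_expr At (sampled t Q W) s & forall e, e \in s -> compatible t Q e.
Proof.
move=> [ht _ ad _ _]; have tm := ht.2; have t0 := grid_ge0 ht.
have /choice[l hl] : forall q, exists l : seq (A * A),
    (forall p, p \in l -> At (t q) p.1 /\ At (t q) p.2) /\ W (t q) = tsum l.
  by move=> q; have [l h1 h2] := ad _ (t0 q); exists l.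
pose cell q (p : A * A) := (p.1, p.2, t q, t q.+1).
exists (flatten [seq [seq cell q p | p <- l q] | q <- iota 0 Q]).
  split=> [e /flatten_mapP[q _ /mapP[p pl ->]]|].
    by have [h1 h2] := (hl q).1 p pl; split.
  apply/funext => u; rewrite /sampled /step big_flatten big_map.
  rewrite -(big_mkord xpredT (fun q => if t q <= u < t q.+1 then W (t q) else 0)) /=.
  rewrite /index_iota subn0; apply: eq_bigr => q _; rewrite big_map /=.
  by case: ifP => _; rewrite ?(hl q).2 // big1.
move=> e /flatten_mapP[q]; rewrite mem_iota add0n => /andP[_ qQ] /mapP[p pl ->].
split; first exact: (grid_mono ht).
move=> q' _; have [lt|lt|->] := ltngtP q' q.
- by constructor 2; apply: (grid_mono ht).
- by constructor 3; apply: (grid_mono ht).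
by constructor 1.
Qed.

Lemma step_increment t Q (phi : nat -> tens A 2) (D : R -> A) q : grid t -> (q < Q)%N ->
  sharp (step t Q phi (t q)) (D (t q.+1) - D (t q)) = sharp (phi q) (D (t q.+1) - D (t q)).
Proof.
move=> ht qQ; have := ht.2 q; rewrite le_eqVlt => /orP[/eqP <-|lt].
  by rewrite subrr !sharp0r.
by rewrite (step_cell _ ht qQ) // lexx.
Qed.

Lemma simple_step t Q U s : grid t -> simple_expr At U s ->
  (forall e, e \in s -> compatible t Q e) ->
  forall u, 0 <= u -> U u = step t Q (fun q => U (t q)) u.
Proof.
move=> ht [hs ->] hc u u0; have [lt|le] := ltP u (t Q); last first.
  by rewrite step_out // big_seq big1 // => e es; rewrite (elementary_fun_out (hc e es)).
have [q qQ hq] := grid_cell ht u0 lt; rewrite (step_cell _ ht qQ hq).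
by apply: eq_big_seq => e es; rewrite (elementary_fun_cell (hc e es) qQ hq).
Qed.

Lemma simple_adapted U s u : simple_expr At U s -> 0 <= u -> adapted_tens (At u) (U u).
Proof.
move=> [hs ->] u0; rewrite big_seq; apply: adapted_tens_sum => e es.
have [a0 ab Ax Ay] := adapted_bounds (hs e es); rewrite elementary_funE.
case: ifP => [/andP[au _]|_].
  by apply: adapted_tensor2; [apply: At_mono Ax|apply: At_mono Ay].
by exists [::] => //; rewrite /tsum big_nil.
Qed.

(** *** The two quantities that control a sampling error *)

Section Error.
Variables (t : nat -> R) (Q : nat) (C h : R) (W : R -> tens A 2).
Hypotheses (hW : holder_biprocess At t Q C W) (hh : mesh_le t Q h).

Let G u := sampled t Q W u - W u.

Lemma sampled_cell q u : (q < Q)%N -> t q <= u < t q.+1 -> G u = W (t q) - W u.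
Proof. by move=> qQ hq; rewrite /G /sampled (step_cell _ (hb_grid hW) qQ hq). Qed.

Lemma sampled_out u : t Q <= u -> G u = 0.
Proof. by move=> tu; rewrite /G /sampled (step_out _ (hb_grid hW) tu) (hb_out hW) // subrr. Qed.

Lemma sampled_small u : 0 <= u ->
  tnorm2 (G u) <= step t Q (fun=> C * Num.sqrt h) u /\ n2 (tmul (G u)) <= C * Num.sqrt h.
Proof.
move=> u0; have ht := hb_grid hW.
have c0 : 0 <= C * Num.sqrt h by rewrite mulr_ge0 ?sqrtr_ge0 ?(hb_C hW).
have [lt|le] := ltP u (t Q); last first.
  by rewrite sampled_out // step_out // tnorm2_0 tmul0 n2_0.
have [q qQ hq] := grid_cell ht u0 lt.
have [h1 h2] := holder_cell hW hh qQ hq.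
rewrite (sampled_cell qQ hq) (step_cell _ ht qQ hq) -tnorm2N opprB; split=> //.
by rewrite -n2N tmulB opprB.
Qed.

(** On a cell the sampled value is constant, so that the error inherits the
    modulus of continuity of [W]. *)
Lemma sampled_norm_holder : holder_fun t Q C (fun u => tnorm2 (G u)).
Proof.
split=> [u tu|q qQ u v hu hv]; first by rewrite sampled_out // tnorm2_0.
have [h1 _] := hb_holder hW qQ hu hv; apply: le_trans h1.
rewrite !(sampled_cell qQ) //.
have E : W (t q) - W u = (W (t q) - W v) - (W u - W v) by rewrite opprB addrA subrK.
have E' : W (t q) - W v = (W (t q) - W u) + (W u - W v) by rewrite addrA subrK.
have := tnorm2_add (W (t q) - W v) (- (W u - W v)); rewrite -E tnorm2N => h2.
have := tnorm2_add (W (t q) - W u) (W u - W v); rewrite -E' => h3.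
by rewrite ler_norml lerBlDl h2 lerNl opprB lerBlDl h3.
Qed.

Lemma sampled_measurable :
  measurable_fun (`[0, +oo[%classic : set (measurableTypeR R)) (fun u => tnorm2 (G u)).
Proof. exact: holder_fun_measurable (hb_grid hW) sampled_norm_holder (hb_C hW). Qed.

Lemma sampled_sq_integral : 0 <= h -> (0 <= \int[lebesgue_measure]_(s in `[0%R, +oo[)
    ((tnorm2 (G s)) ^+ 2)%:E <= (C ^+ 2 * h * t Q)%:E)%E.
Proof.
move=> h0; have ht := hb_grid hW; apply/andP; split.
  by apply: integral_ge0 => u _; rewrite lee_fin sqr_ge0.
have [fi fE] := integral_is_step Q (fun=> C ^+ 2 * h) ht.
have -> : (C ^+ 2 * h * t Q)%:E = (\int[lebesgue_measure]_(s in `[0%R, +oo[)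
    (step t Q (fun=> C ^+ 2 * h) s)%:E)%E.
  rewrite -(sum_steps Q ht) mulrC mulr_suml -fE /Rintegral fineK //.
  exact: integrable_fin_num fi.
apply: ge0_le_integral => //.
- by move=> u _; rewrite lee_fin sqr_ge0.
- apply/(measurable_realfun.measurable_EFinP _ _).2.
  by apply: measurable_realfun.measurable_funX; exact: sampled_measurable.
- by have [/integrableP[]] := integral_is_step Q (fun=> C ^+ 2 * h) ht.
move=> u; rewrite /= in_itv /= andbT => u0; rewrite lee_fin.
have [h1 _] := sampled_small u0; have [lt|le] := ltP u (t Q); last first.
  by rewrite sampled_out // step_out // tnorm2_0 expr0n.
have [q qQ hq] := grid_cell ht u0 lt; move: h1; rewrite !(step_cell _ ht qQ hq) => h1.
rewrite -[X in _ <= _ * X](sqr_sqrtr h0) -exprMn lerXn2r ?nnegrE ?tnorm2_ge0 //.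
by rewrite mulr_ge0 ?sqrtr_ge0 ?(hb_C hW).
Qed.

Lemma sampled_vector_integral (L2 : L2_completion A) :
  exists2 z : L2, vector_integral (fun u => tmul (G u)) z & vnorm z <= C * Num.sqrt h * t Q.
Proof.
apply: (@vector_integral_holder _ _ L2 t Q C) => //.
- exact: hb_grid hW.
- exact: hb_C hW.
- by rewrite mulr_ge0 ?sqrtr_ge0 ?(hb_C hW).
- by move=> u tu; rewrite sampled_out // tmul0.
- move=> q qQ u v hu hv; have [_ h1] := hb_holder hW qQ hu hv; apply: le_trans h1.
  rewrite !(sampled_cell qQ) // -tmulB opprB addrC addrA subrK.
  by rewrite -tmulB -n2N -[- tmul _]scaleN1r -tmulZ scaleN1r opprB.
by move=> u u0; have [] := sampled_small u0.
Qed.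

End Error.

Lemma sampled_approximates (L2 : L2_completion A) t Q C W : holder_biprocess At t Q C W ->
  approximates At L2 (fun N => sampled (refine t N.+1) (Q * N.+1) W) W.
Proof.
move=> hW; have ht := hb_grid hW; have T0 := grid_ge0 ht Q.
have hWN N := holder_refine (ltn0Sn N) hW.
have hm N := refine_mesh_vanishing (N := N) (Q := Q) ht.
have tE N : refine t N.+1 (Q * N.+1)%N = t Q by rewrite refineM.
pose h N : R := t Q / N.+1%:R.
have h0 N : 0 <= h N by rewrite divr_ge0.
have vh : vanishing h by apply: vanishingM; exact: vanishing_inv.
split.
- by move=> N; have [s hs _] := sampled_simple (hWN N); exists s.
- by move=> N; exact: sampled_measurable (hWN N).
- apply: (@squeeze_cvge _ _ _ _ (fun=> 0%E) _ (fun N => (C ^+ 2 * h N * t Q)%:E)).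
  + near=> N; rewrite -(tE N); exact: sampled_sq_integral.
  + exact: cvg_cst.
  + apply: cvg_EFin; first by near=> N.
    have v : vanishing (fun N => t Q * (C ^+ 2 * h N)) by do 2!apply: vanishingM.
    by apply: vanishing_ext v => N /=; rewrite mulrC.
have /choice[z hz] : forall N, exists z : L2,
    vector_integral (fun u => tmul (sampled (refine t N.+1) (Q * N.+1) W u - W u)) z /\
    vnorm z <= C * Num.sqrt (h N) * t Q.
  move=> N; have [z h1 h2] := sampled_vector_integral (hWN N) (hm N) L2.
  by exists z; rewrite -(tE N).
exists z => [N|]; first by have [] := hz N.
apply/vcvgP; have v : vanishing (fun N => t Q * (C * Num.sqrt (h N))).
  by do 2!apply: vanishingM; apply: vanishing_sqrt.
apply: vanishing_le v => N; rewrite subr0 ger0_norm ?vnorm_ge0 // mulrC.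
by have [] := hz N.
Unshelve. all: by end_near.
Qed.

End SampledBiprocesses.

(** * Integrable biprocesses *)

Section IntegrableBiprocesses.
Context {R : realType} {A : tracial_vN R} (L2 : L2_completion A) (At : R -> set A)
  (r : nat -> R) (mut : R -> probability (measurableTypeR R) R) (X : R -> R -> A)
  (Delta : nat -> R -> R -> A).
Hypotheses (hAt : vN_filtration At) (hmut : free_convolution_semigroup r mut)
  (hX : free_stochastic_measure At mut X)
  (hDelta : forall k, (0 < k)%N -> diagonal_measure X k (Delta k)).
Local Notation half := (`[0, +oo[%classic : set (measurableTypeR R)).

Lemma vector_integral_ext (f g : R -> A) (z : L2) : (forall u, 0 <= u -> f u = g u) ->
  vector_integral f z -> vector_integral g z.
Proof.
move=> fg h y; have /half_line_integralP[h1 h2] := h y.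
apply/half_line_integralP; split.
  by apply: integral_is_ext h1 => u u0; rewrite fg.
by apply: integral_is_ext h2 => u u0; rewrite fg.
Qed.

Lemma sqr_le_sum (a b c : R) : 0 <= a -> a <= b + c -> a ^+ 2 <= 2 * (b ^+ 2 + c ^+ 2).
Proof.
move=> a0 abc; have := ler_pM a0 a0 abc abc; have := sqr_ge0 (b - c).
by rewrite !expr2; lra.
Qed.

Lemma integral_is_ge0 (f : R -> R) (e : R) : measurable_fun half f -> (forall u, 0 <= f u) ->
  (\int[lebesgue_measure]_(s in half) (f s)%:E <= e%:E)%E ->
  exists2 c, c <= e & integral_is f c.
Proof.
move=> mf f0 fe.
have fi : (@lebesgue_measure R).-integrable half (EFin \o f).
  apply/integrableP; split; first exact/(measurable_realfun.measurable_EFinP _ _).2.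
  apply: le_lt_trans (ltry e); apply: le_trans fe.
  by under eq_integral => u _ do rewrite /= ger0_norm //.
eexists; last by split; [exact: fi|].
rewrite -lee_fin /Rintegral fineK //; exact: integrable_fin_num fi.
Qed.

Lemma simple_integral_riemann k U s t Q : (0 < k)%N -> grid t -> simple_expr At U s ->
  (forall e, e \in s -> compatible t Q e) ->
  simple_integral At (Delta k 0) U = riemann_sum Delta t Q k U.
Proof.
move=> k0 ht hU hc; rewrite (simple_integralE _ hU) (grid_integral _ ht hU hc).
have t0 := grid_ge0 ht; have tm := ht.2.
by apply: eq_bigr => q _; rewrite (Delta_diff hAt hmut hX hDelta).
Qed.

(** The difference of two simple biprocesses is a step function on a common grid.
    Both terms of the isometry are bounded by integrals of the distances to
    [W], without using any integral of [W]. *)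
Lemma simple_integral_dist k U1 U2 W (z1 z2 : L2) (e1 e2 : R) : (0 < k)%N ->
  simple_biprocess At U1 -> simple_biprocess At U2 ->
  measurable_fun half (fun u => tnorm2 (U1 u - W u)) ->
  measurable_fun half (fun u => tnorm2 (U2 u - W u)) ->
  (\int[lebesgue_measure]_(u in half) ((tnorm2 (U1 u - W u)) ^+ 2)%:E <= e1%:E)%E ->
  (\int[lebesgue_measure]_(u in half) ((tnorm2 (U2 u - W u)) ^+ 2)%:E <= e2%:E)%E ->
  vector_integral (fun u => tmul (U1 u - W u)) z1 ->
  vector_integral (fun u => tmul (U2 u - W u)) z2 ->
  n2 (simple_integral At (Delta k 0) U1 - simple_integral At (Delta k 0) U2) <=
    Num.sqrt (`|r (k + k)%N| * (2 * (e1 + e2))) + `|r k| * (vnorm z1 + vnorm z2).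
Proof.
move=> k0 [s1 hs1] [s2 hs2] m1 m2 i1 i2 v1 v2.
have [t [Q [ht hc]]] : exists t Q, grid t /\ forall e, e \in s1 ++ s2 -> compatible t Q e.
  have [a1 _] := hs1; have [a2 _] := hs2.
  by apply: (@compatible_grid _ _ At) => e; rewrite mem_cat => /orP[/a1|/a2].
have hc1 e : e \in s1 -> compatible t Q e by move=> es; apply: hc; rewrite mem_cat es.
have hc2 e : e \in s2 -> compatible t Q e by move=> es; apply: hc; rewrite mem_cat es orbT.
rewrite (simple_integral_riemann k0 ht hs1 hc1) (simple_integral_riemann k0 ht hs2 hc2).
have t0 := grid_ge0 ht; have tm := ht.2.
pose u q := U1 (t q) - U2 (t q).
have E : riemann_sum Delta t Q k U1 - riemann_sum Delta t Q k U2 =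
    \sum_(q < Q) sharp (u q) (Delta k (t q) (t q.+1)).
  by rewrite -sumrB; apply: eq_bigr => q _; rewrite sharpB.
have uE v : 0 <= v -> U1 v - U2 v = step t Q u v.
  move=> v0; rewrite (simple_step ht hs1 hc1 v0) (simple_step ht hs2 hc2 v0) -sumrB.
  by apply: eq_bigr => q _; case: ifP; rewrite ?subrr.
have ad q : (q < Q)%N -> adapted_tens (At (t q)) (u q).
  move=> _; apply: adapted_tensB; [exact: At_sub|exact: simple_adapted hs1 _|].
  exact: simple_adapted hs2 _.
rewrite E; apply: le_trans (isometry_Delta hAt hmut hX hDelta _ tm k0 ad) _; first exact: t0.
apply: lerD; last first.
  rewrite ler_wpM2l //; apply: le_trans (_ : _ <= vnorm (z1 - z2)) _; last first.
    by rewrite -[vnorm z2]vnormN vnorm_add.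
  apply: (vector_integral_step (phi := fun q => tmul (u q)) ht).
  apply: vector_integral_ext (vector_integralB v1 v2) => v v0.
  rewrite -tmulB opprB addrA subrK uE // /step tmul_sum.
  by apply: eq_bigr => q _; case: ifP => // _; rewrite tmul0.
apply: ler_wsqrtr.
have -> : \sum_(q < Q) (t q.+1 - t q) * `|r (k + k)%N| * tnorm2 (u q) ^+ 2 =
    `|r (k + k)%N| * \sum_(q < Q) (t q.+1 - t q) * tnorm2 (u q) ^+ 2.
  by rewrite mulr_sumr; apply: eq_bigr => q _; ring.
rewrite ler_wpM2l //.
have [c1 c1e h1] := integral_is_ge0 (measurable_realfun.measurable_funX 2 m1)
  (fun u => sqr_ge0 _) i1.
have [c2 c2e h2] := integral_is_ge0 (measurable_realfun.measurable_funX 2 m2)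
  (fun u => sqr_ge0 _) i2.
apply: le_trans (_ : _ <= 2 * (c1 + c2)) _; last by rewrite ler_wpM2l // lerD.
apply: integral_is_le (integral_is_step Q (fun q => tnorm2 (u q) ^+ 2) ht)
  (integral_isZ 2 (integral_isD h1 h2)) => v v0.
have -> : step t Q (fun q => tnorm2 (u q) ^+ 2) v = tnorm2 (U1 v - U2 v) ^+ 2.
  rewrite uE //; have [lt|le] := ltP v (t Q); last by rewrite !step_out // tnorm2_0 expr0n.
  by have [q qQ hq] := grid_cell ht v0 lt; rewrite !(step_cell _ ht qQ hq).
have E' : U1 v - U2 v = (U1 v - W v) - (U2 v - W v) by rewrite opprB addrA subrK.
have : tnorm2 (U1 v - U2 v) <= tnorm2 (U1 v - W v) + tnorm2 (U2 v - W v).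
  by rewrite E' -[tnorm2 (U2 v - W v)]tnorm2N tnorm2_add.
move=> abc; exact: sqr_le_sum (tnorm2_ge0 _) abc.
Qed.

Lemma ereal_vanishing (a : nat -> \bar R) : (a n @[n --> \oo] --> 0%E)%E ->
  forall e, 0 < e -> exists N, forall n, (N <= n)%N -> (a n <= e%:E)%E.
Proof.
move=> /fine_cvgP[[N1 _ hN1] hv] e e0.
have [N2 hN2] := vanishing_eps hv e0; exists (maxn N1 N2) => n; rewrite geq_max => /andP[h1 h2].
rewrite -(fineK (hN1 n h1)) lee_fin; exact: le_trans (ler_norm _) (hN2 n h2).
Qed.

(** Used twice: it gives a Cauchy sequence for the sampled biprocesses, and the
    independence of the limit from the approximation. *)
Lemma approximants_close k W Un Vn : (0 < k)%N ->
  approximates At L2 Un W -> approximates At L2 Vn W ->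
  forall e, 0 < e -> exists N, forall m n, (N <= m)%N -> (N <= n)%N ->
  n2 (simple_integral At (Delta k 0) (Un m) - simple_integral At (Delta k 0) (Vn n)) <= e.
Proof.
move=> k0 [s1 m1 i1 [z1 v1 c1]] [s2 m2 i2 [z2 v2 c2]] e e0.
pose g j : R := Num.sqrt (`|r (k + k)%N| * (2 * (j.+1%:R^-1 + j.+1%:R^-1))) +
  `|r k| * (j.+1%:R^-1 + j.+1%:R^-1).
have vi := @vanishing_inv R.
have vg : vanishing g.
  apply: vanishingD; last by apply: vanishingM; apply: vanishingD.
  apply: vanishing_sqrt => [j|]; first by rewrite !mulr_ge0 ?addr_ge0 ?invr_ge0.
  by do 2!apply: vanishingM; apply: vanishingD.
have [j hj] := vanishing_eps vg e0; have {}hj := le_trans (ler_norm _) (hj j (leqnn j)).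
have d0 : 0 < j.+1%:R^-1 :> R by rewrite invr_gt0.
have [N1 h1] := ereal_vanishing i1 d0; have [N2 h2] := ereal_vanishing i2 d0.
have /vcvgP w1 := c1; have /vcvgP w2 := c2.
have [N3 h3] := vanishing_eps w1 d0; have [N4 h4] := vanishing_eps w2 d0.
exists (maxn (maxn N1 N2) (maxn N3 N4)) => m n.
rewrite !geq_max => /andP[/andP[a1 a2] /andP[a3 a4]] /andP[/andP[b1 b2] /andP[b3 b4]].
have := simple_integral_dist k0 (s1 m) (s2 n) (m1 m) (m2 n) (h1 m a1) (h2 n b2) (v1 m) (v2 n).
move=> /le_trans; apply; apply: le_trans hj; rewrite lerD2l ler_wpM2l //.
have := h3 m a3; have := h4 n b4; rewrite !subr0 !ger0_norm ?vnorm_ge0 // => h h'.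
exact: lerD.
Qed.

(** The integrals of the sampled biprocesses are the Riemann sums. *)
Lemma holder_has_integral k t Q C W : (0 < k)%N -> holder_biprocess At t Q C W ->
  exists2 Z : L2, has_integral At (Delta k 0) W Z &
    L2_inj L2 (riemann_sum Delta (refine t N.+1) (Q * N.+1) k W) @[N --> \oo] --> Z.
Proof.
move=> k0 hW; have app := sampled_approximates L2 hW.
set U := fun N => sampled _ _ W in app.
have UE N : simple_integral At (Delta k 0) (U N) =
    riemann_sum Delta (refine t N.+1) (Q * N.+1) k W.
  have hWN := holder_refine (ltn0Sn N) hW; have ht := hb_grid hWN.
  have [s hs hc] := sampled_simple hWN.
  rewrite (simple_integral_riemann k0 ht hs hc); apply: eq_bigr => q _.
  have t0 := grid_ge0 ht; have tm := ht.2.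
  rewrite -(Delta_diff hAt hmut hX hDelta) //.
  exact: step_increment.
pose S (Un : nat -> R -> tens A 2) n := L2_inj L2 (simple_integral At (Delta k 0) (Un n)).
have [Z hZ] : exists Z : L2, S U @ \oo --> Z.
  apply: vcauchy => e e0; have [N hN] := approximants_close k0 app app e0.
  by exists N => m n hm hn; rewrite /S -L2_injB vnorm_L2_inj hN.
exists Z; last by under eq_fun => N do rewrite -UE; exact: hZ.
split; [by move=> u u0; exact: hb_adapted hW u u0|by exists U|move=> Wn hWn].
have /vcvgP v := hZ; apply/vcvgP; apply: eps_vanishing => e e0.
have e20 : 0 < e / 2 by rewrite divr_gt0.
have [N1 h1] := approximants_close k0 hWn app e20.
have [N2 h2] := vanishing_eps v e20.
exists (maxn N1 N2) => n; rewrite geq_max => /andP[n1 n2'].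
have a1 := h1 n n n1 n1; have := h2 n n2'; rewrite !ger0_norm ?vnorm_ge0 // => a2.
rewrite -(subrK (S U n) (L2_inj L2 _)) -addrA.
apply: le_trans (vnorm_add _ _) _; rewrite -L2_injB vnorm_L2_inj [e]splitr.
exact: lerD.
Qed.

End IntegrableBiprocesses.

(** * The product formula *)

Theorem proposition3 (R : realType) (A : tracial_vN R) (L2 : L2_completion A)
    (At : R -> set A) (hAt : vN_filtration At)
    (mu : probability (measurableTypeR R) R)
    (hmu_supp : compactly_supported mu)
    (hmu_fid : freely_infinitely_divisible mu)
    (hmu_var : 'V_mu[idfun] = 1%E)
    (r : nat -> R) (hr : free_cumulants mu r)
    (mut : R -> probability (measurableTypeR R) R)
    (hmut : free_convolution_semigroup r mut)
    (X : R -> R -> A) (hX : free_stochastic_measure At mut X)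
    (Delta : nat -> R -> R -> A)
    (hDelta : forall k, (0 < k)%N -> diagonal_measure X k (Delta k))
    (n : nat) (hn : (0 < n)%N)
    (V : 'I_n -> R -> tens A 2) (hV : forall i, simple_biprocess At (V i)) :
  let M (i : 'I_n) : A := simple_integral At (X 0) (V i) in
  let Mt (i : 'I_n) (t : R) : A :=
    simple_integral At (X 0) (restrict_biprocess 0 t (V i)) in
  exists Z : 'I_n -> L2,
    (forall k : 'I_n,
       has_integral At (Delta k.+1 0) (product_integrand k Mt V) (Z k)) /\
    L2_inj L2 (\prod_(i < n) M i) = \sum_(k < n) Z k.
Proof.
move=> M Mt.
have /choice[s hs] : forall i, exists s, simple_expr At (V i) s by move=> i; exact: hV i.
have [t [Q [ht hc]]] : exists t Q, grid t /\
    forall e, e \in flatten [seq s i | i <- enum 'I_n] -> compatible t Q e.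
  apply: (@compatible_grid _ _ At) => e /flatten_mapP[i _ es].
  by have [h _] := hs i; exact: h.
have hci i e : e \in s i -> compatible t Q e.
  by move=> es; apply: hc; apply/flatten_mapP; exists i; rewrite ?mem_enum.
have /choice[Z hZ] : forall k : 'I_n, exists Z : L2,
    has_integral At (Delta k.+1 0) (product_integrand k Mt V) Z /\
    vanishing (fun N => vnorm (L2_inj L2 (riemann_sum Delta (refine t N.+1) (Q * N.+1) k.+1
      (product_integrand k Mt V)) - Z)).
  move=> k; have [C hW] := integrand_holder hAt hmut hX hs ht hci k.
  have [Z h1 h2] := holder_has_integral L2 hAt hmut hX hDelta (ltn0Sn k) hW.
  by exists Z; split=> //; apply/vcvgP.
exists Z; split=> [k|]; first by have [] := hZ k.
apply/eqP; rewrite -subr_eq0; apply/eqP; apply: vnorm_eq0; apply/le_anti.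
rewrite vnorm_ge0 andbT.
have v := vanishingD (riemann_sum_limit hAt hmut hX hDelta hs ht hci hn)
  (vanishing_sum (enum 'I_n) (fun k => (hZ k).2)).
apply: vanishing_le0 v => N; rewrite big_enum /=.
set S := fun k : 'I_n => riemann_sum Delta (refine t N.+1) (Q * N.+1) k.+1 (product_integrand k Mt V).
have -> : L2_inj L2 (\prod_(i < n) M i) - \sum_(k < n) Z k =
    L2_inj L2 (\prod_(i < n) M i - \sum_(k < n) S k) + \sum_(k < n) (L2_inj L2 (S k) - Z k).
  by rewrite L2_injB sumrB L2_inj_sum addrA subrK.
apply: le_trans (vnorm_add _ _) _; rewrite vnorm_L2_inj; apply: lerD => //.
exact: vnorm_sum.
Qed.
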